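(* Let $\mu$ be a doubling measure on $\mathbb{R}^n$ with support $\Sigma$, let $1<\lambda_1<\lambda_2<\infty$, and let $\Sigma_0,\Sigma_2\subset\Sigma$ be defined as in the context. For $1\le d\le n$ set $$\mathcal S''_d=\{x\in\Sigma_0\cap\Sigma_2:\ \mathrm{Tan}(\mu,x)\subset\mathcal F_d\}.$$ Then for every $1\le d\le n$ and every $x\in\mathcal S''_d$ the limit $$\theta_d(x)=\lim_{r\to0}r^{-d}\mu(B(x,r))$$ exists and belongs to $(0,\infty)$. Moreover, for every $k\in\mathbb{Z}$, the measures $\mu$ and $\mathcal H^d$ are mutually absolutely continuous on the set $\{x\in\mathcal S''_d:\ 2^k\le\theta_d(x)<2^{k+1}\}$.
   Context: $B(x,r)$ is the open ball in $\mathbb{R}^n$ and $\mathbb{B}=B(0,1)$. A Radon measure $\mu$ on $\mathbb{R}^n$ is a locally finite positive Borel measure; its support is $\Sigma=\{x\in\mathbb{R}^n:\mu(B(x,r))>0\text{ for all }r>0\}$. $\mu$ is doubling if it is Radon and there is a constant $C_\delta>0$ with $\mu(B(x,2r))\le C_\delta\,\mu(B(x,r))$ for all $x\in\Sigma$, $r>0$. $\mathrm{Lip}_1(\mathbb{B})$ is the set of $1$-Lipschitz functions $\psi:\mathbb{R}^n\to\mathbb{R}$ with $\psi=0$ on $\mathbb{R}^n\setminus\mathbb{B}$. For measures $\mu,\nu$ whose restrictions to $\mathbb{B}$ are probability measures, $\mathbb{W}_1(\mu,\nu)=\sup_{\psi\in\mathrm{Lip}_1(\mathbb{B})}\left|\int\psi\,d\mu-\int\psi\,d\nu\right|$.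 $\mathcal R$ is the group of affine isometries of $\mathbb{R}^n$; $\mathcal G=\{\lambda R:\lambda>0,\ R\in\mathcal R\}$, and for $G\in\mathcal G$, $\lambda(G)>0$ is the unique number with $G=\lambda(G)R$, $R\in\mathcal R$. For $x\in\mathbb{R}^n$, $r>0$, $\mathcal G(x)=\{G\in\mathcal G:G(x)=0\}$ and $\mathcal G(x,r)=\{G\in\mathcal G(x):\lambda_1r\le\lambda(G)^{-1}\le\lambda_2r\}$. For $G\in\mathcal G$, $\mu^G(A)=\mu(G^{-1}(A))$ for Borel $A$; for $x\in\Sigma$ and $G\in\mathcal G(x)$, $\mu_0^G=\mu^G/\mu^G(\mathbb{B})$. Also $\mu^{x,r}(A)=\mu(x+rA)$ and $\mu_0^{x,r}=\mu^{x,r}/\mu(B(x,r))$. For $x\in\Sigma$, $r>0$, $\alpha_{\mathcal G}(x,r)=\inf_{G\in\mathcal G(x,r)}\mathbb{W}_1(\mu_0^G,\mu_0^{x,r})$ and $$\alpha_{\mathcal G}^\ast(x,r)=\frac{1}{\mu(B(x,r))}\int_{B(x,r)}\frac1r\int_r^{2r}\alpha_{\mathcal G}(y,t)\,dt\,d\mu(y).$$ $\Sigma_0=\{x\in\Sigma:\lim_{r\to0}\alpha^\ast_{\mathcal G}(x,r)=0\}$ and $\Sigma_2=\{x\in\Sigma:\int_0^1\alpha_{\mathcal G}(x,r)\frac{\log(1/r)\,dr}{r}<\infty\}$. $\mathrm{Tan}(\mu,x)$ is the set of non-zero Radon measures $\sigma$ for which there exist $r_k>0$ with $r_k\to0$ and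 $a_k\ge0$ such that $a_k\mu^{x,r_k}\to\sigma$ weakly (tested against continuous compactly supported functions). $\mathcal F_d$ is the set of measures $c\,\mathcal H^d|_V$ with $c\ge0$ and $V$ a $d$-dimensional vector subspace of $\mathbb{R}^n$; $\mathcal H^d$ is $d$-dimensional Hausdorff measure. *)

(* Defs.v *)
(* MathComp-Analysis; R^n is 'rV[R]_n for an arbitrary R : realType. *)
From HB Require Import structures.
From mathcomp Require Import all_boot all_order all_algebra.
From mathcomp Require Import all_classical all_reals all_analysis.

Set Implicit Arguments.
Unset Strict Implicit.
Unset Printing Implicit Defensive.

Import Order.TTheory GRing.Theory Num.Theory.
Import numFieldNormedType.Exports.

Local Open Scope classical_set_scope.
Local Open Scope ring_scope.

(* Borel sigma-algebra. The library topology of 'rV[R]_n comes from the sup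
   norm, hence has the same open sets as the Euclidean one. *)
HB.instance Definition _ (R : realType) (n : nat) :=
  Measurable.copy 'rV[R]_n (g_sigma_algebraType (@open 'rV[R]_n)).

Section EuclideanSpace.
Context (R : realType) (n : nat).
Implicit Types (x y : 'rV[R]_n) (r lam : R) (f G : 'rV[R]_n -> 'rV[R]_n).

(* The library norm `|x| on 'rV[R]_n is the sup norm. *)
Definition enorm x : R := Num.sqrt (\sum_(i < n) x ord0 i ^+ 2).

Definition eball x r : set 'rV[R]_n := [set y | enorm (y - x) < r].

Definition eisometry f : Prop :=
  forall x y, enorm (f x - f y) = enorm (x - y).

Definition affine_map f : Prop :=
  exists (M : 'M[R]_n) (b : 'rV[R]_n), forall x, f x = x *m M + b.

Definition affine_isometry f : Prop := affine_map f /\ eisometry f.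

(* G = lam T with lam > 0 and T an affine isometry; for n >= 1 the ratio lam is
   determined by G. *)
Definition similarity lam G : Prop :=
  0 < lam /\
  exists2 T, affine_isometry T & forall x, G x = lam *: T x.

Definition simG (l1 l2 : R) x r : set ('rV[R]_n -> 'rV[R]_n) :=
  [set G | exists lam,
     [/\ similarity lam G, G x = 0 & l1 * r <= lam^-1 <= l2 * r]].

Definition Lip1 : set ('rV[R]_n -> R) :=
  [set psi | (forall x y, `|psi x - psi y| <= enorm (x - y)) /\
             (forall x, ~ eball 0 1 x -> psi x = 0)].

End EuclideanSpace.

Section Measures.
Context (R : realType) (n : nat).
Local Notation Rn := 'rV[R]_n.
Local Open Scope ereal_scope.

(* Operations on measures are defined on plain set functions; library integrals
   accept these. *)
Implicit Types (mu nu : set Rn -> \bar R) (x y : Rn) (r : R).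

Definition radon mu : Prop := forall x, exists2 r, (0 < r)%R & mu (eball x r) < +oo.

Definition msupport mu : set Rn :=
  [set x | forall r, (0 < r)%R -> 0 < mu (eball x r)].

Definition doubling mu : Prop :=
  radon mu /\
  exists2 C : R, (0 < C)%R &
    forall x r, msupport mu x -> (0 < r)%R ->
      mu (eball x (2 * r)) <= C%:E * mu (eball x r).

Definition W1 mu nu : \bar R :=
  ereal_sup [set `| \int[mu]_z (psi z)%:E - \int[nu]_z (psi z)%:E |
            | psi in @Lip1 R n].

Definition scalem (c : R) mu : set Rn -> \bar R := fun A => c%:E * mu A.

(* mu / mu(B(0,1)) *)
Definition normalize1 mu : set Rn -> \bar R :=
  scalem (fine (mu (eball 0%R 1)))^-1 mu.

(* A |-> mu (x + r A) *)
Definition blowup mu x r : set Rn -> \bar R :=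
  fun A => mu ((fun y => x + r *: y)%R @` A).

Definition blowup0 mu x r : set Rn -> \bar R :=
  scalem (fine (mu (eball x r)))^-1 (blowup mu x r).

Definition alphaG (l1 l2 : R) mu x r : \bar R :=
  ereal_inf [set W1 (normalize1 (pushforward mu G)) (blowup0 mu x r)
            | G in simG l1 l2 x r].

(* Points y outside the support of mu, where alphaG is not meaningful, form a
   mu-null set. *)
Definition alphaG_star (l1 l2 : R) mu x r : \bar R :=
  (fine (mu (eball x r)))^-1%:E *
  \int[mu]_(y in eball x r)
    (r^-1%:E * \int[lebesgue_measure]_(t in `[r, (2 * r)%R]) alphaG l1 l2 mu y t).

Definition Sigma0 (l1 l2 : R) mu : set Rn :=
  [set x | msupport mu x /\
           alphaG_star l1 l2 mu x r @[r --> (0%R : R)^'+] --> 0].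

Definition Sigma2 (l1 l2 : R) mu : set Rn :=
  [set x | msupport mu x /\
           \int[lebesgue_measure]_(r in `]0%R, 1%R[)
              (alphaG l1 l2 mu x r * (ln r^-1 / r)%:E) < +oo].

Definition weak_cvg (nu : nat -> set Rn -> \bar R) (sigma : set Rn -> \bar R) :=
  forall phi : Rn -> R, continuous phi ->
    compact (closure [set z | phi z != 0%R]) ->
    \int[nu k]_z (phi z)%:E @[k --> \oo] --> \int[sigma]_z (phi z)%:E.

Definition Tan mu x : set {measure set Rn -> \bar R} :=
  [set sigma : {measure set Rn -> \bar R} |
    [/\ radon sigma, sigma setT != 0 &
     exists r a : nat -> R,
       [/\ forall k, (0 < r k)%R, forall k, (0 <= a k)%R,
           r @ \oo --> (0%R : R) &
           weak_cvg (fun k => scalem (a k) (blowup mu x (r k))) sigma]]].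

(* The singleton [set 0] makes the diameter of the empty set 0, not -oo. *)
Definition diam (A : set Rn) : \bar R :=
  ereal_sup ([set 0] `|` [set (enorm (x - y)%R)%:E | x in A & y in A]).

Definition hausdorff_pre (d : nat) (delta : R) (A : set Rn) : \bar R :=
  ereal_inf [set \sum_(0 <= i <oo) diam (F i) ^+ d
            | F in [set F : nat -> set Rn |
                     A `<=` \bigcup_i F i /\ forall i, diam (F i) <= delta%:E]].

(* Hausdorff (outer) measure without the dimensional normalizing constant;
   meant for d >= 1. *)
Definition hausdorff (d : nat) (A : set Rn) : \bar R :=
  ereal_sup [set hausdorff_pre d delta A | delta in [set delta : R | (0 < delta)%R]].

Definition flat (d : nat) : set {measure set Rn -> \bar R} :=
  [set sigma : {measure set Rn -> \bar R} |
    exists (c : R) (V : {vspace Rn}),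
      [/\ (0 <= c)%R, \dim V = d &
        forall A, measurable A ->
          sigma A = c%:E * hausdorff d (A `&` [set v | v \in V])]].

Definition Sdd (l1 l2 : R) mu (d : nat) : set Rn :=
  [set x | [/\ Sigma0 l1 l2 mu x, Sigma2 l1 l2 mu x & Tan mu x `<=` flat d]].

Definition density_ratio mu (d : nat) x r : \bar R :=
  (r ^- d)%:E * mu (eball x r).

Definition theta mu (d : nat) x : \bar R :=
  lim (density_ratio mu d x r @[r --> (0%R : R)^'+]).

(* nu-null subsets of E are mu-null, where null means contained in a Borel set
   of measure zero; when E is Borel this is absolute continuity of the
   restriction of mu to E with respect to the restriction of nu to E. *)
Definition abs_cont_on mu nu (E : set Rn) : Prop :=
  forall A, A `<=` E -> nu.-negligible A -> mu.-negligible A.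

End Measures.

(* Main.v *)
(** Fix [x], a base [b < 1] and the radial cut-off [phi] that equals 1 on
    [B(0,b)] and 0 off [B(0,1)]; write [M(r) = mu(B(x,r))] and let [m(r)] be the
    integral of [phi((z - x)/r)], so that [M(br) <= m(r) <= M(r)].  Since [phi]
    is radial, a similarity [G] nearly optimal in [alphaG x r] gives a scale
    [s], comparable with [r] and larger by a factor at least [l1], at which the
    normalized profile [m(rho s)/M(s)] differs from that at [r] by
    O([alphaG x r]).  Hence [q(r) = |log(b^-d m(br)/m(r))|] satisfies
    [q(r) <= q(r') + C e_k] for some [r' <= r/l1] when [r] is of size [b^k],
    where [sum k e_k < oo] by the definition of [Sigma2].  All tangent measures
    being flat, compactness of the rescaled measures gives [q(r) -> 0], so
    chaining down to scale 0 yields [q(b^k) <= C sum_(i >= k) e_i], whose sum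
    over [k] is at most [C sum k e_k].  Thus [b^(-kd) m(b^k)] converges in
    (0,oo), and [b -> 1] gives the density itself.

    The set then splits into countably many pieces on which
    [r^d/m <= M(r) <= m r^d] for [r < 1/m]; there null sets are compared
    directly from covers in one direction, and through outer regularity of [mu]
    and the Vitali covering lemma in the other. *)

Require Import Defs.
From HB Require Import structures.
From mathcomp Require Import all_boot all_order all_algebra.
From mathcomp Require Import all_classical all_reals all_analysis.
From mathcomp Require Import measurable_realfun zify ring lra.

Set Implicit Arguments.
Unset Strict Implicit.
Unset Printing Implicit Defensive.

Import Order.TTheory GRing.Theory Num.Theory.
Import numFieldNormedType.Exports.

Local Open Scope classical_set_scope.
Local Open Scope ring_scope.

(** The tangents alone make q small without any rate, so q cannot be summed from them; [alphaG]
    supplies the rate, but its similarity is unknown apart from a range of ratios. Two choices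
    absorb this. The test functions are Lipschitz, because [W1] sees nothing else. And q uses a
    quotient of two smoothed masses taken at the same base scale, so that the unknown normalizing
    masses cancel. Since l1 > 1, every comparison descends by a definite factor; a chain therefore
    spends boundedly many steps in each b-adic interval and ends where flatness of the tangents
    takes over. For a fixed b the density is only trapped up to a power of b, whose exponent depends
    on d alone; this is what makes the passage b -> 1 work. No measurability is known for [alphaG]
    as a function of the scale, nor for the level sets of [theta]. So the integral of [alphaG]
    enters only through measurable minorants, and null sets are compared for arbitrary sets by
    constructing Borel hulls. Compactness of the rescaled measures must produce a genuine Borel
    measure, which is obtained by the Daniell extension of a limiting positive functional. *)

Section Series.
Context (R : realType).
Local Open Scope ereal_scope.

(** One enumeration [f] serves both purposes: it flattens a doubly indexed family of functions or
    sets, and it flattens the corresponding sums. *)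
Lemma nneseries_pair : exists2 f : nat -> nat * nat,
  forall i j, exists k, f k = (i, j) &
  forall a : nat -> nat -> \bar R, (forall i j, 0 <= a i j) ->
  \sum_(0 <= k <oo) a (f k).1 (f k).2 =
  \sum_(0 <= i <oo) \sum_(0 <= j <oo) a i j.
Proof.
have /card_esym/ppcard_eqP[f] := card_nat2.
have bf : set_bij [set: nat] [set: nat * nat] f by exact: bij.
exists f => [i j|a a0].
  by have [_ _ /(_ (i, j) I)[k _ fk]] := bf; exists k.
rewrite nneseries_esumT; last by move=> k; exact: a0.
transitivity (\esum_(p in [set: nat * nat]) a p.1 p.2).
  by rewrite [RHS](reindex_esum setT setT f).
rewrite nneseries_esumT; last by move=> i; exact: nneseries_ge0.
under [RHS]eq_esum do rewrite nneseries_esumT//.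
rewrite esum_esum//; congr esum; apply/seteqP; split=> //.
Qed.

Lemma nneseries_addl_le (T : nat -> \bar R) (x b : \bar R) :
  (forall i, 0 <= T i) -> 0 <= x ->
  (forall N, \sum_(0 <= i < N) T i + x <= b) ->
  \sum_(0 <= i <oo) T i + x <= b.
Proof.
move=> T0 x0 H; have [xy|xfin] := eqVneq x +oo.
  have := H 0%N; rewrite xy big_geq// add0e => /(le_trans _); apply.
  exact: leey.
have xf : x \is a fin_num by rewrite ge0_fin_numE// lt_neqAle xfin leey.
rewrite -leeBrDr//; apply: lime_le; first exact: is_cvg_nneseries.
by apply: nearW => N; rewrite leeBrDr.
Qed.

Lemma nneseries1 (T : nat -> \bar R) (k : nat) :
  (forall i, i != k -> T i = 0) -> 0 <= T k -> \sum_(0 <= i <oo) T i = T k.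
Proof.
move=> T0 Tk; rewrite (@nneseriesD1 _ _ k)//; last first.
  by move=> i _; have [->//|/T0 ->] := eqVneq i k.
by rewrite eseries0 ?adde0// => i _ /andP[_] /T0.
Qed.

End Series.

(** * Continuous functions with compact support *)

Section TestFunctions.
Context (R : realType) (n : nat).
Local Notation Rn := 'rV[R]_n.
Implicit Types (f g u : Rn -> R).

(** Restricting to nonnegative functions gives a cone, on which positive functionals need only be
    additive and homogeneous for scalars >= 0. Vanishing off a sup-norm ball amounts to compact
    support. *)
Definition ccp f : Prop :=
  [/\ continuous f, forall z, 0 <= f z & exists M, forall z, M < `|z| -> f z = 0].

Lemma ccpD f g : ccp f -> ccp g -> ccp (fun z => f z + g z).
Proof.
move=> [fc f0 [M fM]] [gc g0 [N gN]]; split.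
- by move=> z; apply: (@continuousD _ _ _ f g z); [exact: fc|exact: gc].
- by move=> z; exact: addr_ge0.
- exists (Num.max M N) => z; rewrite gt_max => /andP[? ?].
  by rewrite fM// gN// addr0.
Qed.

Lemma ccpM f u : ccp f -> continuous u -> (forall z, 0 <= u z) ->
  ccp (fun z => f z * u z).
Proof.
move=> [fc f0 [M fM]] uc u0; split.
- by move=> z; apply: continuousM; [exact: fc|exact: uc].
- by move=> z; exact: mulr_ge0.
- by exists M => z Mz; rewrite fM// mul0r.
Qed.

Lemma ccpB f g : ccp f -> ccp g -> (forall z, g z <= f z) ->
  ccp (fun z => f z - g z).
Proof.
move=> [fc f0 [M fM]] [gc g0 [N gN]] gf; split.
- by move=> z; apply: continuousB; [exact: fc|exact: gc].
- by move=> z; rewrite subr_ge0.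
- exists (Num.max M N) => z; rewrite gt_max => /andP[? ?].
  by rewrite fM// gN// subr0.
Qed.

Lemma ccpZ f c : ccp f -> 0 <= c -> ccp (fun z => c * f z).
Proof.
move=> fcc c0; rewrite (_ : (fun _ => _) = (fun z => f z * c)).
  by apply: (ccpM fcc) => //; exact: (@cst_continuous Rn R).
by apply/funext => z; rewrite mulrC.
Qed.

Lemma ccp0 : ccp (fun=> 0).
Proof. by split=> //; [exact: (@cst_continuous Rn R)|exists 0]. Qed.

Lemma ccp_sum (p : nat -> Rn -> R) N : (forall i, ccp (p i)) ->
  ccp (fun z => \sum_(0 <= i < N) p i z).
Proof.
move=> pc; elim: N => [|N IH].
  rewrite (_ : (fun _ => _) = (fun=> 0)); first exact: ccp0.
  by apply/funext => z; rewrite big_geq.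
rewrite (_ : (fun _ => _) = (fun z => \sum_(0 <= i < N) p i z + p N z)).
  exact: ccpD.
by apply/funext => z; rewrite big_nat_recr.
Qed.

Lemma continuous_clamp u a b : continuous u ->
  continuous (fun z => Num.min a (Num.max b (u z))).
Proof.
move=> uc; apply: (@min_fun_continuous _ _ _ (cst a)); first exact: cst_continuous.
by apply: (@max_fun_continuous _ _ _ (cst b)) => //; exact: cst_continuous.
Qed.

Lemma ccp_bump (M : R) : exists2 f, ccp f & forall z, `|z| <= M -> f z = 1.
Proof.
exists (fun z => Num.min 1 (Num.max 0 (M + 1 - `|z|))).
  split.
  - apply: continuous_clamp => z.
    apply: (@continuousB _ _ _ (cst (M + 1)) (fun z : Rn => `|z|)).
      exact: cst_continuous.
    exact: norm_continuous.
  - by move=> z; rewrite le_min ler01/= le_max lexx.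
  - exists (M + 1) => z Mz; rewrite max_l; last by rewrite subr_le0 ltW.
    by rewrite min_r.
move=> z zM; rewrite min_l// le_max; apply/orP; right.
by rewrite lerBrDr addrC lerD2r.
Qed.

Lemma open_Borel (U : set Rn) : open U -> measurable U.
Proof. exact: sub_sigma_algebra. Qed.

Lemma closed_Borel (U : set Rn) : closed U -> measurable U.
Proof. by move=> Uc; rewrite -(setCK U); apply: measurableC; apply: open_Borel; exact: closed_openC. Qed.

Lemma continuous_Borel (u : Rn -> R) : continuous u -> measurable_fun setT u.
Proof.
move=> uc; apply: (measurability _ (RGenOInfty.measurableE R)) => //.
move=> _ [_ [a ->] <-]; rewrite setTI; apply: open_Borel.
by apply: open_comp; [move=> z _; exact: uc|exact: rray_open].
Qed.

Lemma ccp_Borel f : ccp f -> measurable_fun setT (fun x : Rn => (f x)%:E).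
Proof. by move=> [fc _ _]; apply/measurable_EFinP; exact: continuous_Borel. Qed.

Lemma continuous_Borel_fun (G : Rn -> Rn) : continuous G -> measurable_fun setT G.
Proof.
move=> Gc; apply: (measurability (@open Rn)) => // _ [U oU <-].
by rewrite setTI; apply: open_Borel; apply: open_comp => // z _; exact: Gc.
Qed.

Lemma superlevel_compact f a : ccp f -> 0 < a -> compact [set z | a <= f z].
Proof.
move=> [fc f0 [M fM]] a0; apply: bounded_closed_compact.
  exists M; split; first exact: num_real.
  move=> x Mx z /= az; apply: ltW; rewrite ltNge; apply/negP => xz.
  by move: az; rewrite fM ?(lt_le_trans Mx xz)// leNgt a0.
rewrite (_ : [set z | _] = f @^-1` [set x | a <= x])//.
by apply: closed_comp; [move=> z _; exact: fc|exact: closed_ge].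
Qed.

Lemma closed_norm_ball_compact (M : R) : compact [set z : Rn | `|z| <= M].
Proof.
apply: bounded_closed_compact.
  by exists M; split; [exact: num_real|move=> x Mx z /= /le_trans; apply; exact: ltW].
rewrite (_ : [set z | _] = (fun z : Rn => `|z|) @^-1` [set x | x <= M])//.
by apply: closed_comp; [move=> z _; exact: norm_continuous|exact: closed_le].
Qed.

Lemma lipschitz_norm_continuous (u : Rn -> R) (k : R) : 0 <= k ->
  (forall x z : Rn, `|u x - u z| <= k * `|x - z|) -> continuous u.
Proof.
move=> k0 H; suff: forall z : Rn, u y @[y --> z] --> u z by [].
move=> z; apply/(@cvgrPdist_lt _ R^o Rn (nbhs z) (nbhs_filter z) u (u z)) => e e0.
have k1 : 0 < k + 1 by rewrite ltr_wpDl.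
have e1 : 0 < e / (k + 1) by rewrite divr_gt0.
apply: filterS (nbhsx_ballx z (e / (k + 1)) e1) => x; rewrite -ball_normE /= => zx.
apply: (le_lt_trans (H z x)).
apply: (@le_lt_trans _ _ ((k + 1) * `|z - x|)); first by rewrite ler_wpM2r// lerDl.
by rewrite mulrC -ltr_pdivlMr.
Qed.

Lemma compact_nondecreasing_cover (K : set Rn) (U : nat -> set Rn) : compact K ->
  (forall N, open (U N)) -> (forall N m, (N <= m)%N -> U N `<=` U m) ->
  K `<=` \bigcup_N U N -> exists N, K `<=` U N.
Proof.
rewrite compact_cover => cK oU Um KU.
have [D _ KD] := cK nat setT U (fun N _ => oU N) KU.
exists (\max_(i <- finmap.enum_fset D) i)%N => x /KD[i iD Uix]; apply: (Um i) => //.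
by apply: (@leq_bigmax_seq _ _ xpredT id).
Qed.

Lemma open_positivity (U : set Rn) : open U -> exists2 g : Rn -> R,
  continuous g /\ (forall z, 0 <= g z) & U = [set z | 0 < g z].
Proof.
(* The function is the sup-norm distance to the complement, except when the complement is empty: an
   infimum over the empty set would be 0. *)
move=> oU; have [UC|/set0P [y0 Uy0]] := eqVneq (~` U) set0.
  exists (fun=> 1); first by split=> //; exact: (@cst_continuous Rn R).
  by rewrite -(setCK U) UC setC0; apply/seteqP; split => z _ //=; exact: ltr01.
pose d (z : Rn) := inf [set `|z - y| | y in ~` U].
have d0 z : 0 <= d z.
  by apply: lb_le_inf; [exists `|z - y0|; exists y0|move=> _ [y _ <-]].
have hi z : has_inf [set `|z - y| | y in ~` U].
  split; first by exists `|z - y0|; exists y0.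
  by exists 0 => _ [y _ <-].
have dL x z : d x <= d z + `|x - z|.
  rewrite -lerBlDr; apply: lb_le_inf; first exact: (hi z).1.
  move=> _ [y Uy <-]; rewrite lerBlDr.
  apply: (@le_trans _ _ `|x - y|).
    by apply: ge_inf; [exact: (hi x).2|exists y].
  by rewrite [leRHS]addrC; exact: ler_distD.
exists d.
  split=> //; apply: (@lipschitz_norm_continuous d 1) => // x z; rewrite mul1r.
  rewrite ler_norml !lerBlDl dL andbT lerBrDr addrC -lerBrDr opprK.
  by rewrite -normrN opprB; exact: dL.
apply/seteqP; split => z /=.
  move=> Uz; have /nbhs_ballP[e /= e0 eU] := open_nbhs_nbhs (conj oU Uz).
  apply: (lt_le_trans e0); apply: lb_le_inf; first exact: (hi z).1.
  move=> _ [y Uy <-]; rewrite leNgt; apply/negP => zy; apply: Uy; apply: eU.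
  by rewrite -ball_normE.
apply: contraPP => Uz; apply/negP; rewrite -leNgt.
by apply: ge_inf; [exact: (hi z).2|exists z => //; rewrite subrr normr0].
Qed.

Lemma ccp_ge0 f x : ccp f -> 0 <= f x. Proof. by case. Qed.

Lemma ccp_bounded f : ccp f -> exists2 M : R, forall x, f x <= M &
  forall x : Rn, M < `|x| -> f x = 0.
Proof.
move=> [fcont fge [M fM]].
have cK := @closed_norm_ball_compact M.
have [B [_ HB]] : bounded_set [set f z | z in [set z : Rn | `|z| <= M]].
  apply: compact_bounded; apply: continuous_compact => //.
  by apply: continuous_subspaceT.
pose M' := Num.max M (Num.max 0 (B + 1)).
exists M'.
  move=> x; have [xM|Mx] := leP `|x| M.
    apply: (le_trans (ler_norm _)); rewrite /M' !le_max; apply/orP; right; apply/orP; right.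
    by apply: (HB (B + 1)); [rewrite ltrDl|exists x].
  by rewrite fM// /M' !le_max lexx orbT.
by move=> x; rewrite /M' gt_max => /andP[/fM].
Qed.

Lemma closed_norm_ball_Borel (M : R) : measurable [set z : Rn | `|z| <= M].
Proof.
by apply: closed_Borel; apply: compact_closed;
  [exact: norm_hausdorff|exact: closed_norm_ball_compact].
Qed.

Lemma ccp_integral_ge (nu : {measure set Rn -> \bar R}) (A : set Rn) f c : measurable A -> ccp f -> 0 <= c ->
  (forall x, A x -> c <= f x) -> (c%:E * nu A <= \int[nu]_x (f x)%:E)%E.
Proof.
move=> mA fc c0 cf; rewrite -(setIT A) -integral_indic//.
rewrite -ge0_integralZl//; last exact/measurable_EFinP/measurable_indic.
apply: ge0_le_integral => //.
- by move=> x _; rewrite mule_ge0.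
- by apply: measurable_funeM; exact/measurable_EFinP/measurable_indic.
- exact: ccp_Borel.
move=> x _; rewrite -EFinM lee_fin indicE; have [/set_mem/cf|_] := boolP (x \in A).
  by rewrite mulr1.
by rewrite mulr0 ccp_ge0.
Qed.

Lemma ccp_integral_le (nu : {measure set Rn -> \bar R}) (K : set Rn) (f : Rn -> R) (c : R) :
  ccp f -> measurable K -> 0 <= c ->
  (forall x, f x <= c) -> (forall x, ~ K x -> f x = 0) ->
  (\int[nu]_x (f x)%:E <= c%:E * nu K)%E.
Proof.
move=> fc mK c0 fle fK; rewrite -(setIT K) -integral_indic//.
rewrite -ge0_integralZl//; last exact/measurable_EFinP/measurable_indic.
apply: ge0_le_integral => //.
- by move=> x _; rewrite lee_fin; case: fc.
- exact: ccp_Borel.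
- by apply: measurable_funeM; exact/measurable_EFinP/measurable_indic.
move=> x _; rewrite -EFinM lee_fin indicE; have [_|/negP] := boolP (x \in K).
  by rewrite mulr1.
by rewrite inE => /fK ->; rewrite mulr0.
Qed.

Lemma ccp_integral_fin (nu : {measure set Rn -> \bar R}) f :
  (forall M : R, nu [set z : Rn | (`|z| <= M)%R] < +oo)%E -> ccp f ->
  (\int[nu]_x (f x)%:E)%E \is a fin_num.
Proof.
move=> nufin fc; rewrite ge0_fin_numE; last first.
  by apply: integral_ge0 => x _; rewrite lee_fin ccp_ge0.
have [M fM f0M] := ccp_bounded fc.
have M0 : 0 <= M by apply: le_trans (fM 0); exact: ccp_ge0.
apply: (le_lt_trans (ccp_integral_le nu fc (closed_norm_ball_Borel M) M0 fM _)).
  by move=> x /= /negP; rewrite -ltNge => /f0M.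
by rewrite lte_mul_pinfty// lee_fin.
Qed.

End TestFunctions.

(** * The Riesz representation theorem *)

Section Riesz.
Context (R : realType) (n : nat).
Local Notation Rn := 'rV[R]_n.
Variable L : (Rn -> R) -> R.
Hypothesis L_ge0 : forall f, ccp f -> 0 <= L f.
Hypothesis LD : forall f g, ccp f -> ccp g -> L (fun z => f z + g z) = L f + L g.
Hypothesis LZ : forall f c, ccp f -> 0 <= c -> L (fun z => c * f z) = c * L f.

Let L0 : L (fun=> 0) = 0.
Proof.
rewrite -[RHS](mul0r (L (fun=> 0))) -LZ//; last exact: ccp0.
by congr L; apply/funext => z; rewrite mul0r.
Qed.

Let L_le f g : ccp f -> ccp g -> (forall z, f z <= g z) -> L f <= L g.
Proof.
move=> fc gc fg; rewrite (_ : g = (fun z => f z + (g z - f z))).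
  by rewrite LD//; [rewrite lerDl; apply: L_ge0|]; exact: ccpB.
by apply/funext => z; rewrite addrC subrK.
Qed.

Let L_sum (p : nat -> Rn -> R) N : (forall i, ccp (p i)) ->
  L (fun z => \sum_(0 <= i < N) p i z) = \sum_(0 <= i < N) L (p i).
Proof.
move=> pc; elim: N => [|N IH].
  by rewrite big_geq// -[RHS]L0; congr L; apply/funext => z; rewrite big_geq.
rewrite big_nat_recr//= -IH -LD//; last exact: ccp_sum.
by congr L; apply/funext => z; rewrite big_nat_recr.
Qed.

Local Open Scope ereal_scope.

(** Series of test functions dominating the indicator of A. The infimum of their total [L]-values is
    Daniell's upper integral of that indicator; allowing infinite series makes it countably
    subadditive. *)
Definition daniell_cover (A : set Rn) : set (nat -> Rn -> R) :=
  [set p | (forall i, ccp (p i)) /\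
           forall x, A x -> 1 <= \sum_(0 <= i <oo) (p i x)%:E].

Definition daniell (A : set Rn) : \bar R :=
  ereal_inf [set \sum_(0 <= i <oo) (L (p i))%:E | p in daniell_cover A].

Let D_ge0 A : 0 <= daniell A.
Proof.
apply: le_ereal_inf_tmp => _ [p [pc _] <-]; apply: nneseries_ge0 => i _ _.
by rewrite lee_fin L_ge0.
Qed.

Let D_le A p : daniell_cover A p -> daniell A <= \sum_(0 <= i <oo) (L (p i))%:E.
Proof. by move=> Ap; apply: ereal_inf_lbound; exists p. Qed.

Let D_mono : {homo daniell : A B / A `<=` B >-> A <= B}.
Proof.
move=> A B AB; apply: ereal_inf_le_tmp => _ [p [pc pB] <-].
by exists p => //; split => // x /AB/pB.
Qed.

Let D0 : daniell set0 = 0.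
Proof.
apply/eqP; rewrite eq_le D_ge0 andbT.
apply: (le_trans (@D_le _ (fun _ _ => 0%R) _)).
  by split => // i; exact: ccp0.
by rewrite eseries0// => i _ _; rewrite L0.
Qed.

Let D_le2 A (p : nat -> nat -> Rn -> R) : (forall i j, ccp (p i j)) ->
  (forall x, A x -> 1 <= \sum_(0 <= i <oo) \sum_(0 <= j <oo) (p i j x)%:E) ->
  daniell A <= \sum_(0 <= i <oo) \sum_(0 <= j <oo) (L (p i j))%:E.
Proof.
move=> pc pA; have [f _ Hf] := nneseries_pair R.
rewrite -(Hf (fun i j => (L (p i j))%:E)); last by move=> i j; rewrite lee_fin L_ge0.
apply: (@D_le _ (fun k => p (f k).1 (f k).2)); split => [k//|x Ax].
rewrite (Hf (fun i j => (p i j x)%:E)); last by move=> i j; rewrite lee_fin ccp_ge0.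
exact: pA.
Qed.

Let D_sigma : sigma_subadditive daniell.
Proof.
move=> A; have [[i ioo]|] := pselect (exists i, daniell (A i) = +oo).
  rewrite (eseries_pinfty _ _ ioo) ?leey// => k _.
  by rewrite -ltNye (lt_le_trans _ (D_ge0 _)).
rewrite -forallNE => Aoo.
apply/lee_addgt0Pr => e e0.
rewrite (le_trans _ (epsilon_trick _ _ (ltW e0)))//.
have [p pP] : {p : nat -> nat -> Rn -> R & forall k, daniell_cover (A k) (p k) /\
    \sum_(0 <= j <oo) (L (p k j))%:E <= daniell (A k) + (e / (2 ^ k.+1)%:R)%:E}.
  apply: (@choice _ _ (fun k q => daniell_cover (A k) q /\
    \sum_(0 <= j <oo) (L (q j))%:E <= daniell (A k) + (e / (2 ^ k.+1)%:R)%:E)) => k.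
  have e2 : (0 < e / (2 ^ k.+1)%:R)%R by rewrite divr_gt0// ltr0n expn_gt0.
  have fk : daniell (A k) \is a fin_num.
    by rewrite ge0_fin_numE// lt_neqAle leey andbT; apply/eqP/Aoo.
  have [_ [q qA <-] qle] := lb_ereal_inf_adherent e2 fk.
  by exists q; split => //; exact: ltW.
apply: (@le_trans _ _ (\sum_(0 <= i <oo) \sum_(0 <= j <oo) (L (p i j))%:E)).
  apply: D_le2; first by move=> i j; exact: (pP i).1.1.
  move=> x [k _ Ax]; apply: (le_trans ((pP k).1.2 _ Ax)).
  have s0 i : 0 <= \sum_(0 <= j <oo) (p i j x)%:E.
    by apply: nneseries_ge0 => j _ _; rewrite lee_fin ccp_ge0//; exact: (pP i).1.1.
  apply: le_trans (nneseries_lim_ge k.+1 _) => //.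
  by rewrite big_nat_recr//= leeDr// sume_ge0.
apply: lee_nneseries => [i _ _|i _]; last exact: (pP i).2.
by apply: nneseries_ge0 => j _ _; rewrite lee_fin L_ge0//; exact: (pP i).1.1.
Qed.

HB.instance Definition _ := isOuterMeasure.Build R Rn daniell D0 D_ge0 D_mono D_sigma.

(** For U = {g > 0} the functions u_m = min(1, m g) increase to the indicator of U. Each p_i in a
    cover of X is the sum of the p_i v_m, m < N, plus p_i (1 - u_N). The p_i v_m over all m cover
    the part of X in U; the p_i (1 - u_N) cover the rest, where u_N = 0. Then N tends to
    infinity. *)
Let D_open U : open U -> daniell.-caratheodory U.
Proof.
move=> /open_positivity[g [gc g0] ->].
apply: le_caratheodory_measurable => X.
apply: le_ereal_inf_tmp => _ [p [pc pX] <-].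
pose u (m : nat) (x : Rn) : R := Num.min 1%R (Num.max 0%R (m%:R * g x)%R).
have uE m x : u m x = Num.min 1%R (m%:R * g x)%R.
  by rewrite /u max_r// mulr_ge0.
have uc m : continuous (u m).
  apply: continuous_clamp => z.
  by apply: (@continuousM _ _ (cst (m%:R : R)) g); [exact: cst_continuous|exact: gc].
have u0 m x : (0 <= u m x <= 1)%R.
  by rewrite uE le_min ler01 mulr_ge0//= ge_min lexx.
have uS m x : (u m x <= u m.+1 x)%R.
  rewrite !uE le_min ge_min lexx/= ge_min; apply/orP; right.
  by rewrite ler_wpM2r// ler_nat.
pose v m x := (u m.+1 x - u m x)%R.
have vc m : continuous (v m).
  by move=> z; apply: (@continuousB _ _ _ (u m.+1) (u m)); exact: uc.
have v0 m x : (0 <= v m x)%R by rewrite subr_ge0.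
have sv N x : (\sum_(0 <= m < N) v m x = u N x)%R.
  rewrite /v (telescope_sumr (fun m => u m x))// [u 0%N x]uE mul0r.
  by rewrite min_r ?subr0.
have pvc i m : ccp (fun z => p i z * v m z)%R by exact: ccpM.
have puc i N : ccp (fun z => p i z * (1 - u N z))%R.
  apply: ccpM => //.
    by move=> z; apply: (@continuousB _ _ _ (@cst Rn R 1%R) (u N)); [exact: cst_continuous|exact: uc].
  by move=> z; rewrite subr_ge0; case/andP: (u0 N z).
have pv0 i m x : 0 <= (p i x * v m x)%:E by rewrite lee_fin; case: (pvc i m).
have H1 : daniell (X `&` [set z | (0 < g z)%R]) <=
    \sum_(0 <= m <oo) \sum_(0 <= i <oo) (L (fun z => p i z * v m z)%R)%:E.
  rewrite (nneseries_interchange xpredT xpredT); last first.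
    by move=> i j; rewrite lee_fin L_ge0.
  apply: D_le2 => // x [Xx /= gx]; apply: (le_trans (pX _ Xx)).
  apply: lee_nneseries => [i _|i _]; first by rewrite lee_fin ccp_ge0.
  have [N Ngx] : exists N : nat, (1 <= N%:R * g x)%R.
    exists (Num.trunc (g x)^-1).+1; rewrite -ler_pdivrMr// mul1r ltW//.
    by rewrite truncnS_gt ?invr_ge0 ?ltW.
  apply: le_trans (nneseries_lim_ge N _) => //.
  rewrite sumEFin lee_fin -mulr_sumr sv uE min_l ?mulr1//.
have H2 N : daniell (X `&` ~` [set z | (0 < g z)%R]) <=
    \sum_(0 <= i <oo) (L (fun z => p i z * (1 - u N z))%R)%:E.
  apply: D_le; split => // x [Xx /negP]; rewrite -leNgt => gx.
  apply: (le_trans (pX _ Xx)); apply: lee_nneseries => [i _|i _].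
    by rewrite lee_fin ccp_ge0.
  have -> : u N x = 0%R.
    by rewrite uE (_ : g x = 0%R) ?mulr0 ?min_r//; apply/eqP; rewrite eq_le gx g0.
  by rewrite subr0 mulr1.
apply: (le_trans (leeD2r _ H1)).
apply: nneseries_addl_le => [m||N].
- by apply: nneseries_ge0 => i _ _; rewrite lee_fin L_ge0.
- exact: D_ge0.
apply: (le_trans (leeD2l _ (H2 N))).
rewrite -nneseries_sum_nat; last by move=> m i; rewrite lee_fin L_ge0.
rewrite -nneseriesD; last 2 first.
- by move=> i _ _; apply: sume_ge0 => m _; rewrite lee_fin L_ge0.
- by move=> i _ _; rewrite lee_fin L_ge0.
apply: lee_nneseries => [i _|i _].
  by rewrite adde_ge0// ?sume_ge0// => [m _|]; rewrite lee_fin L_ge0.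
rewrite sumEFin -EFinD lee_fin -L_sum// -LD//; last exact: ccp_sum.
apply: L_le => //; first by apply: ccpD => //; exact: ccp_sum.
by move=> z; rewrite -mulr_sumr sv -mulrDr addrC subrK mulr1.
Qed.

Let D_Borel (A : set Rn) : measurable A -> daniell.-caratheodory A.
Proof.
apply: smallest_sub; last exact: D_open.
exact: (@sigma_algebra_measurable _ (caratheodory_type daniell)).
Qed.

Let D_semi_sigma_additive : semi_sigma_additive (daniell : set Rn -> \bar R).
Proof.
move=> F mF tF mUF; apply: (@caratheodory_measure_sigma_additive _ _ daniell) => //.
  by move=> i; exact: D_Borel.
exact: D_Borel.
Qed.

HB.instance Definition _ := isMeasure.Build _ Rn R daniell D0 D_ge0
  D_semi_sigma_additive.

Let D_le1 A f c : ccp f -> (0 <= c)%R -> (forall x, A x -> (c <= f x)%R) ->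
  c%:E * daniell A <= (L f)%:E.
Proof.
move=> fc; rewrite le_eqVlt => /predU1P[<- _|c0 cf].
  by rewrite mul0e lee_fin L_ge0.
have ci : (0 <= c^-1)%R by rewrite invr_ge0 ltW.
rewrite muleC -lee_pdivlMr// -EFinM mulrC -(LZ fc ci).
pose q (i : nat) := if i == 0%N then (fun z => c^-1 * f z)%R else fun=> 0%R.
have qc i : ccp (q i) by case: i => [|i]; [exact: ccpZ|exact: ccp0].
have -> : (L (fun z => c^-1 * f z)%R)%:E = \sum_(0 <= i <oo) (L (q i))%:E.
  rewrite [RHS](@nneseries1 _ (fun i => (L (q i))%:E) 0%N)//.
    by case=> [|i]//= _; rewrite /q/= L0.
  by rewrite lee_fin L_ge0.
apply: D_le; split => // x /cf cfx.
apply: le_trans (nneseries_lim_ge 1 _); last first.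
  by move=> i _ _; rewrite lee_fin ccp_ge0.
by rewrite big_nat1 lee_fin /q/= mulrC ler_pdivlMr// mul1r.
Qed.

(** By compactness some finite partial sum of a cover exceeds 1 - e on all of K. Then (1 - e) f is
    at most c times that finite sum, to which finite additivity of [L] applies. *)
Let D_ge1 K f c : ccp f -> compact K -> (0 <= c)%R -> (forall x, (f x <= c)%R) ->
  (forall x, ~ K x -> f x = 0%R) -> (L f)%:E <= c%:E * daniell K.
Proof.
move=> fc cK; rewrite le_eqVlt => /predU1P[<-|c0] fle fK.
  rewrite mul0e (_ : f = fun=> 0%R) ?L0//; apply/funext => x.
  by apply/eqP; rewrite eq_le fle ccp_ge0.
rewrite -lee_pdivrMl//.
apply: le_ereal_inf_tmp => _ [p [pc pK] <-].
rewrite lee_pdivrMl//.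
have S0 : 0 <= \sum_(0 <= i <oo) (L (p i))%:E.
  by apply: nneseries_ge0 => i _ _; rewrite lee_fin L_ge0.
have H (e : R) : (0 < e < 1)%R ->
    ((1 - e) * L f)%:E <= c%:E * \sum_(0 <= i <oo) (L (p i))%:E.
  move=> /andP[e0 e1].
  pose U N := [set x | (1 - e < \sum_(0 <= i < N) p i x)%R].
  have [N KN] : exists N, K `<=` U N.
    apply: compact_nondecreasing_cover => //.
    - move=> N; rewrite (_ : U N =
        (fun x => \sum_(0 <= i < N) p i x)%R @^-1` [set y | (1 - e < y)%R])//.
      apply: open_comp; last exact: open_gt.
      by move=> x _; have [+ _ _] := ccp_sum N pc; exact.
    - move=> N m Nm x /= /lt_le_trans; apply.
      rewrite (@big_cat_nat _ _ _ N 0 m)//= lerDl sumr_ge0// => i _.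
      exact: ccp_ge0.
    - move=> x /pK px; apply: contrapT => nx.
      suff : \sum_(0 <= i <oo) (p i x)%:E <= (1 - e)%:E.
        move/(le_trans px); rewrite lee_fin leNgt => /negP; apply.
        by rewrite gtrBl.
      apply: lime_le.
        by apply: is_cvg_nneseries => i _ _; rewrite lee_fin ccp_ge0.
      apply: nearW => N; rewrite sumEFin lee_fin leNgt; apply/negP => xN.
      by apply: nx; exists N.
  have ce0 : (0 <= 1 - e)%R by rewrite subr_ge0 ltW.
  have le1 : ((1 - e) * L f <= c * \sum_(0 <= i < N) L (p i))%R.
    rewrite -(LZ fc ce0) -L_sum// -(LZ (ccp_sum N pc) (ltW c0)).
    apply: L_le => [||x].
    - exact: ccpZ.
    - by apply: ccpZ; [exact: ccp_sum|exact: ltW].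
    have s0 : (0 <= \sum_(0 <= i < N) p i x)%R.
      by apply: sumr_ge0 => i _; exact: ccp_ge0.
    have [/KN /= /ltW Kx|/fK ->] := pselect (K x).
      by rewrite mulrC; apply: ler_pM => //; exact: ccp_ge0.
    by rewrite mulr0 mulr_ge0// ltW.
  apply: (@le_trans _ _ (c * \sum_(0 <= i < N) L (p i))%:E); first by rewrite lee_fin.
  rewrite EFinM lee_wpmul2l ?lee_fin ?(ltW c0)// -sumEFin.
  by apply: nneseries_lim_ge => i _ _; rewrite lee_fin L_ge0.
case: (\sum_(0 <= i <oo) (L (p i))%:E) S0 H => [s| |]//; last first.
  by move=> _ _; rewrite gt0_muley ?lte_fin// leey.
rewrite lee_fin => s0 H; rewrite -EFinM lee_fin.
apply/ler_addgt0Pr => e e0.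
have Lf0 := L_ge0 fc.
(* The loss e' L f is at most e; the summand 1 keeps the denominator positive when L f = 0. *)
pose e' := Num.min (2^-1)%R (e / (1 + L f))%R.
have e'0 : (0 < e')%R by rewrite lt_min invr_gt0 ltr0n/= divr_gt0// ltr_wpDr.
have := H e'; rewrite e'0/= -EFinM lee_fin.
have -> : (e' < 1)%R by rewrite gt_min; apply/orP; left; lra.
move=> /(_ isT); rewrite mulrBl mul1r lerBlDr => /le_trans; apply.
rewrite lerD2l; apply: (@le_trans _ _ (e / (1 + L f) * L f)%R).
  by rewrite ler_wpM2r// ge_min lexx orbT.
rewrite mulrAC ler_pdivrMr ?ltr_wpDr// ler_wpM2l ?(ltW e0)//.
by rewrite lerDr ler01.
Qed.

Let bounded_fin (M : R) : daniell [set z | (`|z| <= M)%R] < +oo.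
Proof.
have [f fc f1] := ccp_bump n M.
have := @D_le1 [set z | (`|z| <= M)%R] f 1%R fc ler01.
rewrite mul1e => /(_ _)/le_lt_trans; apply; last exact: ltry.
by move=> x /f1 ->.
Qed.

(* Cutting f into horizontal layers of height e determines, up to an error
   proportional to e, any additive functional comparable with the measure. *)
Let layer (f : Rn -> R) (e : R) (N : nat) (M : R) : ccp f -> (0 < e)%R -> (forall x, (f x <= N%:R * e)%R) ->
    (forall x, (M < `|x|)%R -> f x = 0%R) ->
  exists2 s : R, (0 <= s)%R & forall Lam : (Rn -> R) -> R,
    (forall f g, ccp f -> ccp g -> Lam (fun z => f z + g z)%R = (Lam f + Lam g)%R) ->
    Lam (fun=> 0%R) = 0%R ->
    (forall (A : set Rn) f c, measurable A -> ccp f -> (0 <= c)%R -> (forall x, A x -> (c <= f x)%R) ->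
       c%:E * daniell A <= (Lam f)%:E) ->
    (forall (K : set Rn) f c, ccp f -> compact K -> measurable K -> (0 <= c)%R -> (forall x, (f x <= c)%R) ->
      (forall x, ~ K x -> f x = 0%R) -> (Lam f)%:E <= c%:E * daniell K) ->
    (s <= Lam f <= s + e * fine (daniell [set z | (`|z| <= M)%R]))%R.
Proof.
move=> fc e0 fN fM.
have [fcont f0 _] := fc.
(* [g j] is the slice of f between the heights j e and (j + 1) e. It equals e on [K j.+1] and
   vanishes off [K j]. *)
pose g (j : nat) (x : Rn) : R := Num.min e (Num.max 0%R (f x - j%:R * e)%R).
have gc j : ccp (g j).
  split.
  - apply: continuous_clamp => z.
    apply: (@continuousB _ _ _ f (cst (j%:R * e : R)%R)) => //; first exact: fcont.
    exact: cst_continuous.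
  - by move=> z; rewrite le_min (ltW e0)/= le_max lexx.
  - exists M => z Mz; rewrite /g fM// sub0r max_l ?min_r// ?(ltW e0)//.
    by rewrite oppr_le0 mulr_ge0// ltW.
pose K (j : nat) := if j is j'.+1 then [set z | (j%:R * e <= f z)%R]
                    else [set z | (`|z| <= M)%R].
have cK j : compact (K j).
  case: j => [|j]; first exact: closed_norm_ball_compact.
  by apply: superlevel_compact => //; rewrite mulr_gt0.
have mK j : measurable (K j).
  by apply: closed_Borel; apply: compact_closed => //; exact: norm_hausdorff.
have KM j : K j `<=` [set z | (`|z| <= M)%R].
  case: j => [//|j] z /= jz; rewrite leNgt; apply/negP => /fM fz.
  by move: jz; rewrite fz leNgt mulr_gt0.
have Kfin j : daniell (K j) \is a fin_num.
  rewrite ge0_fin_numE//; apply: le_lt_trans (bounded_fin M).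
  exact/D_mono/KM.
pose s j := fine (daniell (K j)).
have sE j : daniell (K j) = (s j)%:E by rewrite fineK.
exists (\sum_(0 <= j < N) e * s j.+1)%R.
  by apply: sumr_ge0 => j _; rewrite mulr_ge0 ?(ltW e0)// fine_ge0.
move=> Lam LamD Lam0 Lamge Lamle.
have partial m x : (\sum_(0 <= j < m) g j x = Num.min (f x) (m%:R * e))%R.
  elim: m => [|m IH]; first by rewrite big_geq// mul0r min_r.
  rewrite big_nat_recr//= IH /g -natr1 mulrDl mul1r.
  have [h|h] := leP (f x) (m%:R * e)%R.
    rewrite max_l ?subr_le0// min_r ?(ltW e0)// addr0 min_l//.
    by rewrite (le_trans h)// lerDl ltW.
  rewrite max_r ?subr_ge0 ?(ltW h)// addr_minr [(_ + (f x - _))%R]addrC subrK minC.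
  by [].
have Lsum m : Lam (fun z => \sum_(0 <= j < m) g j z)%R = (\sum_(0 <= j < m) Lam (g j))%R.
  elim: m => [|m IH].
    by rewrite big_geq// -[RHS]Lam0; congr Lam; apply/funext => z; rewrite big_geq.
  rewrite big_nat_recr//= -IH -LamD//; last exact: ccp_sum.
  by congr Lam; apply/funext => z; rewrite big_nat_recr.
have -> : Lam f = (\sum_(0 <= j < N) Lam (g j))%R.
  by rewrite -Lsum; congr Lam; apply/funext => z; rewrite partial min_l.
have lo j : (e * s j.+1 <= Lam (g j))%R.
  rewrite -lee_fin EFinM -sE; apply: Lamge => //; first exact: ltW.
  move=> x /= jx; rewrite le_min lexx/= le_max; apply/orP; right.
  by rewrite lerBrDr -{1}[e]mul1r -mulrDl nat1r.
have hi j : (Lam (g j) <= e * s j)%R.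
  rewrite -lee_fin EFinM -sE; apply: Lamle => //; first exact: ltW.
    by move=> x; rewrite ge_min lexx.
  move=> x Kx; rewrite /g max_l ?min_r ?(ltW e0)// subr_le0.
  case: j Kx => [|j]/= /negP; rewrite -ltNge; last exact: ltW.
  by move=> /fM ->; rewrite mul0r.
apply/andP; split; first by apply: ler_sum => j _; exact: lo.
apply: (@le_trans _ _ (\sum_(0 <= j < N) e * s j)%R).
  by apply: ler_sum => j _; exact: hi.
(* The upper minus the lower sum telescopes to e times the difference of the two extreme level-set
   measures. *)
rewrite -!mulr_sumr -mulrDr ler_wpM2l ?(ltW e0)//.
rewrite -lerBlDl -sumrB.
rewrite (_ : \sum_(0 <= j < N) _ = s 0%N - s N)%R; last first.
  rewrite -[RHS]opprB -(telescope_sumr s)// -sumrN.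
  by apply: eq_bigr => j _; rewrite opprB.
by rewrite lerBlDr lerDl fine_ge0.
Qed.

Lemma riesz_markov : exists s : {measure set Rn -> \bar R},
  forall f, ccp f -> \int[s]_x (f x)%:E = (L f)%:E.
Proof.
exists daniell => f0 f0c.
have int_fin (f : Rn -> R) (fc : ccp f) : \int[daniell]_x (f x)%:E \is a fin_num.
  exact: (@ccp_integral_fin R n daniell f bounded_fin fc).
pose I f := fine (\int[daniell]_x (f x)%:E).
have IE (f : Rn -> R) : ccp f -> (I f)%:E = \int[daniell]_x (f x)%:E.
  by move=> fc; rewrite /I fineK// int_fin.
rewrite -IE//; congr EFin.
have [M fM f0M] := ccp_bounded f0c.
set B := fine (daniell [set z | (`|z| <= M)%R]).
have B0 : (0 <= B)%R by exact: fine_ge0.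
(* The s given by [layer] does not depend on the functional, so [L] and the integral lie in one
   interval of length e B. *)
have close e : (0 < e)%R -> (`|I f0 - L f0| <= e * B)%R.
  move=> e0; pose N := (Num.trunc (M / e)).+1.
  have fN x : (f0 x <= N%:R * e)%R.
    apply: (le_trans (fM x)); rewrite -ler_pdivrMr//; apply: ltW.
    have M0 : (0 <= M)%R by apply: le_trans (fM 0%R); exact: ccp_ge0.
    by rewrite truncnS_gt// divr_ge0// ltW.
  have [s s0 Hs] := layer f0c e0 fN f0M.
  have /andP[l1 l2] : (s <= L f0 <= s + e * B)%R.
    apply: Hs => //; last by move=> K f c fc cK _; exact: D_ge1.
    by move=> A f c _; exact: D_le1.
  have /andP[i1 i2] : (s <= I f0 <= s + e * B)%R.
    apply: Hs => //.
    - move=> f g fc gc; rewrite /I -fineD ?int_fin//; congr fine.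
      rewrite -ge0_integralD//.
      + by move=> x _; rewrite lee_fin ccp_ge0.
      + exact: ccp_Borel.
      + by move=> x _; rewrite lee_fin ccp_ge0.
      + exact: ccp_Borel.
    - by rewrite /I integral0_eq.
    - by move=> A f c mA fc c0 cf; rewrite IE//; exact: ccp_integral_ge.
    - by move=> K f c fc cK mK c0 fle fK; rewrite IE//; exact: ccp_integral_le.
  rewrite ler_norml; apply/andP; split; lra.
apply/eqP; rewrite -subr_eq0 -normr_le0; apply/ler_addgt0Pr => e e0; rewrite add0r.
have B1 : (0 < B + 1)%R by rewrite ltr_wpDl.
apply: (le_trans (close (e / (B + 1))%R _)); first by rewrite divr_gt0.
by rewrite mulrAC ler_pdivrMr// ler_wpM2l ?(ltW e0)// lerDl.
Qed.

End Riesz.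

(** * Vague compactness *)

Section Diagonal.
Context (R : realType).

Lemma increasing_seq_ge (f : nat -> nat) : increasing_seq f -> forall k, (k <= f k)%N.
Proof.
move=> fi; elim=> [//|k IH]; apply: (leq_ltn_trans IH).
have := fi k.+1 k; rewrite !leEnat => h.
by rewrite ltnNge h -ltnNge.
Qed.

Lemma increasing_seq_ltn (f : nat -> nat) : increasing_seq f ->
  forall x y, (x < y)%N -> (f x < f y)%N.
Proof. by move=> fi x y; have := fi y x; rewrite !leEnat !ltnNge => ->. Qed.

(* Cantor's diagonal extraction of a common convergent subsequence. *)
Lemma diagonal_subsequence (u : nat -> nat -> R) :
  (forall i, bounded_fun (u i)) ->
  exists2 h : nat -> nat, increasing_seq h & forall i, cvgn (u i \o h).
Proof.
move=> bu.
have ex (i : nat) (g : nat -> nat) : {f : nat -> nat | increasing_seq f /\ cvgn (u i \o g \o f)}.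
  apply: cid; have : bounded_fun (u i \o g).
    case: (bu i) => N [Nr HN]; exists N; split=> // x Nx k _ /=.
    exact: (HN x Nx (g k)).
  by move=> /bolzano_weierstrass[f fi fc]; exists f.
pose fix G (i : nat) : nat -> nat :=
  if i is i'.+1 then G i' \o sval (ex i (G i')) else sval (ex 0%N id).
have Gi i : increasing_seq (G i).
  elim: i => [|i IH] /=; first by case: (svalP (ex 0%N id)).
  by move=> x y /=; rewrite IH; exact: ((svalP (ex i.+1 (G i))).1 x y).
have Gc i : cvgn (u i \o G i).
  by case: i => [|i] /=; [case: (svalP (ex 0%N id))|case: (svalP (ex i.+1 (G i)))].
have Gsub i j : exists2 f : nat -> nat, increasing_seq f & G (i + j)%N = G i \o f.
  elim: j => [|j [f fi fG]]; first by exists id; rewrite ?addn0.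
  exists (f \o sval (ex (i + j).+1 (G (i + j)%N))).
    by move=> x y /=; rewrite fi; exact: ((svalP (ex (i + j).+1 (G (i + j)%N))).1 x y).
  by rewrite addnS /= fG.
exists (fun k => G k k).
  apply/increasing_seqP => k; rewrite /= ltEnat /=.
  have := svalP (ex k.+1 (G k)) => -[si _].
  by apply: (increasing_seq_ltn (Gi k)); exact: (leq_trans _ (increasing_seq_ge si _)).
move=> i; have /cvg_ex[l ul] := Gc i; apply/cvg_ex; exists l => /=.
apply/cvgrPdist_lt => e e0.
have /cvgrPdist_lt/(_ _ e0)[N _ HN] := ul.
exists (N + i)%N => // k /= Nik.
have ik : (i <= k)%N by rewrite (leq_trans _ Nik)// leq_addl.
have [f fi] := Gsub i (k - i)%N; rewrite subnKC// => ->.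
apply: (HN (f k)) => /=.
by rewrite (leq_trans _ (increasing_seq_ge fi k))// (leq_trans _ Nik)// leq_addr.
Qed.

End Diagonal.

(** * Dyadic partitions of unity by tent functions *)

Section PartitionOfUnity.
Context (R : realType) (n : nat).
Local Notation Rn := 'rV[R]_n.

Definition ramp (y : R) : R := Num.min 1 (Num.max 0 y).

(** This is the tent max(0, 1 - |y|), written as a difference so that its integer translates
    telescope to 1. *)
Definition hat (y : R) : R := ramp (y + 1) - ramp y.

Lemma rampE0 y : y <= 0 -> ramp y = 0.
Proof. by move=> y0; rewrite /ramp max_l// min_r. Qed.

Lemma rampE1 y : 1 <= y -> ramp y = 1.
Proof. by move=> y1; rewrite /ramp min_l// le_max y1 orbT. Qed.

Lemma ramp_le : {homo ramp : x y / x <= y}.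
Proof.
move=> x y xy; rewrite /ramp le_min ge_min lexx/= ge_min; apply/orP; right.
by rewrite ge_max !le_max lexx xy orbT.
Qed.

Lemma hat_ge0 y : 0 <= hat y.
Proof. by rewrite subr_ge0; apply: ramp_le; rewrite lerDl. Qed.

Lemma hat_eq0 y : 1 <= `|y| -> hat y = 0.
Proof.
rewrite ler_normr /hat => /orP[y1|y1].
  by rewrite !rampE1 ?subrr// ler_wpDl// ?ltW// (lt_le_trans ltr01).
by rewrite !rampE0 ?subrr//; lra.
Qed.

Lemma sum_hat (y : R) (N : nat) : `|y| <= N%:R ->
  \sum_(j < (N + N).+1) hat (y + N%:R - j%:R) = 1.
Proof.
rewrite ler_norml => /andP[y1 y2].
pose f (j : nat) := - ramp (y + N%:R + 1 - j%:R).
rewrite (eq_bigr (fun j : 'I_(N + N).+1 => f j.+1 - f j)); last first.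
  move=> j _; rewrite /hat /f opprK [RHS]addrC; congr (ramp _ - ramp _).
    by rewrite addrAC.
  by rewrite -natr1; lra.
rewrite -(big_mkord xpredT (fun j => f j.+1 - f j)) telescope_sumr// /f.
rewrite rampE0 ?oppr0 ?add0r ?opprK; last by rewrite -natr1 natrD; lra.
by rewrite rampE1//; lra.
Qed.

Definition grid (j : nat) (z : {ffun 'I_n -> int}) : Rn :=
  \row_i ((z i)%:~R / 2 ^+ j).

(** A product of tents of half-width 2^-j around [grid j z]. The pairs (j, z) form a countable type,
    as diagonal extraction requires. *)
Definition bump (j : nat) (z : {ffun 'I_n -> int}) (x : Rn) : R :=
  \prod_(i < n) hat (2 ^+ j * x ord0 i - (z i)%:~R).

Lemma bump_ge0 j z x : 0 <= bump j z x.
Proof. by apply: prodr_ge0 => i _; exact: hat_ge0. Qed.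

Lemma row_norm_gt (x : Rn) (M : R) : 0 <= M -> M < `|x| -> exists i, M < `|x ord0 i|.
Proof.
move=> M0; apply: contraPP => /forallNP H; apply/negP; rewrite -leNgt.
rewrite (_ : `|x| = mx_norm x)// mx_normrE; apply/bigmax_leP; split=> // -[a i] _ /=.
by rewrite (ord1 a) leNgt; apply/negP/H.
Qed.

Lemma le_row_norm (x : Rn) i : `|x ord0 i| <= `|x|.
Proof.
rewrite (_ : `|x| = mx_norm x)// mx_normrE.
exact: (le_bigmax _ (fun ij : 'I_1 * 'I_n => `|x ij.1 ij.2|) (ord0, i)).
Qed.

Lemma bump_neq0 j z x : bump j z x != 0 -> `|x - grid j z| <= (2 ^+ j)^-1.
Proof.
move=> b0; rewrite leNgt; apply/negP => /row_norm_gt[]; first by rewrite invr_ge0 exprn_ge0.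
move=> i; rewrite !mxE => h; move/prodf_neq0: b0 => /(_ i isT)/negP; apply.
apply/eqP/hat_eq0; rewrite -[leLHS](@mulfV _ (2 ^+ j)) ?expf_neq0//.
have -> : 2 ^+ j * x ord0 i - (z i)%:~R = 2 ^+ j * (x ord0 i - (z i)%:~R / 2 ^+ j).
  by rewrite mulrBr mulrCA mulfV ?expf_neq0// mulr1.
by rewrite normrM ger0_norm ?exprn_ge0// ler_wpM2l ?exprn_ge0// ltW.
Qed.

Lemma continuous_hat : continuous hat.
Proof.
have cr : continuous ramp.
  have c0 : continuous (@cst R R 0) by exact: cst_continuous.
  have c1 : continuous (@cst R R 1) by exact: cst_continuous.
  have ci : continuous (@id R) by move=> x; exact: cvg_id.
  exact: (min_fun_continuous c1 (max_fun_continuous c0 ci)).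
have cr1 : continuous (fun y : R => ramp (y + 1)).
  move=> y; apply: (@continuous_comp _ _ _ (fun y : R => y + 1) ramp); last exact: cr.
  by apply: cvgD; [exact: cvg_id|exact: cvg_cst].
by move=> y; exact: (cvgB (cr1 y) (cr y)).
Qed.

Lemma continuous_coord i : continuous (fun x : Rn => x ord0 i).
Proof. exact: coord_continuous. Qed.

Lemma continuous_bump j z : continuous (bump j z).
Proof.
rewrite /bump; elim: (index_enum _) => [|i s IH].
  rewrite (_ : (fun _ => _) = cst 1); first exact: cst_continuous.
  by apply/funext => x; rewrite big_nil.
rewrite (_ : (fun _ => _) = (fun x : Rn => hat (2 ^+ j * x ord0 i - (z i)%:~R) *
   \prod_(i <- s) hat (2 ^+ j * x ord0 i - (z i)%:~R))); last first.
  by apply/funext => x; rewrite big_cons.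
move=> x; apply: (@continuousM _ _ (fun x : Rn => hat (2 ^+ j * x ord0 i - (z i)%:~R))
   (fun x : Rn => \prod_(i <- s) hat (2 ^+ j * x ord0 i - (z i)%:~R))); last exact: IH.
apply: (@continuous_comp _ _ _ (fun x : Rn => 2 ^+ j * x ord0 i - (z i)%:~R) hat);
  last exact: continuous_hat.
apply: (@continuousB _ _ _ (fun x : Rn => 2 ^+ j * x ord0 i) (cst _));
  last exact: cst_continuous.
apply: (@continuousM _ _ (cst _) (fun x : Rn => x ord0 i)); first exact: cst_continuous.
exact: continuous_coord.
Qed.

Lemma ccp_bump_grid j z : ccp (bump j z).
Proof.
split; [exact: continuous_bump|exact: bump_ge0|].
exists (`|grid j z| + (2 ^+ j)^-1) => x; apply: contraTeq => /bump_neq0 h.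
rewrite -leNgt -[x](subrK (grid j z)) addrC (le_trans (ler_normD _ _))// lerD2l.
exact: h.
Qed.

Definition grid_index (N : nat) (g : {ffun 'I_n -> 'I_(N + N).+1}) : {ffun 'I_n -> int} :=
  [ffun i => (g i : nat)%:Z - N%:Z].

Lemma sum_bump j N (x : Rn) : 2 ^+ j * `|x| <= N%:R ->
  \sum_(g : {ffun 'I_n -> 'I_(N + N).+1}) bump j (grid_index g) x = 1.
Proof.
move=> xN; transitivity (\prod_(i < n) \sum_(k < (N + N).+1)
  hat (2 ^+ j * x ord0 i + N%:R - k%:R)).
  rewrite bigA_distr_bigA; apply: eq_bigr => g _; apply: eq_bigr => i _.
  by rewrite ffunE intrB /= opprB addrA.
apply: big1 => i _; apply: sum_hat.
rewrite normrM ger0_norm ?exprn_ge0// (le_trans _ xN)//.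
by rewrite ler_wpM2l ?exprn_ge0// le_row_norm.
Qed.

(** The oscillation condition on two points near x survives a small move of x at the cost of radius,
    and the strict bound on the radius leaves room for it; so the increasing sets [U N] are open and
    one contains K. Only x is confined to K. *)
Lemma compact_uniformly_continuous (f : Rn -> R) (K : set Rn) e : continuous f ->
  compact K -> 0 < e -> exists2 d, 0 < d &
  forall x y, K x -> `|x - y| < d -> `|f x - f y| < e.
Proof.
move=> fc cK e0.
pose U (N : nat) := [set x : Rn | exists2 r, N.+1%:R^-1 < r &
  forall y z : Rn, `|x - y| < r -> `|x - z| < r -> `|f y - f z| < e].
have [N KN] : exists N, K `<=` U N.
  apply: compact_nondecreasing_cover => //.
  - move=> N; rewrite openE => x [r]; set a := N.+1%:R^-1 => Nr rP.
    have d0 : 0 < (r - a) / 2 by rewrite divr_gt0// subr_gt0.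
    rewrite /interior; apply/nbhs_ballP; exists ((r - a) / 2) => //= x'.
    rewrite -ball_normE /= => xx'.
    exists ((r + a) / 2); first by rewrite -/a; lra.
    move=> y z x'y x'z; apply: rP.
      by apply: (le_lt_trans (ler_distD x' _ _)); lra.
    by apply: (le_lt_trans (ler_distD x' _ _)); lra.
  - move=> N m Nm x [r Nr rP]; exists r => //; apply: le_lt_trans Nr.
    by rewrite lef_pV2 ?posrE ?ltr0n// ler_nat.
  - move=> x Kx.
    have : \forall y \near nbhs x, ball (f x) (e / 2) (f y).
      by apply: fc; apply: nbhsx_ballx; rewrite divr_gt0.
    move=> /nbhs_ballP[d /= d0 dP].
    exists (Num.trunc d^-1) => //; exists d.
      rewrite -[ltRHS]invrK ltf_pV2 ?posrE ?ltr0n ?invr_gt0//.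
      by rewrite truncnS_gt ?invr_ge0 ?ltW.
    move=> y z xy xz.
    have := dP y; have := dP z; rewrite -!ball_normE /= => /(_ xz) fz /(_ xy) fy.
    apply: (le_lt_trans (ler_distD (f x) _ _)); rewrite distrC; lra.
exists N.+1%:R^-1 => [|x y /KN[r Nr rP] xy]; first by rewrite invr_gt0 ltr0n.
apply: rP; last exact: lt_trans xy Nr.
by rewrite subrr normr0 (lt_trans _ Nr)// invr_gt0 ltr0n.
Qed.

(* Every test function is approximated, within a multiple of a fixed bump
   function, by nonnegative combinations of the functions [bump j z]. *)
Lemma ccp_approx (f : Rn -> R) : ccp f -> exists2 b : Rn -> R, ccp b &
  forall e, 0 < e -> exists j N, forall x,
    `|f x - \sum_(k : {ffun 'I_n -> 'I_(N + N).+1})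
       f (grid j (grid_index k)) * bump j (grid_index k) x| <= e * b x.
Proof.
move=> fc; have [fcont f0 [M0 fM0]] := fc.
pose M := Num.max M0 0.
have M_ge0 : 0 <= M by rewrite le_max lexx orbT.
have fM (z : Rn) : M < `|z| -> f z = 0 by rewrite gt_max => /andP[/fM0].
have [b bc b1] := ccp_bump n (M + 1).
exists b => // e e0.
have [d d0 dP] := compact_uniformly_continuous fcont (@closed_norm_ball_compact R n (M + 1)) e0.
pose j := Num.bound d^-1.
pose N := (Num.trunc (2 ^+ j * (M + 1))).+1.
have jd : (2 ^+ j)^-1 < d.
  rewrite -[ltRHS]invrK ltf_pV2 ?posrE ?exprn_gt0 ?invr_gt0//.
  exact: upper_nthrootP.
have j1 : (2 ^+ j)^-1 <= 1 :> R.
  by rewrite invf_le1 ?exprn_gt0// exprn_ege1// ler1n.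
exists j, N => x; have [xM|Mx] := leP `|x| (M + 1).
  have s1 : \sum_(k : {ffun 'I_n -> 'I_(N + N).+1}) bump j (grid_index k) x = 1.
    apply: sum_bump; rewrite (@le_trans _ _ (2 ^+ j * (M + 1)))//.
      by rewrite ler_wpM2l ?exprn_ge0.
    by apply: ltW; exact: truncnS_gt.
  rewrite b1// mulr1 -[f x]mulr1 -[X in f x * X]s1 mulr_sumr -sumrB.
  rewrite (le_trans (ler_norm_sum _ _ _))// -[leRHS]mulr1 -[X in e * X]s1 mulr_sumr.
  apply: ler_sum => k _; rewrite -mulrBl normrM (ger0_norm (bump_ge0 _ _ _)).
  have [->|/bump_neq0 xk] := eqVneq (bump j (grid_index k) x) 0; first by rewrite !mulr0.
  rewrite ler_wpM2r ?bump_ge0// ltW// dP//.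
  exact: le_lt_trans xk jd.
(* Bumps have radius at most 1, so one that is nonzero at x with |x| > M + 1 is centred outside the
   ball of radius M, where f vanishes. *)
rewrite fM ?(lt_trans _ Mx) ?ltrDl// big1 ?subrr ?normr0.
  by rewrite mulr_ge0 ?(ltW e0) ?ccp_ge0.
move=> k _; have [->|/bump_neq0 xk] := eqVneq (bump j (grid_index k) x) 0; first by rewrite mulr0.
rewrite fM ?mul0r// ltNge; apply/negP => gM; move: Mx; rewrite ltNge => /negP; apply.
rewrite -[x](subrK (grid j (grid_index k))) addrC (le_trans (ler_normD _ _))// lerD//.
exact: le_trans xk j1.
Qed.

End PartitionOfUnity.
Arguments grid {R n} j z.

(** * Sequential compactness of locally bounded measures *)

Section WeakCompactness.
Context (R : realType) (n : nat).
Local Notation Rn := 'rV[R]_n.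

Definition pos_functional (L : (Rn -> R) -> R) :=
  [/\ forall f, ccp f -> 0 <= L f,
      forall f g, ccp f -> ccp g -> L (fun z => f z + g z) = L f + L g &
      forall f c, ccp f -> 0 <= c -> L (fun z => c * f z) = c * L f].

Lemma ccp_comb (I : Type) (s : seq I) (c : I -> R) (F : I -> Rn -> R) :
  (forall k, 0 <= c k) -> (forall k, ccp (F k)) ->
  ccp (fun x => \sum_(k <- s) c k * F k x).
Proof.
move=> c0 Fc; elim: s => [|k s IH].
  rewrite (_ : (fun _ => _) = (fun=> 0)); first exact: ccp0.
  by apply/funext => z; rewrite big_nil.
rewrite (_ : (fun _ => _) = (fun z => c k * F k z + \sum_(k <- s) c k * F k z)).
  by apply: ccpD => //; exact: ccpZ.
by apply/funext => z; rewrite big_cons.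
Qed.

Lemma pos_functional_comb L (I : Type) (s : seq I) (c : I -> R) (F : I -> Rn -> R) :
  pos_functional L -> (forall k, 0 <= c k) -> (forall k, ccp (F k)) ->
  L (fun x => \sum_(k <- s) c k * F k x) = \sum_(k <- s) c k * L (F k).
Proof.
move=> [L0 LD LZ] c0 Fc; elim: s => [|k s IH].
  rewrite big_nil -[RHS](mul0r (L (fun=> 0))) -LZ//; last exact: ccp0.
  by congr L; apply/funext => z; rewrite big_nil mul0r.
rewrite big_cons -IH -LZ// -LD//; [|exact: ccpZ|exact: ccp_comb].
by congr L; apply/funext => z; rewrite big_cons.
Qed.

Lemma pos_functional_le L f g : pos_functional L -> ccp f -> ccp g ->
  (forall z, f z <= g z) -> L f <= L g.
Proof.
move=> [L0 LD LZ] fc gc fg; rewrite (_ : g = (fun z => f z + (g z - f z))).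
  by rewrite LD//; [rewrite lerDl; apply: L0|]; exact: ccpB.
by apply/funext => z; rewrite addrC subrK.
Qed.

Lemma pos_functional_dist L f g b e : pos_functional L -> ccp f -> ccp g -> ccp b ->
  0 <= e -> (forall z, `|f z - g z| <= e * b z) -> `|L f - L g| <= e * L b.
Proof.
move=> Lp fc gc bc e0 fg; have [L0 LD LZ] := Lp.
have ebc : ccp (fun z => e * b z) by exact: ccpZ.
rewrite ler_norml lerBrDr lerBlDr addrC lerBlDr -LZ// -!LD//; apply/andP; split.
  apply: pos_functional_le => //; first exact: ccpD.
  by move=> z; have := fg z; rewrite ler_norml => /andP[h _]; rewrite -lerBlDl; lra.
apply: pos_functional_le => //; first exact: ccpD.
by move=> z; have := fg z; rewrite ler_norml => /andP[_ h]; lra.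
Qed.

Lemma cvgn_comb (I : Type) (s : seq I) (c : I -> R) (u : I -> nat -> R) :
  (forall k, cvgn (u k)) -> cvgn (fun m => \sum_(k <- s) c k * u k m).
Proof.
move=> uc; elim: s => [|k s IH].
  rewrite (_ : (fun _ => _) = (fun=> 0)); first exact: is_cvg_cst.
  by apply/funext => z; rewrite big_nil.
rewrite (_ : (fun _ => _) = (fun m => c k * u k m + \sum_(k <- s) c k * u k m)).
  by apply: is_cvgD => //; apply: is_cvgM; [exact: is_cvg_cst|exact: uc].
by apply/funext => z; rewrite big_cons.
Qed.

(** The diagonal subsequence converges on the countably many bumps, hence on their combinations.
    [ccp_approx] bounds the error by a small multiple of one function b, on which the functionals
    are uniformly bounded, so the values at f are Cauchy. *)
Lemma functional_subsequence (Lam : nat -> (Rn -> R) -> R) :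
  (forall k, pos_functional (Lam k)) ->
  (forall f, ccp f -> exists C, forall k, Lam k f <= C) ->
  exists2 h : nat -> nat, increasing_seq h &
    forall f, ccp f -> cvgn (fun k => Lam (h k) f).
Proof.
move=> Lp Lb.
(* Integers that code no pair (j, z) contribute the zero sequence. *)
pose u (i k : nat) : R :=
  if unpickle i is Some p then Lam k (bump (p : nat * {ffun 'I_n -> int}).1 p.2) else 0.
have [i|h hi hc] := @diagonal_subsequence R u.
  rewrite /u; case: (unpickle i) => [[j z]|]; last first.
    by exists 0; split=> // y y0 k _ /=; rewrite normr0 ltW.
  have [C HC] := Lb _ (@ccp_bump_grid R n j z).
  exists C; split; first exact: num_real.
  move=> y Cy k _ /=; rewrite ger0_norm; last by case: (Lp k) => + _ _; apply; exact: ccp_bump_grid.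
  exact: (le_trans (HC k) (ltW Cy)).
exists h => // f fc.
have [b bc bP] := ccp_approx fc.
have [C HC] := Lb _ bc.
apply: cauchy_cvg; apply: cauchy_exP => e e0.
have C0 : 0 <= C by apply: le_trans (HC 0%N); case: (Lp 0%N) => + _ _; exact.
have e1 : 0 < e / 2 / (C + 1) by rewrite !divr_gt0// ltr_wpDl.
have [j [N HjN]] := bP _ e1.
pose g x := \sum_(k : {ffun 'I_n -> 'I_(N + N).+1})
       f (grid j (grid_index k)) * bump j (grid_index k) x.
have fge k : 0 <= f k by exact: ccp_ge0.
have gc : ccp g by apply: ccp_comb => // k; exact: ccp_bump_grid.
have /cvg_ex[l lP] : cvgn (fun k => Lam (h k) g).
  rewrite (_ : (fun _ => _) = (fun m => \sum_(k : {ffun 'I_n -> 'I_(N + N).+1})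
       f (grid j (grid_index k)) * Lam (h m) (bump j (grid_index k)))).
    apply: cvgn_comb => k; have := hc (pickle (j, grid_index k)).
    by rewrite /u pickleK.
  apply/funext => m; apply: (pos_functional_comb _ (Lp (h m))) => // k.
  exact: ccp_bump_grid.
exists l; have e2 : 0 < e / 2 by rewrite divr_gt0.
have /cvgrPdist_lt/(_ _ e2) := lP; rewrite /fmapE /=.
apply: filterS => k lk; rewrite -ball_normE /=.
apply: (le_lt_trans (ler_distD (Lam (h k) g) _ _)).
rewrite [ltRHS](splitr e) ltr_leD// distrC.
apply: (le_trans (pos_functional_dist (Lp (h k)) fc gc bc (ltW e1) HjN)).
rewrite mulrAC ler_pdivrMr ?ltr_wpDl// ler_wpM2l ?(ltW e2)//.
by rewrite (le_trans (HC _))// lerDl.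
Qed.

Lemma integral_pos_functional (nu : {measure set Rn -> \bar R}) :
  (forall M : R, nu [set z : Rn | (`|z| <= M)%R] < +oo)%E ->
  pos_functional (fun f => fine (\int[nu]_x (f x)%:E)).
Proof.
move=> nufin; split.
- by move=> f fc; apply: fine_ge0; apply: integral_ge0 => x _; rewrite lee_fin ccp_ge0.
- move=> f g fc gc; rewrite -fineD ?ccp_integral_fin//; congr fine.
  rewrite -ge0_integralD//.
  + by move=> x _; rewrite lee_fin ccp_ge0.
  + exact: ccp_Borel.
  + by move=> x _; rewrite lee_fin ccp_ge0.
  + exact: ccp_Borel.
- move=> f c fc c0; under eq_integral do rewrite EFinM.
  rewrite ge0_integralZl//.
  + by rewrite fineM// ccp_integral_fin.
  + exact: ccp_Borel.
  + by move=> x _; rewrite lee_fin ccp_ge0.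
Qed.

(** The limits along the subsequence form a positive functional, which [riesz_markov] represents.
    Their finiteness is recorded so that limits can later be subtracted. *)
Theorem weak_compactness (nu : nat -> {measure set Rn -> \bar R}) :
  (forall M : R, exists C : R, forall k, nu k [set z : Rn | (`|z| <= M)%R] <= C%:E)%E ->
  exists2 h : nat -> nat, increasing_seq h &
  exists s : {measure set Rn -> \bar R}, forall f, ccp f ->
    (\int[s]_x (f x)%:E)%E \is a fin_num /\
    (\int[nu (h k)]_x (f x)%:E @[k --> \oo] --> \int[s]_x (f x)%:E)%E.
Proof.
move=> nub.
have nufin k (M : R) : (nu k [set z : Rn | (`|z| <= M)%R] < +oo)%E.
  by have [C HC] := nub M; rewrite (le_lt_trans (HC k))// ltry.
pose Lam k (f : Rn -> R) := fine (\int[nu k]_x (f x)%:E).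
have Lp k : pos_functional (Lam k) by exact: integral_pos_functional.
have LamE k f : ccp f -> (\int[nu k]_x (f x)%:E)%E = (Lam k f)%:E.
  by move=> fc; rewrite /Lam fineK// ccp_integral_fin.
have [|h hi hc] := functional_subsequence Lp.
  move=> f fc; have [M fM f0M] := ccp_bounded fc.
  have [C HC] := nub M.
  have M0 : 0 <= M by apply: le_trans (fM 0); exact: ccp_ge0.
  exists (M * C) => k; rewrite -lee_fin -LamE//.
  have f0K x : ~ [set z : Rn | `|z| <= M] x -> f x = 0.
    by move=> /= /negP; rewrite -ltNge => /f0M.
  apply: (le_trans (ccp_integral_le (nu k) fc (@closed_norm_ball_Borel R n M) M0 fM f0K)).
  by rewrite EFinM lee_wpmul2l// lee_fin.
exists h => //.
pose L f := limn (fun k => Lam (h k) f).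
have [s sP] : exists s : {measure set Rn -> \bar R},
    forall f, ccp f -> (\int[s]_x (f x)%:E = (L f)%:E)%E.
  apply: riesz_markov.
  - move=> f fc; apply: limr_ge; first exact: hc.
    by apply: nearW => k; case: (Lp (h k)) => + _ _; exact.
  - move=> f g fc gc; rewrite /L -limD//; [|exact: hc|exact: hc].
    by congr (limn _); apply/funext => k; case: (Lp (h k)) => _ + _; exact.
  - move=> f c fc c0; apply/cvg_lim; first exact: Rhausdorff.
    rewrite (_ : (fun k => _) = (fun k => c * Lam (h k) f)); last first.
      by apply/funext => k; case: (Lp (h k)) => _ _; exact.
    by apply: cvgMl_tmp; exact: hc.
exists s => f fc; rewrite sP//; split=> //.
under eq_fun do rewrite LamE//.
by apply: cvg_EFin; [exact: nearW|exact: hc].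
Qed.

End WeakCompactness.

(** * Euclidean balls and radial cut-offs *)

Section Euclid.
Context (R : realType) (n : nat).
Local Notation Rn := 'rV[R]_n.
Implicit Types x y z : Rn.

Lemma enorm_ge0 x : 0 <= enorm x. Proof. exact: sqrtr_ge0. Qed.

Let sqsum_ge0 x : 0 <= \sum_(i < n) x ord0 i ^+ 2.
Proof. by apply: sumr_ge0 => i _; exact: sqr_ge0. Qed.

Lemma enorm_sqr x : enorm x ^+ 2 = \sum_(i < n) x ord0 i ^+ 2.
Proof. by rewrite sqr_sqrtr. Qed.

Lemma enormZ c x : enorm (c *: x) = `|c| * enorm x.
Proof.
rewrite /enorm -sqrtr_sqr -sqrtrM ?sqr_ge0//; congr (Num.sqrt _).
by rewrite mulr_sumr; apply: eq_bigr => i _; rewrite !mxE exprMn.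
Qed.

Lemma enormN x : enorm (- x) = enorm x.
Proof. by rewrite -scaleN1r enormZ normrN1 mul1r. Qed.

Lemma enorm0 : enorm (0 : Rn) = 0.
Proof. by rewrite -(scale0r 0) enormZ normr0 mul0r. Qed.

Lemma le_norm_enorm x : `|x| <= enorm x.
Proof.
rewrite leNgt; apply/negP => /(row_norm_gt (enorm_ge0 x))[i].
apply/negP; rewrite -leNgt -sqrtr_sqr ler_wsqrtr//.
by rewrite (bigD1 i)//= lerDl sumr_ge0// => j _; exact: sqr_ge0.
Qed.

Lemma enorm_le_norm x : enorm x <= n%:R * `|x|.
Proof.
rewrite -(@ler_pXn2r _ 2)// ?nnegrE ?enorm_ge0 ?mulr_ge0// enorm_sqr exprMn.
apply: (@le_trans _ _ (\sum_(i < n) `|x| ^+ 2)).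
  apply: ler_sum => i _; rewrite -real_normK ?num_real// ler_pXn2r ?nnegrE//.
  exact: le_row_norm.
rewrite sumr_const card_ord -[X in X <= _]mulr_natl ler_wpM2r ?exprn_ge0// -natrX ler_nat.
by rewrite expnS expn1; case: (n) => // k; rewrite leq_pmulr.
Qed.

Lemma enorm_eq0 x : enorm x = 0 -> x = 0.
Proof. by move=> x0; apply/eqP; rewrite -normr_le0 -x0 le_norm_enorm. Qed.

Lemma cauchy_schwarz x y :
  \sum_(i < n) x ord0 i * y ord0 i <= enorm x * enorm y.
Proof.
set S := (X in X <= _).
have [y0|ny0] := eqVneq (enorm y) 0.
  by rewrite /S big1 ?y0 ?mulr0// => i _; rewrite (enorm_eq0 y0) mxE mulr0.
have y0 : 0 < enorm y by rewrite lt_neqAle eq_sym ny0 enorm_ge0.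
(* The sum is the squared norm of |y|^2 x - <x, y> y, the unnormalized part of x orthogonal to y. *)
have : 0 <= \sum_(i < n) (enorm y ^+ 2 * x ord0 i - S * y ord0 i) ^+ 2.
  by apply: sumr_ge0 => i _; exact: sqr_ge0.
have -> : \sum_(i < n) (enorm y ^+ 2 * x ord0 i - S * y ord0 i) ^+ 2 =
    enorm y ^+ 2 * ((enorm x * enorm y) ^+ 2 - S ^+ 2).
  transitivity (\sum_(i < n) (enorm y ^+ 4 * x ord0 i ^+ 2 +
      (- (2 * S * enorm y ^+ 2)) * (x ord0 i * y ord0 i) + S ^+ 2 * y ord0 i ^+ 2)).
    by apply: eq_bigr => i _; ring.
  by rewrite !big_split /= -!mulr_sumr -/S -!enorm_sqr; ring.
rewrite pmulr_rge0 ?exprn_gt0// subr_ge0 => h.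
rewrite leNgt; apply/negP => lt; move: h; apply/negP; rewrite -ltNge.
by rewrite ltr_pXn2r// nnegrE ?mulr_ge0 ?enorm_ge0// (le_trans _ (ltW lt))// mulr_ge0 ?enorm_ge0.
Qed.

Lemma ler_enormD x y : enorm (x + y) <= enorm x + enorm y.
Proof.
rewrite -(@ler_pXn2r _ 2)// ?nnegrE ?addr_ge0 ?enorm_ge0//.
rewrite sqrrD !enorm_sqr.
rewrite (_ : \sum_(i < n) (x + y) ord0 i ^+ 2 = \sum_(i < n) x ord0 i ^+ 2 +
  (\sum_(i < n) x ord0 i * y ord0 i) *+ 2 + \sum_(i < n) y ord0 i ^+ 2).
  by rewrite lerD2r lerD2l lerMn2r/=; exact: cauchy_schwarz.
by rewrite -sumrMnl -!big_split /=; apply: eq_bigr => i _; rewrite !mxE sqrrD.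
Qed.

Lemma enorm_distC x y : enorm (x - y) = enorm (y - x).
Proof. by rewrite -enormN opprB. Qed.

Lemma enorm_distD z x y : enorm (x - y) <= enorm (x - z) + enorm (z - y).
Proof. by rewrite (_ : x - y = (x - z) + (z - y)) ?ler_enormD// addrA subrK. Qed.

Lemma enorm_lipschitz x y : `|enorm x - enorm y| <= enorm (x - y).
Proof.
have h (u v : Rn) : enorm u <= enorm v + enorm (u - v).
  by rewrite -{1}[u](subrK v) [leRHS]addrC ler_enormD.
have h1 := h x y; have h2 := h y x; rewrite (enorm_distC y x) in h2.
by rewrite ler_norml; apply/andP; split; lra.
Qed.

Lemma lipschitz_enorm_continuous (u : Rn -> R) (k : R) : 0 <= k ->
  (forall x y, `|u x - u y| <= k * enorm (x - y)) -> continuous u.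
Proof.
move=> k0 H; apply: (@lipschitz_norm_continuous _ _ u (k * n%:R)); first exact: mulr_ge0.
move=> x z; apply: (le_trans (H x z)); rewrite -mulrA ler_wpM2l//.
exact: enorm_le_norm.
Qed.

Lemma continuous_enorm_dist x : continuous (fun y : Rn => enorm (y - x)).
Proof.
apply: (@lipschitz_enorm_continuous _ 1) => // y z; rewrite mul1r.
by apply: (le_trans (enorm_lipschitz _ _)); rewrite opprB addrA subrK.
Qed.

Lemma eball_open x r : open (eball x r).
Proof.
rewrite (_ : eball x r = (fun y => enorm (y - x)) @^-1` [set t | t < r])//.
by apply: open_comp; [move=> z _; exact: continuous_enorm_dist|exact: open_lt].
Qed.

Lemma eball_Borel x r : measurable (eball x r).
Proof. by apply: open_Borel; exact: eball_open. Qed.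

Lemma sub_eball x y r s : enorm (y - x) + r <= s -> eball y r `<=` eball x s.
Proof.
move=> h z; rewrite /eball /= => zy; apply: lt_le_trans h.
by apply: (le_lt_trans (enorm_distD y z x)); rewrite addrC ltrD2l.
Qed.

Lemma le_eball x r s : r <= s -> eball x r `<=` eball x s.
Proof. by move=> rs; apply: sub_eball; rewrite subrr enorm0 add0r. Qed.

Lemma enorm_homothety_continuous (G : Rn -> Rn) (l : R) :
  (forall x y, enorm (G x - G y) <= l * enorm (x - y)) -> continuous G.
Proof.
move=> H; suff: forall z : Rn, G y @[y --> z] --> G z by [].
move=> z; apply/(@cvgrPdist_lt _ Rn Rn (nbhs z) (nbhs_filter z) G (G z)) => e e0.
pose k := `|l| * n%:R + 1.
have k0 : 0 < k by rewrite ltr_wpDl// mulr_ge0.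
apply: filterS (nbhsx_ballx z (e / k) (divr_gt0 e0 k0)) => x; rewrite -ball_normE /= => zx.
apply: (le_lt_trans (le_norm_enorm _)); apply: (le_lt_trans (H _ _)).
apply: (@le_lt_trans _ _ (`|l| * (n%:R * `|z - x|))).
  apply: (le_trans (ler_wpM2r (enorm_ge0 _) (ler_norm l))).
  by rewrite ler_wpM2l// enorm_le_norm.
apply: (@le_lt_trans _ _ (k * `|z - x|)); first by rewrite mulrA ler_wpM2r// lerDl.
by rewrite mulrC -ltr_pdivlMr.
Qed.

End Euclid.

Section RadialCutoff.
Context (R : realType) (n : nat).
Local Notation Rn := 'rV[R]_n.
Variable b : R.
Hypothesis b01 : 0 < b < 1.

Definition cutoff (z : Rn) : R := Num.min 1 (Num.max 0 ((1 - enorm z) / (1 - b))).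

Let b1 : 0 < 1 - b. Proof. by case/andP: b01 => _; rewrite subr_gt0. Qed.

Lemma cutoff_ge0 z : 0 <= cutoff z.
Proof. by rewrite /cutoff le_min ler01/= le_max lexx. Qed.

Lemma cutoff_le1 z : cutoff z <= 1.
Proof. by rewrite /cutoff ge_min lexx. Qed.

Lemma cutoff_eq1 z : enorm z <= b -> cutoff z = 1.
Proof.
by move=> zb; rewrite /cutoff min_l// le_max ler_pdivlMr// mul1r lerD2l lerN2 zb orbT.
Qed.

Lemma cutoff_eq0 z : 1 <= enorm z -> cutoff z = 0.
Proof.
move=> z1; rewrite /cutoff max_l ?min_r//.
by rewrite pmulr_lle0 ?invr_gt0// subr_le0.
Qed.

Lemma clamp_lipschitz (s t : R) :
  `|Num.min 1 (Num.max 0 s) - Num.min 1 (Num.max 0 t)| <= `|s - t|.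
Proof.
wlog st : s t / s <= t.
  by move=> h; have [/h//|/ltW/h] := leP s t; rewrite distrC [leRHS]distrC.
rewrite distrC [leRHS]distrC ger0_norm; last first.
  rewrite subr_ge0 le_min ge_min lexx/= ge_min; apply/orP; right.
  by rewrite ge_max !le_max lexx st orbT.
rewrite (ger0_norm (_ : 0 <= t - s)) ?subr_ge0// /Num.min /Num.max.
by repeat case: ifPn; rewrite -?leNgt => *; lra.
Qed.

Lemma cutoff_lipschitz x y : `|cutoff x - cutoff y| <= (1 - b)^-1 * enorm (x - y).
Proof.
apply: (le_trans (clamp_lipschitz _ _)).
rewrite -mulrBl normrM mulrC (ger0_norm (_ : 0 <= (1 - b)^-1)) ?invr_ge0 ?(ltW b1)//.
rewrite ler_wpM2l ?invr_ge0 ?(ltW b1)// opprB addrC addrA subrK distrC.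
exact: enorm_lipschitz.
Qed.

Lemma cutoff_ccp : ccp cutoff.
Proof.
split; last 2 first.
- exact: cutoff_ge0.
- by exists 1 => z z1; apply: cutoff_eq0; apply: le_trans (ltW z1) (le_norm_enorm z).
apply: (@lipschitz_enorm_continuous _ _ _ (1 - b)^-1); first by rewrite invr_ge0 ltW.
exact: cutoff_lipschitz.
Qed.

End RadialCutoff.

(** * Blow-ups of doubling measures *)

Section Blowup.
Context (R : realType) (n : nat).
Local Notation Rn := 'rV[R]_n.

(** [scalem] and [pushforward] yield bare set functions; exhibiting an equal measure gives access to
    the theorems on integrals. *)
Lemma scalem_pushforward (mu : {measure set Rn -> \bar R}) (c : R) (g : Rn -> Rn) :
  0 <= c -> continuous g ->
  exists2 nu : {measure set Rn -> \bar R}, scalem c (pushforward mu g) = nu &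
   forall f : Rn -> R, measurable_fun setT (fun z => (f z)%:E) -> (forall z, 0 <= f z) ->
    (\int[nu]_z (f z)%:E = c%:E * \int[mu]_z (f (g z))%:E)%E.
Proof.
move=> c0 gc; have mg := continuous_Borel_fun gc.
pose pm := measure_function_pushforward__canonical__measure_function_Measure mu mg.
exists (mscale (NngNum c0) pm) => // f mf f0.
rewrite (ge0_integral_mscale pm measurableT (NngNum c0) mf); last by move=> z _; rewrite lee_fin.
congr (_ * _)%E.
rewrite (ge0_integral_pushforward mg mu measurableT mf) ?preimage_setT//.
by move=> z _; rewrite lee_fin.
Qed.

Lemma blowupE (mu : set Rn -> \bar R) (x : Rn) r : 0 < r ->
  blowup mu x r = pushforward mu (fun z => r^-1 *: (z - x)).
Proof.
move=> r0; apply/funext => A; rewrite /blowup /pushforward; congr (mu _).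
apply/seteqP; split=> z /=.
  by move=> [y Ay <-]; rewrite addrC addKr scalerA mulVf ?gt_eqF// scale1r.
move=> Az; exists (r^-1 *: (z - x)) => //.
by rewrite scalerA mulfV ?gt_eqF// scale1r addrC subrK.
Qed.

Lemma rescale_continuous (x : Rn) (r : R) : continuous (fun z : Rn => r *: (z - x)).
Proof.
apply: (@enorm_homothety_continuous _ _ _ `|r|) => y z.
by rewrite -scalerBr enormZ opprB addrA subrK.
Qed.

Lemma similarity_dist lam (G : Rn -> Rn) : similarity lam G ->
  forall y z, enorm (G y - G z) = lam * enorm (y - z).
Proof.
move=> [lam0 [T [_ TI] GE]] y z.
by rewrite !GE -scalerBr enormZ TI gtr0_norm.
Qed.

Lemma similarity_continuous lam (G : Rn -> Rn) : similarity lam G -> continuous G.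
Proof.
move=> sG; apply: (@enorm_homothety_continuous _ _ _ lam) => y z.
by rewrite (similarity_dist sG).
Qed.

Lemma cutoff_enorm b (y z : Rn) : enorm y = enorm z -> cutoff b y = cutoff b z.
Proof. by rewrite /cutoff => ->. Qed.

Lemma cutoff_rescaled_ccp b (x : Rn) r : 0 < b < 1 -> 0 < r ->
  ccp (fun z : Rn => cutoff b (r^-1 *: (z - x))).
Proof.
move=> b01 r0; have [cc _ _] := cutoff_ccp n b01; split.
- move=> z; apply: (@continuous_comp _ _ _ (fun z : Rn => r^-1 *: (z - x)) (cutoff b)).
    exact: rescale_continuous.
  exact: cc.
- by move=> z; exact: cutoff_ge0.
- exists (`|x| + r) => z zr; apply: (cutoff_eq0 b01).
  rewrite enormZ ger0_norm ?invr_ge0 ?(ltW r0)// mulrC ler_pdivlMr// mul1r.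
  apply: le_trans (le_norm_enorm _).
  have := ler_distD 0 z x; have := lerB_dist z x; lra.
Qed.

End Blowup.

(** * Masses and smoothed masses around a support point *)

Section DoublingAtPoint.
Context (R : realType) (n : nat).
Local Notation Rn := 'rV[R]_n.
Variables (mu : {measure set Rn -> \bar R}) (x : Rn) (b : R).
Hypotheses (mud : doubling mu) (xS : msupport mu x) (b01 : 0 < b < 1).

Definition mass r : R := fine (mu (eball x r)).

Definition smooth r : R := fine (\int[mu]_z (cutoff b (r^-1 *: (z - x)))%:E).

(** Local finiteness gives one finite radius at x, and doubling at the support point x propagates it
    to 2^k times that radius. *)
Lemma eball_lty r : (mu (eball x r) < +oo)%E.
Proof.
have [rad [C C0 HC]] := mud; have [r0 r0_gt0 r0fin] := rad x.
have H k : (mu (eball x (2 ^+ k * r0)) < +oo)%E.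
  elim: k => [|k IH]; first by rewrite expr0 mul1r.
  rewrite exprS -mulrA (le_lt_trans (HC _ _ xS _))//.
    by rewrite mulr_gt0 ?exprn_gt0.
  by rewrite lte_mul_pinfty// lee_fin ltW.
apply: le_lt_trans (H (Num.bound (r / r0))).
apply: le_measure; rewrite ?inE; [exact: eball_Borel|exact: eball_Borel|].
apply: le_eball; rewrite -ler_pdivrMr//; apply: ltW.
exact: upper_nthrootP.
Qed.

Lemma massE r : mu (eball x r) = (mass r)%:E.
Proof. by rewrite /mass fineK// ge0_fin_numE ?eball_lty. Qed.

Lemma mass_gt0 r : 0 < r -> 0 < mass r.
Proof. by move=> r0; rewrite -lte_fin -massE; exact: xS. Qed.

Lemma mass_ge0 r : 0 <= mass r. Proof. exact: fine_ge0. Qed.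

Lemma le_mass r s : r <= s -> mass r <= mass s.
Proof.
move=> rs; rewrite -lee_fin -!massE.
apply: le_measure; rewrite ?inE; [exact: eball_Borel|exact: eball_Borel|].
exact: le_eball.
Qed.

(** Doubling is iterated j times with 2^j > 1/c, which gives k = C^-j. *)
Lemma mass_lower_bound c : 0 < c -> exists2 k, 0 < k &
  forall r, 0 < r -> k * mass r <= mass (c * r).
Proof.
move=> c0; have [_ [C C0 HC]] := mud.
pose j := Num.bound c^-1.
have jc : c^-1 < 2 ^+ j by exact: upper_nthrootP.
have H i s : 0 < s -> mass (2 ^+ i * s) <= C ^+ i * mass s.
  move=> s0; elim: i => [|i IH]; first by rewrite !expr0 !mul1r.
  rewrite !exprS -!mulrA.
  apply: (@le_trans _ _ (C * mass (2 ^+ i * s))); last by rewrite ler_wpM2l// ltW.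
  by rewrite -lee_fin EFinM -!massE HC// mulr_gt0// exprn_gt0.
exists (C ^+ j)^-1; first by rewrite invr_gt0 exprn_gt0.
move=> r r0; rewrite mulrC ler_pdivrMr ?exprn_gt0//.
have := H j (r / 2 ^+ j); rewrite divr_gt0 ?exprn_gt0// => /(_ isT).
rewrite mulrCA mulfV ?expf_neq0// mulr1 mulrC => /le_trans; apply.
rewrite ler_wpM2r ?exprn_ge0 ?(ltW C0)// le_mass// mulrC ler_wpM2r ?(ltW r0)//.
by rewrite -[leRHS]invrK lef_pV2 ?posrE ?exprn_gt0 ?invr_gt0// ltW.
Qed.

Let cutoff_Borel r : 0 < r ->
  measurable_fun setT (fun z : Rn => (cutoff b (r^-1 *: (z - x)))%:E).
Proof. by move=> r0; apply: ccp_Borel; exact: cutoff_rescaled_ccp. Qed.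

Let enorm_rescale r z : 0 < r -> enorm (r^-1 *: (z - x)) = enorm (z - x) / r.
Proof. by move=> r0; rewrite enormZ ger0_norm ?invr_ge0 ?(ltW r0)// mulrC. Qed.

Lemma integral_cutoff_le r : 0 < r ->
  (\int[mu]_z (cutoff b (r^-1 *: (z - x)))%:E <= mu (eball x r))%E.
Proof.
move=> r0; have := @ccp_integral_le R n mu (eball x r) _ 1 (cutoff_rescaled_ccp x b01 r0)
  (@eball_Borel _ _ _ _) ler01 (fun z => cutoff_le1 b _).
rewrite mul1e; apply => z /negP; rewrite -leNgt => rz; apply: (cutoff_eq0 b01).
by rewrite enorm_rescale// ler_pdivlMr// mul1r.
Qed.

Lemma smoothE r : 0 < r -> (\int[mu]_z (cutoff b (r^-1 *: (z - x)))%:E)%E = (smooth r)%:E.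
Proof.
move=> r0; rewrite /smooth fineK// ge0_fin_numE.
  exact: le_lt_trans (integral_cutoff_le r0) (eball_lty r).
by apply: integral_ge0 => z _; rewrite lee_fin cutoff_ge0.
Qed.

Lemma smooth_le_mass r : 0 < r -> smooth r <= mass r.
Proof. by move=> r0; rewrite -lee_fin -smoothE// -massE integral_cutoff_le. Qed.

Lemma mass_le_smooth r : 0 < r -> mass (b * r) <= smooth r.
Proof.
move=> r0; rewrite -lee_fin -smoothE// -massE.
have mB := @eball_Borel R n x (b * r).
rewrite -(setIT (eball x (b * r))) -integral_indic//.
apply: ge0_le_integral => //.
- exact/measurable_EFinP/measurable_indic.
- exact: cutoff_Borel.
move=> z _; rewrite lee_fin indicE; have [/set_mem zb|_] := boolP (z \in _).
  by rewrite (cutoff_eq1 b01)// enorm_rescale// ler_pdivrMr// ltW.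
exact: cutoff_ge0.
Qed.

Lemma smooth_gt0 r : 0 < r -> 0 < smooth r.
Proof.
move=> r0; apply: lt_le_trans (mass_le_smooth r0); apply: mass_gt0.
by rewrite mulr_gt0//; case/andP: b01.
Qed.

Lemma integral_blowup t c rho : 0 < t -> 0 <= c -> 0 < rho ->
  (\int[scalem c (blowup mu x t)]_z (cutoff b (rho^-1 *: z))%:E)%E =
  (c * smooth (rho * t))%:E.
Proof.
move=> t0 c0 rho0; rewrite blowupE//.
have [nu -> ->] := scalem_pushforward mu c0 (@rescale_continuous R n x t^-1).
- rewrite (_ : (\int[mu]_z _)%E = (smooth (rho * t))%:E)//.
  rewrite -(smoothE (mulr_gt0 rho0 t0)).
  by apply: eq_integral => z _; rewrite scalerA invfM.
- apply: ccp_Borel; have := cutoff_rescaled_ccp (0 : Rn) b01 rho0.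
  by under eq_fun do rewrite subr0.
- by move=> z; exact: cutoff_ge0.
Qed.

(* Scaled cut-offs are radial, so they do not see the rotation in a
   similarity fixing the base point. *)
Lemma W1_smooth_ratio t lam G a : 0 < t -> similarity lam G -> G x = 0 ->
  (W1 (normalize1 (pushforward mu G)) (blowup0 mu x t) <= a%:E)%E ->
  forall rho, 0 < rho <= 1 ->
  `|smooth (rho * lam^-1) / mass lam^-1 - smooth (rho * t) / mass t| <=
  a / (rho * (1 - b)).
Proof.
move=> t0 sG Gx W1a rho /andP[rho0 rho1].
have lam0 : 0 < lam by case: sG.
have c1 : 0 < 1 - b by case/andP: b01 => _; rewrite subr_gt0.
have k0 : 0 < rho * (1 - b) by rewrite mulr_gt0.
(* The cut-off has Lipschitz constant 1/(1 - b), dilation multiplies it by 1/rho, and the prefactor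
   restores 1. Since rho <= 1, [psi] vanishes off the unit ball. *)
pose psi (z : Rn) := rho * (1 - b) * cutoff b (rho^-1 *: z).
have psiL : Lip1 psi.
  split=> [y z|z /negP].
    rewrite /psi -mulrBr normrM gtr0_norm//.
    apply: (le_trans (ler_wpM2l (ltW k0) (cutoff_lipschitz b01 _ _))).
    rewrite -scalerBr enormZ gtr0_norm ?invr_gt0//.
    rewrite (_ : _ * _ = enorm (y - z))//; field.
    by rewrite !lt0r_neq0.
  rewrite -leNgt subr0 => z1; rewrite /psi (cutoff_eq0 b01) ?mulr0//.
  rewrite enormZ ger0_norm ?invr_ge0 ?(ltW rho0)// mulrC ler_pdivlMr// mul1r.
  exact: le_trans z1.
have psic : ccp psi.
  apply: ccpZ (ltW k0); have := cutoff_rescaled_ccp (0 : Rn) b01 rho0.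
  by under eq_fun do rewrite subr0.
have I1 : (\int[normalize1 (pushforward mu G)]_z (psi z)%:E)%E =
    (rho * (1 - b) * (smooth (rho * lam^-1) / mass lam^-1))%:E.
  rewrite /normalize1.
  have -> : pushforward mu G (eball 0 1) = mu (eball x lam^-1).
    rewrite /pushforward; congr (mu _); apply/seteqP; split => z; rewrite /eball /= subr0.
      by rewrite -[G z]subr0 -Gx (similarity_dist sG) -ltr_pdivlMl// mulr1.
    by rewrite -[G z]subr0 -Gx (similarity_dist sG) -ltr_pdivlMl// mulr1.
  have ci : 0 <= (mass lam^-1)^-1 by rewrite invr_ge0 mass_ge0.
  have [nu -> ->] := scalem_pushforward mu ci (similarity_continuous sG).
  - rewrite (_ : (\int[mu]_z (psi (G z))%:E)%E = (rho * (1 - b) * smooth (rho * lam^-1))%:E).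
      by rewrite -EFinM; congr EFin; ring.
    have rl0 : 0 < rho * lam^-1 by rewrite divr_gt0.
    have -> : (rho * (1 - b) * smooth (rho * lam^-1))%:E =
       ((rho * (1 - b))%:E * \int[mu]_z (cutoff b ((rho * lam^-1)^-1 *: (z - x)))%:E)%E.
      by rewrite smoothE.
    rewrite -ge0_integralZl//.
    + apply: eq_integral => z _; rewrite -EFinM; congr EFin; rewrite /psi.
      congr (_ * _); apply: cutoff_enorm.
      rewrite !enormZ -[G z]subr0 -Gx (similarity_dist sG).
      by rewrite !ger0_norm ?invr_ge0 ?mulr_ge0 ?invr_ge0 ?(ltW lam0) ?(ltW rho0)// invfM invrK mulrA.
    + by apply: cutoff_Borel; rewrite divr_gt0.
    + by move=> z _; rewrite lee_fin cutoff_ge0.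
    + by rewrite lee_fin ltW.
  - exact: ccp_Borel.
  - by move=> z; exact: ccp_ge0.
have I2 : (\int[blowup0 mu x t]_z (psi z)%:E)%E =
    (rho * (1 - b) * (smooth (rho * t) / mass t))%:E.
  have ci : 0 <= (mass t)^-1 by rewrite invr_ge0 mass_ge0.
  have := integral_blowup t0 ci rho0; rewrite /blowup0 -/(mass t).
  rewrite blowupE//.
  have [nu -> _] := scalem_pushforward mu ci (@rescale_continuous R n x t^-1).
  move=> H; under eq_integral do rewrite EFinM.
  rewrite ge0_integralZl//.
  + by rewrite H -EFinM; congr EFin; ring.
  + apply: ccp_Borel; have := cutoff_rescaled_ccp (0 : Rn) b01 rho0.
    by under eq_fun do rewrite subr0.
  + by move=> z _; rewrite lee_fin cutoff_ge0.
  + by rewrite lee_fin ltW.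
have : (`| \int[normalize1 (pushforward mu G)]_z (psi z)%:E -
           \int[blowup0 mu x t]_z (psi z)%:E | <= a%:E)%E.
  by apply: le_trans W1a; apply: ereal_sup_ubound; exists psi.
rewrite I1 I2 -EFinB lee_fin -mulrBr normrM ger0_norm ?(ltW k0)//.
by rewrite mulrC ler_pdivlMr.
Qed.

End DoublingAtPoint.

(** * Hausdorff measure and flat measures *)

Section Hausdorff.
Context (R : realType) (n : nat).
Local Notation Rn := 'rV[R]_n.
Local Open Scope ereal_scope.
Implicit Types A F : set Rn.

Lemma expe_ge0 (x : \bar R) d : 0 <= x -> 0 <= x ^+ d.
Proof. by move=> x0; elim: d => [|d IH]; rewrite ?expe0 ?lee01// expeS mule_ge0. Qed.

Lemma lee_expe (x y : \bar R) d : 0 <= x -> x <= y -> x ^+ d <= y ^+ d.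
Proof.
move=> x0 xy; elim: d => [|d IH]; first by rewrite !expe0.
by rewrite !expeS lee_pmul// expe_ge0.
Qed.

Lemma expe_EFinM (c : R) (x : \bar R) d : (c%:E * x) ^+ d = (c ^+ d)%:E * x ^+ d.
Proof.
elim: d => [|d IH]; first by rewrite !expe0 expr0 mule1.
by rewrite !expeS IH exprS EFinM muleACA.
Qed.

Lemma diam_ge0 F : 0 <= diam F.
Proof. by apply: ereal_sup_ubound; left. Qed.

Lemma diam_le F (c : R) : (0 <= c)%R ->
  (forall x y, F x -> F y -> (enorm (x - y) <= c)%R) -> diam F <= c%:E.
Proof.
move=> c0 H; apply: ge_ereal_sup => _ [->|[x Fx [y Fy <-]]]; first by rewrite lee_fin.
by rewrite lee_fin H.
Qed.

Lemma le_diam F x y : F x -> F y -> (enorm (x - y))%:E <= diam F.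
Proof. by move=> Fx Fy; apply: ereal_sup_ubound; right; exists x => //; exists y. Qed.

Lemma diam_scale_le (c : R) F : (0 <= c)%R ->
  diam [set (c *: y)%R | y in F] <= c%:E * diam F.
Proof.
move=> c0; apply: ge_ereal_sup => _ [->|[_ [x Fx <-] [_ [y Fy <-] <-]]].
  by rewrite mule_ge0// diam_ge0.
by rewrite -scalerBr enormZ ger0_norm// EFinM lee_wpmul2l// le_diam.
Qed.

Lemma hausdorff_pre_ge0 d delta A : 0 <= hausdorff_pre d delta A.
Proof.
apply: le_ereal_inf_tmp => _ [F _ <-]; apply: nneseries_ge0 => i _ _.
exact/expe_ge0/diam_ge0.
Qed.

Lemma hausdorff_ge0 d A : 0 <= hausdorff d A.
Proof.
apply: (le_trans (hausdorff_pre_ge0 d 1%R A)); apply: ereal_sup_ubound.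
by exists 1%R => //=; exact: ltr01.
Qed.

Lemma hausdorff_pre_le d delta A : (0 < delta)%R ->
  hausdorff_pre d delta A <= hausdorff d A.
Proof. by move=> d0; apply: ereal_sup_ubound; exists delta. Qed.

Lemma hausdorff_pre_scale d (c delta : R) A : (0 < c)%R ->
  hausdorff_pre d (c * delta) [set (c *: y)%R | y in A] <=
  (c ^+ d)%:E * hausdorff_pre d delta A.
Proof.
move=> c0; have cd : (0 < c ^+ d)%R by rewrite exprn_gt0.
rewrite -lee_pdivrMl//; apply: le_ereal_inf_tmp => _ [F [AF Fd] <-].
rewrite lee_pdivrMl//.
apply: (@le_trans _ _ (\sum_(0 <= i <oo) diam [set (c *: y)%R | y in F i] ^+ d)).
  apply: ereal_inf_lbound; exists (fun i => [set (c *: y)%R | y in F i]) => //.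
  split=> [_ [y /AF[i _ Fiy] <-]|i]; first by exists i => //; exists y.
  apply: (le_trans (diam_scale_le _ (ltW c0))).
  by rewrite EFinM lee_wpmul2l// lee_fin ltW.
rewrite -nneseriesZl; last by move=> i _; exact/expe_ge0/diam_ge0.
apply: lee_nneseries => [i _ _|i _]; first exact/expe_ge0/diam_ge0.
by rewrite -expe_EFinM; apply: lee_expe; [exact: diam_ge0|exact/diam_scale_le/ltW].
Qed.

Let hausdorff_scale_le d (c : R) A : (0 < c)%R ->
  hausdorff d [set (c *: y)%R | y in A] <= (c ^+ d)%:E * hausdorff d A.
Proof.
move=> c0; apply: ge_ereal_sup => _ [delta /= d0 <-].
rewrite -[delta](mulfVK (lt0r_neq0 c0)) mulrC.
apply: (le_trans (hausdorff_pre_scale _ _ _ c0)).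
apply: lee_wpmul2l; first by rewrite lee_fin exprn_ge0// ltW.
by apply: hausdorff_pre_le; rewrite divr_gt0.
Qed.

Lemma hausdorff_scale d (c : R) A : (0 < c)%R ->
  hausdorff d [set (c *: y)%R | y in A] = (c ^+ d)%:E * hausdorff d A.
Proof.
move=> c0; apply/eqP; rewrite eq_le hausdorff_scale_le//=.
have ci : (0 < c^-1)%R by rewrite invr_gt0.
have := hausdorff_scale_le d [set (c *: y)%R | y in A] ci.
rewrite exprVn lee_pdivlMl ?exprn_gt0//; congr (_ * hausdorff d _ <= _).
apply/seteqP; split=> [_ [_ [y Ay <-] <-]|y Ay].
  by rewrite scalerA mulVf ?scale1r// lt0r_neq0.
exists (c *: y)%R; first by exists y.
by rewrite scalerA mulVf ?scale1r// lt0r_neq0.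
Qed.

(** Dilations preserve a linear subspace, so flat measures inherit the d-homogeneity of Hausdorff
    measure. *)
Lemma flat_scale d (s : {measure set Rn -> \bar R}) (c : R) A : flat d s ->
  (0 < c)%R -> measurable A ->
  s ((fun z : Rn => (c^-1 *: z)%R) @^-1` A) = (c ^+ d)%:E * s A.
Proof.
move=> [k [V [k0 _ sE]]] c0 mA.
have ci : (0 < c^-1)%R by rewrite invr_gt0.
have gc : continuous (fun z : Rn => (c^-1 *: z)%R).
  by apply: (@enorm_homothety_continuous _ _ _ c^-1) => x y; rewrite -scalerBr enormZ gtr0_norm.
have mpre : measurable ((fun z : Rn => (c^-1 *: z)%R) @^-1` A).
  by rewrite -[X in measurable X]setTI; exact: continuous_Borel_fun.
rewrite !sE// muleCA -hausdorff_scale//; congr (_ * hausdorff d _).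
apply/seteqP; split=> z /=.
  move=> [Az Vz]; exists (c^-1 *: z)%R; first by split=> //=; exact: memvZ.
  by rewrite scalerA mulfV ?scale1r// lt0r_neq0.
move=> [y [Ay Vy] <-]; split; last exact: memvZ.
by rewrite scalerA mulVf ?scale1r// lt0r_neq0.
Qed.

Lemma flat_integral_scale d (s : {measure set Rn -> \bar R}) (c : R) (f : Rn -> R) :
  flat d s -> (0 < c)%R -> measurable_fun setT (fun z => (f z)%:E) ->
  (forall z, (0 <= f z)%R) ->
  \int[s]_z (f (c^-1 *: z)%R)%:E = (c ^+ d)%:E * \int[s]_z (f z)%:E.
Proof.
move=> sf c0 mf f0.
have gc : continuous (fun z : Rn => (c^-1 *: z)%R).
  apply: (@enorm_homothety_continuous _ _ _ c^-1) => x y.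
  by rewrite -scalerBr enormZ gtr0_norm ?invr_gt0.
have ic : continuous (fun z : Rn => z) by move=> z; exact: cvg_id.
have cd : (0 <= c ^+ d)%R by rewrite exprn_ge0// ltW.
(* Pushing forward by the identity absorbs the factor c^d into a measure, so that only an equality
   of measures remains. *)
have [nu nuE <-//] := scalem_pushforward s cd ic.
have [nu' nu'E H'] := scalem_pushforward s ler01 gc.
have := H' f mf f0; rewrite mul1e => <-.
apply: eq_measure_integral => A mA _.
rewrite -nuE -nu'E /scalem /pushforward mul1e; exact: flat_scale.
Qed.

End Hausdorff.

(** * Tangent measures *)

Section Tangents.
Context (R : realType) (n : nat).
Local Notation Rn := 'rV[R]_n.

Lemma compact_support_bounded (phi : Rn -> R) :
  compact (closure [set z | phi z != 0]) -> exists M, forall z : Rn, M < `|z| -> phi z = 0.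
Proof.
move=> /compact_bounded[M [_ HM]]; exists (M + 1) => z Mz.
apply/eqP/negPn/negP => phiz.
have phicl : closure [set z | phi z != 0] z by apply: subset_closure.
by have := HM (M + 1); rewrite ltrDl ltr01 => /(_ isT z phicl) /=; rewrite leNgt Mz.
Qed.

(** A signed test function is split into positive and negative parts, both in [ccp]; finite limits
    allow the subtraction. *)
Lemma weak_cvg_ccp (nu : nat -> {measure set Rn -> \bar R}) (s : {measure set Rn -> \bar R}) :
  (forall f, ccp f -> (\int[s]_z (f z)%:E)%E \is a fin_num /\
     (\int[nu k]_z (f z)%:E @[k --> \oo] --> \int[s]_z (f z)%:E)%E) ->
  weak_cvg (fun k => nu k : set Rn -> \bar R) s.
Proof.
move=> H phi phic phiK; have [M HM] := compact_support_bounded phiK.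
have pc (g : R -> R) : continuous g -> g 0 = 0 -> ccp (fun z => Num.max (g (phi z)) 0).
  move=> gc g0; split.
  - have c0 : continuous (fun _ : Rn => 0 : R) by exact: cst_continuous.
    have cg : continuous (fun z : Rn => g (phi z)).
      by move=> z; apply: continuous_comp; [exact: phic|exact: gc].
    exact: (max_fun_continuous cg c0).
  - by move=> z; rewrite le_max lexx orbT.
  - by exists M => z /HM ->; rewrite g0 maxxx.
have pp := pc id (fun x => cvg_id) erefl.
have oc : continuous (fun t : R => - t) by move=> t; apply: cvgN; exact: cvg_id.
have pm := pc _ oc (oppr0 _).
have dec (m : {measure set Rn -> \bar R}) : (\int[m]_z (phi z)%:E =
   \int[m]_z (Num.max (phi z) 0)%:E - \int[m]_z (Num.max (- phi z) 0)%:E)%E.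
  rewrite integralE; congr (_ - _)%E; apply: eq_integral => z _.
    by rewrite funeposE -EFin_max.
  by rewrite funenegE -EFinN -EFin_max.
rewrite dec; under eq_fun do rewrite dec.
have [f1 c1] := H _ pp; have [f2 c2] := H _ pm.
by apply: cvgeB => //; rewrite fin_num_adde_defl// fin_numN.
Qed.

Variables (mu : {measure set Rn -> \bar R}) (x : Rn) (b : R) (d : nat).
Hypotheses (mud : doubling mu) (xS : msupport mu x) (b01 : 0 < b < 1).
Local Notation mass := (mass mu x).
Local Notation smooth := (smooth mu x b).

Lemma blowup0_measure r : 0 < r -> exists nu : {measure set Rn -> \bar R},
  blowup0 mu x r = nu.
Proof.
move=> r0; rewrite /blowup0 blowupE//.
have ci : 0 <= (fine (mu (eball x r)))^-1 by rewrite invr_ge0 fine_ge0.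
by have [nu nuE _] := scalem_pushforward mu ci (@rescale_continuous R n x r^-1); exists nu.
Qed.

Lemma blowup0_eball r M : 0 < r -> 0 < M -> blowup0 mu x r (eball 0 M) = (mass (M * r) / mass r)%:E.
Proof.
move=> r0 M0; rewrite /blowup0 /scalem /blowup -/(mass r).
rewrite (_ : _ @` _ = eball x (M * r)); first by rewrite (massE mud xS) -EFinM mulrC.
apply/seteqP; split=> [_ [z zM <-]|z zM]; rewrite /eball /= in zM *.
  rewrite addrC addKr enormZ gtr0_norm// mulrC ltr_pM2r//.
  by rewrite subr0 in zM.
exists (r^-1 *: (z - x)).
  by rewrite subr0 enormZ gtr0_norm ?invr_gt0// mulrC ltr_pdivrMr.
by rewrite scalerA mulfV ?gt_eqF// scale1r addrC subrK.
Qed.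

Lemma integral_blowup0 r rho : 0 < r -> 0 < rho ->
  (\int[blowup0 mu x r]_z (cutoff b (rho^-1 *: z))%:E)%E = (smooth (rho * r) / mass r)%:E.
Proof.
move=> r0 rho0; rewrite /blowup0 -/(mass r) mulrC; apply: integral_blowup => //.
by rewrite invr_ge0 mass_ge0.
Qed.

(** Doubling acts twice: it bounds the normalized blow-ups above on every ball, which gives
    compactness, and it bounds their smoothed masses below, which keeps I positive and the limit
    nonzero. *)
Lemma tangent_subsequence (r : nat -> R) : (forall k, 0 < r k) ->
  r @ \oo --> 0 -> exists2 h : nat -> nat, increasing_seq h &
  exists s : {measure set Rn -> \bar R}, Tan mu x s /\
    forall rho, 0 < rho -> exists2 I : R, 0 < I &
      (\int[s]_z (cutoff b (rho^-1 *: z))%:E)%E = I%:E /\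
      smooth (rho * r (h k)) / mass (r (h k)) @[k --> \oo] --> I.
Proof.
move=> r0 rto0.
have /choice[nu nuE] : forall k, exists nu : {measure set Rn -> \bar R}, blowup0 mu x (r k) = nu.
  by move=> k; exact: blowup0_measure.
have [M|h hi [s sP]] := weak_compactness (nu := nu).
  (* The sup-norm ball of radius M lies in the open Euclidean ball of this radius. *)
  pose rho := n%:R * `|M| + 1.
  have rho0 : 0 < rho by rewrite ltr_wpDl// mulr_ge0.
  have ri : 0 < rho^-1 by rewrite invr_gt0.
  have [k k0 HK] := mass_lower_bound mud xS ri.
  exists k^-1 => j; rewrite -nuE.
  apply: (@le_trans _ _ (blowup0 mu x (r j) (eball 0 rho))).
    rewrite nuE; apply: le_measure; rewrite ?inE.
    - exact: closed_norm_ball_Borel.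
    - exact: eball_Borel.
    move=> z /= zM; rewrite /eball /= subr0 (le_lt_trans (enorm_le_norm z))//.
    rewrite (@le_lt_trans _ _ (n%:R * `|M|))//; last by rewrite ltrDl.
    by rewrite ler_wpM2l// (le_trans zM)// ler_norm.
  rewrite blowup0_eball// lee_fin ler_pdivrMr ?(mass_gt0 mud xS)//.
  rewrite ler_pdivlMl//; have := HK (rho * r j); rewrite mulr_gt0// => /(_ isT).
  by rewrite mulrA mulVf ?mul1r// gt_eqF.
have cut rho : 0 < rho -> ccp (fun z : Rn => cutoff b (rho^-1 *: z)).
  move=> rho0; have := cutoff_rescaled_ccp (0 : Rn) b01 rho0.
  by under eq_fun do rewrite subr0.
have key rho : 0 < rho -> exists2 I : R, 0 < I &
      (\int[s]_z (cutoff b (rho^-1 *: z))%:E)%E = I%:E /\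
      smooth (rho * r (h k)) / mass (r (h k)) @[k --> \oo] --> I.
  move=> rho0; have [sfin scvg] := sP _ (cut _ rho0).
  pose I := fine (\int[s]_z (cutoff b (rho^-1 *: z))%:E).
  have IE : (\int[s]_z (cutoff b (rho^-1 *: z))%:E)%E = I%:E by rewrite /I fineK.
  have cvgI : smooth (rho * r (h k)) / mass (r (h k)) @[k --> \oo] --> I.
    suff : (smooth (rho * r (h k)) / mass (r (h k)))%:E @[k --> \oo] --> I%:E.
      by move/fine_cvgP => [_].
    rewrite -IE (_ : (fun k => _) =
      (fun k => \int[nu (h k)]_z (cutoff b (rho^-1 *: z))%:E)%E)//.
    by apply/funext => k; rewrite -integral_blowup0// nuE.
  exists I; last by split.
  have brho : 0 < b * rho by rewrite mulr_gt0//; case/andP: b01.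
  have [k k0 HK] := mass_lower_bound mud xS brho.
  apply: (lt_le_trans k0); apply: (cvgr_to_ge cvgI); apply: nearW => j.
  rewrite ler_pdivlMr ?(mass_gt0 mud xS)// (le_trans (HK _ (r0 _)))// -mulrA.
  by apply: mass_le_smooth => //; exact: mulr_gt0.
exists h => //; exists s; split=> //; split.
- move=> y; exists 1 => //.
  have [f fc f1] := ccp_bump n (`|y| + 1).
  have [ffin _] := sP _ fc.
  rewrite (@le_lt_trans _ _ (\int[s]_z (f z)%:E)%E)//; last by rewrite ltey_eq ffin.
  rewrite -[leLHS]mul1e; apply: ccp_integral_ge => //; first exact: eball_Borel.
  move=> z; rewrite /eball /= => zy; rewrite f1// -[z](subrK y) (le_trans (ler_normD _ _))//.
  by rewrite addrC lerD2l (le_trans (le_norm_enorm _))// ltW.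
- have [I I0 [IE _]] := key 1 ltr01; apply/eqP => sT.
  have := @ccp_integral_le R n s setT _ 1 (cut 1 ltr01) measurableT ler01 (fun z => cutoff_le1 b _).
  by rewrite IE sT mule0 lee_fin leNgt I0 => /(_ (fun z h => False_ind _ (h Logic.I))).
- exists (r \o h), (fun k => (mass (r (h k)))^-1); split=> [k|k||].
  + exact: r0.
  + by rewrite invr_ge0 mass_ge0.
  + apply/cvgrPdist_lt => e e0; have /cvgrPdist_lt/(_ _ e0)[N _ HN] := rto0.
    by exists N => // k /= Nk; apply: HN => /=; rewrite (leq_trans Nk)// increasing_seq_ge.
  + rewrite (_ : (fun k => _) = (fun k => nu (h k) : set Rn -> \bar R)); last first.
      by apply/funext => k; rewrite -nuE.
    exact: weak_cvg_ccp.
Qed.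

(** Otherwise bad radii r_k -> 0 exist. A subsequence of their blow-ups has a flat limit, and its
    homogeneity forces the quotient, in which [mass] cancels, to tend to c^d. *)
Lemma smooth_ratio_cvg : Tan mu x `<=` flat d -> forall c, 0 < c -> forall e, 0 < e ->
  exists2 r0, 0 < r0 & forall r, 0 < r <= r0 -> `|smooth (c * r) / smooth r - c ^+ d| < e.
Proof.
move=> Tflat c c0 e e0; apply: contrapT => H.
have /choice[r rP] : forall k : nat, exists r, 0 < r <= k.+1%:R^-1 /\
    e <= `|smooth (c * r) / smooth r - c ^+ d|.
  move=> k; apply: contrapT => Hk; apply: H; exists k.+1%:R^-1; first by rewrite invr_gt0 ltr0n.
  by move=> r rk; rewrite ltNge; apply/negP => er; apply: Hk; exists r.
have r0 k : 0 < r k by have [/andP[]] := rP k.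
have rto0 : r @ \oo --> 0.
  apply/cvgrPdist_lt => t t0.
  have [N _ HN] := near_infty_natSinv_lt (PosNum t0).
  exists N => // k /= Nk; rewrite sub0r normrN gtr0_norm//.
  by have [/andP[_ rk] _] := rP k; apply: (le_lt_trans rk); exact: (HN k).
have [h hi [s [/Tflat sflat Hs]]] := tangent_subsequence r0 rto0.
have [I1 I10 [I1E I1c]] := Hs 1 ltr01; have [I2 I20 [I2E I2c]] := Hs c c0.
have I12 : I2 = c ^+ d * I1.
  apply/EFin_inj; rewrite EFinM -I1E -I2E invr1.
  under [in RHS]eq_integral do rewrite scale1r.
  apply: (flat_integral_scale (f := cutoff b) sflat c0).
    by apply: ccp_Borel; exact: cutoff_ccp.
  by move=> z; exact: cutoff_ge0.
have : smooth (c * r (h k)) / smooth (r (h k)) @[k --> \oo] --> c ^+ d.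
  have -> : c ^+ d = I2 / I1 by rewrite I12 mulfK// gt_eqF.
  rewrite (_ : (fun k => _) = (fun k => smooth (c * r (h k)) / mass (r (h k)) /
     (smooth (1 * r (h k)) / mass (r (h k))))); last first.
    apply/funext => k; rewrite mul1r.
    have m0 := mass_gt0 mud xS (r0 (h k)); have s0 := smooth_gt0 mud xS b01 (r0 (h k)).
    by field; rewrite !gt_eqF.
  by apply: cvgM => //; apply: cvgV => //; rewrite gt_eqF.
move=> /cvgrPdist_lt/(_ _ e0)[N _ /(_ N)] /= /(_ (leqnn N)).
by rewrite distrC ltNge; have [_ ->] := rP (h N).
Qed.

End Tangents.

(** * The logarithmic condition on alpha numbers *)

Section LowerIntegral.
Context d (T : measurableType d) (R : realType) (nu : {measure set T -> \bar R}).

(* No measurability is required of [f]: the integral of a nonnegative function is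
   a supremum over simple functions, hence a lower integral. *)
Lemma ge0_le_lower_integral (D : set T) (g f : T -> \bar R) :
  (forall z, 0 <= g z)%E -> (forall z, D z -> 0 <= f z)%E ->
  (forall z, g z <= (f \_ D) z)%E ->
  (\int[nu]_z g z <= \int[nu]_(z in D) f z)%E.
Proof.
move=> g0 f0 gf; rewrite ge0_integralTE// ge0_integralE//.
apply: ge_ereal_sup => _ [h hg <-]; apply: ereal_sup_ubound; exists h => // z.
exact: le_trans (hg z) (gf z).
Qed.

End LowerIntegral.

Section SquareLogCondition.
Context (R : realType) (n : nat).
Local Notation Rn := 'rV[R]_n.
Variables (l1 l2 : R) (mu : {measure set Rn -> \bar R}) (x : Rn) (b : R).
Hypothesis b01 : 0 < b < 1.

Lemma W1_ge0 (nu nu' : set Rn -> \bar R) : (0 <= W1 nu nu')%E.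
Proof.
apply: le_trans (abse_ge0 _) _; last first.
  apply: ereal_sup_ubound; exists (fun=> 0) => //; split=> // y z.
  by rewrite subrr normr0 enorm_ge0.
Qed.

Lemma alphaG_ge0 r : (0 <= alphaG l1 l2 mu x r)%E.
Proof. by apply: le_ereal_inf_tmp => _ [G _ <-]; exact: W1_ge0. Qed.

Let b0 : 0 < b. Proof. by case/andP: b01. Qed.
Let b1 : b < 1. Proof. by case/andP: b01. Qed.

(** Truncation at 1 makes this a real number and loses nothing: an error of at least 1 is trivial
    for quotients lying in [0, 1]. *)
Definition alpha_inf (k : nat) : R :=
  fine (Order.min 1%E (ereal_inf [set alphaG l1 l2 mu x t | t in [set t | b ^+ k.+1 <= t <= b ^+ k]])).

Let alpha_infE k : (alpha_inf k)%:E =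
  Order.min 1%E (ereal_inf [set alphaG l1 l2 mu x t | t in [set t | b ^+ k.+1 <= t <= b ^+ k]]).
Proof.
have h0 : (0 <= ereal_inf [set alphaG l1 l2 mu x t | t in [set t | (b ^+ k.+1 <= t <= b ^+ k)%R]])%E.
  by apply: le_ereal_inf_tmp => _ [t _ <-]; exact: alphaG_ge0.
rewrite /alpha_inf fineK// ge0_fin_numE ?le_min ?h0 ?lee01//.
by rewrite gt_min ltry.
Qed.

Lemma alpha_inf_ge0 k : 0 <= alpha_inf k.
Proof.
rewrite -lee_fin alpha_infE le_min lee01/=.
by apply: le_ereal_inf_tmp => _ [t _ <-]; exact: alphaG_ge0.
Qed.

Lemma alpha_inf_le1 k : alpha_inf k <= 1.
Proof. by rewrite -lee_fin alpha_infE ge_min lexx. Qed.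

Lemma alpha_inf_le k t : b ^+ k.+1 <= t <= b ^+ k ->
  ((alpha_inf k)%:E <= alphaG l1 l2 mu x t)%E.
Proof.
move=> kt; rewrite alpha_infE ge_min; apply/orP; right.
by apply: ereal_inf_lbound; exists t.
Qed.

Lemma alpha_inf_adherent k e : alpha_inf k < e -> 1 <= e \/
  exists2 t, b ^+ k.+1 <= t <= b ^+ k & (alphaG l1 l2 mu x t < e%:E)%E.
Proof.
move=> ke; have [|e1] := leP 1 e; [by left|right].
move: ke; rewrite -lte_fin alpha_infE gt_min lte_fin [1 < e]ltNge (ltW e1)/=.
by move=> /ereal_inf_lt[_ [t kt <-] te]; exists t.
Qed.

(* The step function equal to [k alpha_inf k / b^k], up to a constant, on
   [b^(k+1), b^k] is a measurable minorant of the integrand. *)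
Lemma Sigma2_sum : Sigma2 l1 l2 mu x -> exists W : R, forall N : nat,
  \sum_(0 <= k < N) k%:R * alpha_inf k <= W.
Proof.
move=> [_ Sfin].
have lb0 : 0 < ln b^-1 by rewrite ln_gt0// invf_gt1.
(* On [I k] both ln(1/r) >= k ln(1/b) and 1/r >= b^-k hold, and the length b^k (1 - b) of [I k]
   cancels b^-k. Open intervals keep the [I k] disjoint. *)
pose c k := k%:R * alpha_inf k * ln b^-1 / b ^+ k.
pose I (k : nat) : set R := `]b ^+ k.+1, b ^+ k[%classic.
have c0 k : 0 <= c k.
  by rewrite /c !mulr_ge0 ?alpha_inf_ge0 ?invr_ge0 ?exprn_ge0 ?(ltW b0) ?(ltW lb0).
have bk i : 0 < b ^+ i by rewrite exprn_gt0.
set J := (\int[lebesgue_measure]_(r in _) _)%E in Sfin.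
have J0 : (0 <= J)%E.
  apply: integral_ge0 => r; rewrite /= in_itv /= => /andP[r0 r1].
  by rewrite mule_ge0 ?alphaG_ge0// lee_fin divr_ge0 ?(ltW r0)// ln_ge0// invf_ge1// ltW.
have JE : J = (fine J)%:E by rewrite fineK// ge0_fin_numE.
have K0 : 0 < ln b^-1 * (1 - b) by rewrite mulr_gt0// subr_gt0.
exists (fine J / (ln b^-1 * (1 - b))) => N.
rewrite ler_pdivlMr// -lee_fin -JE.
pose g (r : R) : \bar R := (\sum_(0 <= k < N) (c k)%:E * (\1_(I k) r)%:E)%E.
have mI k : measurable (I k) by exact: measurable_itv.
have -> : ((\sum_(0 <= k < N) k%:R * alpha_inf k) * (ln b^-1 * (1 - b)))%:E =
    (\int[lebesgue_measure]_r g r)%E.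
  rewrite /g ge0_integral_sum//; last 2 first.
  - by move=> k; apply: measurable_funeM; apply/measurable_EFinP; apply: measurable_indic; exact: mI.
  - by move=> k r _; rewrite mule_ge0 ?lee_fin.
  rewrite mulr_suml -sumEFin; apply: eq_bigr => k _.
  rewrite ge0_integralZl//; last 2 first.
  - by apply/measurable_EFinP; apply: measurable_indic; exact: mI.
  - by rewrite lee_fin.
  rewrite (@integral_indic _ _ R lebesgue_measure setT measurableT (I k) (mI k)).
  rewrite (_ : I k `&` _ = I k); last by apply/seteqP; split=> [z []|z].
  transitivity ((c k)%:E * (b ^+ k - b ^+ k.+1)%:E)%E; last first.
    congr (_ * _)%E; apply/esym; apply: etrans (lebesgue_measure_itv `]b ^+ k.+1, b ^+ k[) _.
    by rewrite /= lte_fin exprS gtr_pMl// b1 -EFinB.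
  rewrite -EFinM exprS; congr EFin.
  by rewrite /c; field; rewrite gt_eqF.
apply: ge0_le_lower_integral.
- by move=> r; apply: sume_ge0 => k _; rewrite mule_ge0// lee_fin.
- move=> r; rewrite /= in_itv /= => /andP[r0 r1].
  by rewrite mule_ge0 ?alphaG_ge0// lee_fin divr_ge0 ?(ltW r0)// ln_ge0// invf_ge1// ltW.
move=> r.
have [[k Ikr]|noI] := pselect (exists k, I k r); last first.
  rewrite /g big1; last first.
    move=> k _; rewrite indicE memNset ?mule0// => Ikr; apply: noI; by exists k.
  rewrite patchE; case: ifPn => // /set_mem; rewrite /= in_itv /= => /andP[r0 r1].
  by rewrite mule_ge0 ?alphaG_ge0// lee_fin divr_ge0 ?(ltW r0)// ln_ge0// invf_ge1// ltW.
have /andP[kr rk] : b ^+ k.+1 < r < b ^+ k by move: Ikr; rewrite /I /= in_itv.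
have r0 : 0 < r by apply: lt_trans kr.
have r1 : r < 1 by rewrite (lt_le_trans rk)// exprn_ile1// ltW.
have gle : (g r <= (c k)%:E)%E.
  have disj i : i != k -> (\1_(I i) r : R) = 0.
    move=> ik; rewrite indicE memNset// /I /= in_itv /= => /andP[ir ri].
    have := lt_trans kr ri; have := lt_trans ir rk.
    rewrite !ltr_iXn2l// !ltnS.
    by move=> h1 h2; move/eqP: ik; apply; apply/eqP; rewrite eqn_leq h1 h2.
  have [kN|Nk] := ltnP k N.
    rewrite /g (bigD1_seq k) ?mem_index_iota ?iota_uniq//= big1; last first.
      by move=> i ik; rewrite disj// mule0.
    by rewrite adde0 indicE mem_set// mule1.
  rewrite /g big_nat big1 ?lee_fin// => i /andP[_ iN].
  by rewrite disj ?mule0// ltn_eqF// (leq_trans iN).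
apply: (le_trans gle).
rewrite patchE mem_set; last by rewrite /= in_itv /= r0.
have ln1 : k%:R * ln b^-1 <= ln r^-1.
  rewrite mulr_natl -lnXn ?invr_gt0// ler_ln ?posrE ?exprn_gt0 ?invr_gt0//.
  by rewrite exprVn lef_pV2 ?posrE// ltW.
apply: (@le_trans _ _ ((alpha_inf k)%:E * (ln r^-1 / r)%:E)%E); last first.
  rewrite lee_wpmul2r ?alpha_inf_le ?(ltW kr) ?(ltW rk)// lee_fin.
  by rewrite divr_ge0 ?(ltW r0)// ln_ge0// invf_ge1// ltW.
rewrite -EFinM lee_fin /c [X in X <= _](_ : _ = alpha_inf k * (k%:R * ln b^-1 / b ^+ k)); last by ring.
rewrite ler_wpM2l ?alpha_inf_ge0//; apply: ler_pM => //.
- by rewrite mulr_ge0// ltW.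
- by rewrite invr_ge0 ltW.
- by rewrite lef_pV2 ?posrE// ltW.
Qed.

Lemma Sigma2_series : Sigma2 l1 l2 mu x -> exists e : nat -> R,
  [/\ forall k, 0 < e k,
      exists W : R, forall N : nat, \sum_(0 <= k < N) k.+1%:R * e k <= W &
      forall k, 1 <= e k \/
       exists2 t, b ^+ k.+1 <= t <= b ^+ k & (alphaG l1 l2 mu x t < (e k)%:E)%E].
Proof.
move=> /Sigma2_sum[W HW].
(* The positive increments of f put [e k] strictly above the infimum, so that some scale lies below
   [e k]; weighted by k + 1 these corrections telescope to at most 1. *)
pose f (k : nat) : R := - k.+1%:R^-1.
pose e k := alpha_inf k + (f k.+1 - f k) / k.+1%:R.
have fk k : 0 < f k.+1 - f k.
  by rewrite /f opprK addrC subr_gt0 ltf_pV2 ?posrE ?ltr0n// ltr_nat.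
have ek k : alpha_inf k < e k by rewrite ltrDl divr_gt0// ltr0n.
exists e; split=> [k||k].
- exact: le_lt_trans (alpha_inf_ge0 k) (ek k).
- exists (2 * W + 2) => N.
  have -> : \sum_(0 <= k < N) k.+1%:R * e k =
      \sum_(0 <= k < N) k.+1%:R * alpha_inf k + (f N - f 0%N).
    rewrite -(telescope_sumr f)// -big_split; apply: eq_bigr => k _ /=.
    by rewrite /e mulrDr mulrCA mulfV ?mulr1// pnatr_eq0.
  (* For k >= 1 one has k + 1 <= 2 k, and the term k = 0 is at most 1 by the truncation. *)
  have h1 : \sum_(0 <= k < N) k.+1%:R * alpha_inf k <=
      2 * (\sum_(0 <= k < N) k%:R * alpha_inf k) + 1.
    apply: (@le_trans _ _ (2 * (\sum_(0 <= k < N) k%:R * alpha_inf k) + ((0 < N)%N : nat)%:R)).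
      elim: N => [|N IH]; first by rewrite !big_geq// mulr0 addr0.
      rewrite !big_nat_recr//= (le_trans (lerD IH (lexx _)))//.
      have := alpha_inf_ge0 N; have := alpha_inf_le1 N.
      case: N {IH} => [|N]; first by rewrite /= !big_geq//; lra.
      move=> a1 a0; have : 0 <= N%:R * alpha_inf N.+1 by rewrite mulr_ge0.
      by rewrite /= -!(natr1 N.+1) -(natr1 N); lra.
    by rewrite lerD2l; case: (0 < N)%N.
  have h2 : f N - f 0%N <= 1.
    by rewrite /f invr1 opprK gerDr oppr_le0 invr_ge0.
  have := HW N; lra.
- exact: alpha_inf_adherent.
Qed.

End SquareLogCondition.

(** * Chaining scales *)

Section Chaining.
Context (R : realType).

Lemma geometric_lt (b e : R) : 0 < b < 1 -> 0 < e -> exists N, forall k, (N <= k)%N -> b ^+ k < e.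
Proof.
move=> /andP[b0 b1] e0.
have : b ^+ k @[k --> \oo] --> 0 by apply: cvg_expr; rewrite ger0_norm ?ltW.
move=> /cvgrPdist_lt/(_ _ e0)[N _ HN]; exists N => k Nk.
by have := HN k Nk; rewrite /= sub0r normrN ger0_norm// exprn_ge0// ltW.
Qed.

Lemma geometric_bracket (b r : R) : 0 < b < 1 -> 0 < r <= 1 ->
  exists j, b ^+ j.+1 < r <= b ^+ j.
Proof.
move=> b01 /andP[r0 r1].
have ex : exists j, b ^+ j.+1 < r.
  by have [N HN] := geometric_lt b01 r0; exists N; exact: HN.
case: (ex_minnP ex) => j jr jmin; exists j; rewrite jr/=.
case: j jr jmin => [//|j] jr jmin; rewrite leNgt; apply/negP => /jmin.
by rewrite ltnn.
Qed.

Lemma geometric_le (b : R) i j : 0 < b < 1 -> (i <= j)%N -> b ^+ j <= b ^+ i.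
Proof. by move=> /andP[b0 b1] ij; rewrite ler_wiXn2l// ltW. Qed.

(* Following the chain r -> r' downwards, each b-adic interval is visited at
   most N times, where l^N >= 1/b. *)
Lemma chain_bound (u : R -> R) (e : nat -> R) (b l : R) : 0 < b < 1 -> 1 < l ->
  (forall k, 0 <= e k) ->
  (forall k r, b ^+ k.+2 <= r <= b ^+ k.+1 ->
    exists2 r', 0 < r' <= r / l & u r <= u r' + e k) ->
  (forall eps, 0 < eps -> exists K, forall r, 0 < r <= b ^+ K.+1 -> u r <= eps) ->
  exists N : nat, forall eps, 0 < eps -> exists K0, forall K, (K0 <= K)%N ->
    forall k, (k <= K)%N -> forall r, 0 < r <= b ^+ k.+1 ->
    u r <= N%:R * \sum_(k <= i < K) e i + eps.
Proof.
move=> b01 l1 e0 step lim; have /andP[b0 b1] := b01.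
have l0 : 0 < l by apply: lt_trans l1.
have li : 0 < l^-1 < 1 by rewrite invr_gt0 l0 invf_lt1.
have [N0 HN0] := geometric_lt li b0; pose N := N0.
have lN : 1 <= l ^+ N * b.
  by have := HN0 N (leqnn _); rewrite exprVn -ler_pdivrMl ?exprn_gt0// mulr1 => /ltW.
exists N => eps eps0; have [K0 HK0] := lim _ eps0; exists K0 => K K0K k kK.
(* Descending induction on k becomes induction on m = K - k; for m >= K the truncated difference
   stays at 0 and nothing changes. *)
have [m ->] : exists m, k = (K - m)%N by exists (K - k)%N; rewrite subKn.
have s0 j : 0 <= \sum_(j <= i < K) e i by apply: sumr_ge0.
elim: m => [|m IH] r /andP[r0 rb].
  rewrite subn0 big_geq// mulr0 add0r; apply: HK0; rewrite r0/=.
  by move: rb; rewrite subn0 => /le_trans; apply; apply: geometric_le.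
have [Km|mK] := leqP K m.
  have E : (K - m.+1 = K - m)%N by move: Km; clear; lia.
  by rewrite E in rb *; apply: IH; rewrite r0.
set j := (K - m.+1)%N in rb *.
have jE : (K - m)%N = j.+1 by rewrite /j; move: mK; clear; lia.
have jK : (j < K)%N by rewrite /j; move: mK; clear; lia.
rewrite jE in IH; rewrite big_ltn// mulrDr -addrA.
(* Here i bounds the number of steps before the chain falls below b^(j+2), since each step divides
   the radius by l. *)
have claim i : forall r, 0 < r <= b ^+ j.+1 -> r <= l ^+ i * b ^+ j.+2 ->
    u r <= i%:R * e j + (N%:R * \sum_(j.+1 <= k0 < K) e k0 + eps).
  elim: i => [|i IHi] r'.
    by rewrite expr0 mul1r mul0r add0r => /andP[r'0 _] r'b; apply: IH; rewrite r'0.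
  move=> /andP[r'0 r'b] r'l.
  have [small|big] := leP r' (b ^+ j.+2).
    by apply: (le_trans (IH r' _)); rewrite ?r'0// lerDr mulr_ge0.
  have [|r'' /andP[r''0 r''l] hu] := step j r'; first by rewrite (ltW big).
  have r''r : r'' <= r'.
    by rewrite (le_trans r''l)// ler_pdivrMr// ler_peMr// ltW.
  apply: (le_trans hu); rewrite -natr1 mulrDl mul1r addrAC lerD2r.
  apply: IHi; first by rewrite r''0 (le_trans r''r).
  rewrite (le_trans r''l)// ler_pdivrMr// (le_trans r'l)//.
  by rewrite exprSr mulrAC.
apply: (claim N); first by rewrite r0.
apply: (le_trans rb); rewrite [b ^+ j.+2]exprS mulrA ler_peMl// exprn_ge0// ?(ltW b0)//.
Qed.

(** After exchanging the sums, [e i] occurs at most i + 1 times. This is where the logarithmic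
    weight is spent. *)
Lemma sum_tails_le (e : nat -> R) (J K : nat) : (forall k, 0 <= e k) ->
  \sum_(0 <= j < J) \sum_(j <= i < K) e i <= \sum_(0 <= i < K) i.+1%:R * e i.
Proof.
move=> e0.
rewrite (eq_bigr (fun j => \sum_(0 <= i < K) if (j <= i)%N then e i else 0)); last first.
  by move=> j _; rewrite (big_nat_widenl _ 0)// big_mkcond.
rewrite exchange_big /=; apply: ler_sum => i _.
apply: (@le_trans _ _ ((minn J i.+1)%:R * e i)); last first.
  by rewrite ler_wpM2r// ler_nat geq_minr.
elim: J => [|J IH]; first by rewrite big_geq// min0n mul0r.
rewrite big_nat_recr//=; case: (leqP J i) => Ji.
  rewrite (le_trans (lerD IH (lexx _)))// (minn_idPl (ltnW _))// (minn_idPl _)//.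
  by rewrite -natr1 mulrDl mul1r.
by rewrite addr0 (le_trans IH)// ler_wpM2r// ler_nat; lia.
Qed.

Lemma cvgn_bounded_variation (h : nat -> R) (W : R) :
  (forall N, \sum_(0 <= j < N) `|h j.+1 - h j| <= W) -> cvgn h.
Proof.
move=> HW; pose v j := h j.+1 - h j.
have nc : cvgn [normed series v].
  apply: nondecreasing_is_cvgn.
    apply/nondecreasing_seqP => N /=; rewrite /series /=.
    by rewrite big_nat_recr//= lerDl.
  by exists W => _ [N _ <-]; exact: HW.
have /cvg_ex[l hl] := normed_cvg nc.
pose a := h 0%N; apply/cvg_ex; exists (a + l).
rewrite (_ : h = (fun N => a + series v N)); last first.
  apply/funext => N; rewrite /series /= /v (telescope_sumr h)//.
  by rewrite addrC subrK.
by have := cvgD (cvg_cst a) hl; exact.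
Qed.

Lemma unit_interval_dist (s t : R) : 0 <= s <= 1 -> 0 <= t <= 1 -> `|s - t| <= 1.
Proof.
by rewrite ler_norml => /andP[? ?] /andP[? ?]; apply/andP; split; lra.
Qed.

Lemma ln_div_common (u v w : R) : 0 < u -> 0 < v -> 0 < w ->
  ln (u / v) = ln (u / w) - ln (v / w).
Proof.
move=> u0 v0 w0; rewrite -ln_div ?posrE ?divr_gt0//; congr ln.
by field; rewrite !gt_eqF.
Qed.

Lemma dist_sub_le (A B C D l c : R) :
  `|A - B| <= c -> `|C - D| <= c -> `|C - A - l| <= `|D - B - l| + (c + c).
Proof.
move=> L1 L2.
have -> : C - A - l = (D - B - l) + ((C - D) - (A - B)) by ring.
rewrite (le_trans (ler_normD _ _))// lerD2l (le_trans (ler_normB _ _))//.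
exact: lerD.
Qed.

Lemma ln_lipschitz (k s t : R) : 0 < k -> k <= s -> k <= t ->
  `|ln s - ln t| <= `|s - t| / k.
Proof.
move=> k0; wlog st : s t / s <= t.
  by move=> H ks kt; have [/H|/ltW/H] := leP s t; [|rewrite distrC [`|s - t|]distrC]; exact.
move=> ks kt; have s0 : 0 < s by apply: lt_le_trans ks.
have t0 : 0 < t by apply: lt_le_trans kt.
rewrite distrC [`|s - t|]distrC ger0_norm ?subr_ge0 ?ler_ln ?posrE//.
rewrite ger0_norm ?subr_ge0// -ln_div ?posrE//.
have -> : t / s = 1 + (t - s) / s by field; rewrite gt_eqF.
apply: (@le_trans _ _ ((t - s) / s)).
  by apply: le_ln1Dx; rewrite (lt_le_trans (ltrN10 _))// divr_ge0 ?subr_ge0// ltW.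
by rewrite ler_wpM2l ?subr_ge0// lef_pV2.
Qed.

End Chaining.

(** * The density along the scales b^j *)

Section DensityAlongGeometricSequence.
Context (R : realType) (n : nat).
Local Notation Rn := 'rV[R]_n.
Variables (l1 l2 : R) (mu : {measure set Rn -> \bar R}) (x : Rn) (b : R) (d : nat).
Hypotheses (hl1 : 1 < l1) (hl12 : l1 < l2) (mud : doubling mu) (b01 : 0 < b < 1).
Hypothesis xS : Sdd l1 l2 mu d x.
Local Notation mass := (mass mu x).
Local Notation smooth := (smooth mu x b).

Let xsupp : msupport mu x. Proof. by case: xS => -[]. Qed.
Let b0 : 0 < b. Proof. by case/andP: b01. Qed.
Let b1 : b < 1. Proof. by case/andP: b01. Qed.
Let cb : 0 < 1 - b. Proof. by rewrite subr_gt0. Qed.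
Let m0 (r : R) : 0 < r -> 0 < mass r. Proof. exact: mass_gt0. Qed.
Let s0 (r : R) : 0 < r -> 0 < smooth r. Proof. exact: smooth_gt0. Qed.

(** If e k >= 1 any admissible scales will do, both quotients lying in [0, 1] and rho (1 - b) being
    at most 1. Otherwise a nearly optimal similarity of ratio lam at scale t gives s = 1/lam. *)
Lemma scale_comparison : exists e : nat -> R,
  [/\ forall k, 0 < e k,
      exists W : R, forall N : nat, \sum_(0 <= k < N) k.+1%:R * e k <= W &
      forall k, exists t s, [/\ b ^+ k.+1 <= t <= b ^+ k, l1 * t <= s <= l2 * t &
        forall rho, 0 < rho <= 1 ->
        `|smooth (rho * s) / mass s - smooth (rho * t) / mass t| <= e k / (rho * (1 - b))]].
Proof.
have [_ S2 _] := xS.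
have [e [e0 eW eP]] := Sigma2_series b01 S2.
exists e; split=> // k; have [ek1|[t tk]] := eP k.
  have bk : 0 < b ^+ k by rewrite exprn_gt0.
  have l10 : 0 < l1 by exact: lt_trans hl1.
  exists (b ^+ k), (l1 * b ^+ k); split.
  - by rewrite geometric_le/=.
  - by rewrite lexx/= ler_wpM2r ?(ltW bk)// ltW.
  move=> rho /andP[rho0 rho1].
  have bnd r : 0 < r -> 0 <= smooth (rho * r) / mass r <= 1.
    move=> r0; rewrite divr_ge0 ?mass_ge0 ?(ltW (s0 _)) ?mulr_gt0//=.
    rewrite ler_pdivrMr ?m0// mul1r.
    rewrite (le_trans (smooth_le_mass mud xsupp b01 (mulr_gt0 rho0 r0)))//.
    by apply: (le_mass mud xsupp); rewrite ler_piMl// ltW.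
  apply: (@le_trans _ _ 1).
    have := bnd _ bk; have := bnd _ (mulr_gt0 l10 bk).
    exact: unit_interval_dist.
  rewrite ler_pdivlMr ?mulr_gt0// mul1r (le_trans _ ek1)//.
  by rewrite mulr_ile1// ?(ltW rho0) ?(ltW cb)// gerBl ltW.
move=> /ereal_inf_lt[_ [G [lam [sG Gx /andP[lam1 lam2]]] <-] We].
have t0 : 0 < t by case/andP: tk => + _; apply: lt_le_trans; rewrite exprn_gt0.
exists t, lam^-1; split=> //; first by rewrite lam1.
by move=> rho rho01; exact: (W1_smooth_ratio mud xsupp b01 t0 sG Gx (ltW We) rho01).
Qed.

(** At r = b^j this is the absolute increment, from j to j + 1, of the logarithm of
    [smooth (b ^+ j) / (b ^+ d) ^+ j]. *)
Definition log_ratio r : R := `|ln (smooth (b * r) / smooth r) - ln (b ^+ d)|.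

Lemma log_ratio_lim eps : 0 < eps ->
  exists K, forall r, 0 < r <= b ^+ K.+1 -> log_ratio r <= eps.
Proof.
move=> eps0; have [_ _ Tflat] := xS.
have bd : 0 < b ^+ d by rewrite exprn_gt0.
(* The first bound keeps the quotient above b^d / 2, where ln has Lipschitz constant 2 / b^d; the
   second then yields eps. *)
pose e' := Num.min (b ^+ d / 2) (eps * (b ^+ d / 2)).
have e'0 : 0 < e' by rewrite lt_min !mulr_gt0 ?invr_gt0.
have [r0 r00 Hr] := smooth_ratio_cvg mud xsupp b01 Tflat b0 e'0.
have [K HK] := geometric_lt b01 r00.
exists K => r /andP[r_gt0 rK].
have rr0 : 0 < r <= r0 by rewrite r_gt0 (le_trans rK)// ltW// HK.
have h := Hr _ rr0.
have h1 : `|smooth (b * r) / smooth r - b ^+ d| < b ^+ d / 2.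
  by rewrite (lt_le_trans h)// ge_min lexx.
have h2 : `|smooth (b * r) / smooth r - b ^+ d| < eps * (b ^+ d / 2).
  by rewrite (lt_le_trans h)// ge_min lexx orbT.
apply: (@le_trans _ _ (`|smooth (b * r) / smooth r - b ^+ d| / (b ^+ d / 2))).
  apply: ln_lipschitz; first by rewrite divr_gt0.
    by move: h1; rewrite ltr_norml => /andP[+ _]; lra.
  by lra.
by rewrite ler_pdivrMr ?divr_gt0// ltW.
Qed.

Lemma log_ratio_step : exists e : nat -> R,
  [/\ forall k, 0 <= e k,
      exists W : R, forall N : nat, \sum_(0 <= k < N) k.+1%:R * e k <= W &
      forall k r, b ^+ k.+2 <= r <= b ^+ k.+1 ->
        exists2 r', 0 < r' <= r / l1 & log_ratio r <= log_ratio r' + e k].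
Proof.
have [e [e0 [W eW] eP]] := scale_comparison.
have l10 : 0 < l1 by exact: lt_trans hl1.
have l20 : 0 < l2 by exact: lt_trans hl12.
(* A lower bound for rho = r/s, as r >= b^(k+2) and s <= l2 b^k. The further factor b^2 in [c0] pays
   for rho being replaced by b rho and for passing from [smooth] to [mass]. *)
pose rho0 := b ^+ 2 / l2.
have rho00 : 0 < rho0 by rewrite divr_gt0// exprn_gt0.
have c0 : 0 < b ^+ 2 * rho0 by rewrite mulr_gt0// exprn_gt0.
have [k0 k00 Hk0] := mass_lower_bound mud xsupp c0.
(* Two profiles are compared, at rho and at b rho. Each costs at most e k / (b rho0 (1 - b)), and ln
   multiplies this by at most 1/k0 above k0. *)
pose C := 2 / (b * rho0 * (1 - b)) / k0.
have C0 : 0 < C by do 2 apply: divr_gt0 => //; do 2 apply: mulr_gt0 => //.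
exists (fun k => C * e k); split.
- by move=> k; rewrite mulr_ge0 ?(ltW C0) ?(ltW (e0 k)).
- exists (C * W) => N; under eq_bigr do rewrite mulrCA.
  by rewrite -mulr_sumr ler_wpM2l ?(ltW C0).
move=> k r /andP[r1 r2].
have [t [s [/andP[t1 t2] /andP[s1 s2] H]]] := eP k.
have bk : 0 < b ^+ k by rewrite exprn_gt0.
have bk1 : 0 < b ^+ k.+1 by rewrite exprn_gt0.
have bk2 : 0 < b ^+ k.+2 by rewrite exprn_gt0.
have t0 : 0 < t by apply: lt_le_trans t1.
have ss0 : 0 < s by apply: lt_le_trans s1; rewrite mulr_gt0.
have r0 : 0 < r by apply: lt_le_trans r1.
(* The radius r is read as rho s, and rho t is the next radius, at most r / l1 because l1 t <= s.
   Taking r <= b^(k+1) <= t <= s ensures rho <= 1. *)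
pose rho := r / s.
have rE : r = rho * s by rewrite /rho mulfVK// gt_eqF.
have rho_gt0 : 0 < rho by rewrite divr_gt0.
have ts : t <= s by rewrite (le_trans _ s1)// ler_peMl ?(ltW t0)// ltW.
have rho1 : rho <= 1 by rewrite ler_pdivrMr// mul1r (le_trans r2)// (le_trans t1).
have rho0_le : rho0 <= rho.
  rewrite /rho0 /rho ler_pdivrMr// mulrAC ler_pdivlMr//.
  apply: (@le_trans _ _ (b ^+ 2 * (l2 * t))); first by rewrite ler_wpM2l// exprn_ge0// ltW.
  rewrite mulrCA mulrC ler_wpM2r ?(ltW l20)//.
  have bkk : b ^+ k.+2 = b ^+ 2 * b ^+ k by rewrite -exprD.
  by rewrite (le_trans _ r1)// bkk ler_wpM2l ?exprn_ge0 ?(ltW b0).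
exists (rho * t).
  rewrite mulr_gt0//= ler_pdivlMr// rE -mulrA ler_wpM2l ?(ltW rho_gt0)//.
  by rewrite mulrC.
have lower a q : 0 < a -> b * rho0 <= q -> k0 <= smooth (q * a) / mass a.
  move=> a0 qb; have q0 : 0 < q by apply: lt_le_trans qb; rewrite mulr_gt0.
  rewrite ler_pdivlMr ?m0// (le_trans (Hk0 _ a0))//.
  rewrite (le_trans _ (mass_le_smooth mud xsupp b01 (mulr_gt0 q0 a0)))//.
  apply: (le_mass mud xsupp); rewrite [leRHS]mulrA ler_wpM2r ?(ltW a0)// expr2 -mulrA.
  by rewrite ler_wpM2l ?(ltW b0).
have brho1 : b * rho <= 1 by rewrite mulr_ile1// ltW.
have brho_gt0 : 0 < b * rho by rewrite mulr_gt0.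
have bb : b * rho0 <= b * rho by rewrite ler_wpM2l ?(ltW b0).
have b_1 : b * rho0 <= rho.
  by rewrite (le_trans bb)// ler_piMl ?(ltW rho_gt0) ?(ltW b1).
have p1 : 0 < b * rho0 * (1 - b) by rewrite mulr_gt0 ?subr_gt0// mulr_gt0.
have p2 : 0 < rho * (1 - b) by rewrite mulr_gt0 ?subr_gt0.
have p3 : 0 < b * rho * (1 - b) by rewrite mulr_gt0 ?subr_gt0.
have bge : 0 <= 1 - b by rewrite subr_ge0 ltW.
have L1 : `|ln (smooth (rho * s) / mass s) - ln (smooth (rho * t) / mass t)| <=
    e k / (b * rho0 * (1 - b)) / k0.
  apply: (le_trans (ln_lipschitz k00 (lower _ _ ss0 b_1) (lower _ _ t0 b_1))).
  rewrite ler_wpM2r ?invr_ge0 ?(ltW k00)//.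
  rewrite (le_trans (H rho _)) ?rho_gt0// ler_wpM2l ?(ltW (e0 k))//.
  by rewrite lef_pV2 ?posrE// ler_wpM2r.
have L2 : `|ln (smooth (b * rho * s) / mass s) - ln (smooth (b * rho * t) / mass t)| <=
    e k / (b * rho0 * (1 - b)) / k0.
  apply: (le_trans (ln_lipschitz k00 (lower _ _ ss0 bb) (lower _ _ t0 bb))).
  rewrite ler_wpM2r ?invr_ge0 ?(ltW k00)//.
  rewrite (le_trans (H (b * rho) _)) ?brho_gt0// ler_wpM2l ?(ltW (e0 k))//.
  by rewrite lef_pV2 ?posrE// ler_wpM2r.
have -> : C * e k = e k / (b * rho0 * (1 - b)) / k0 + e k / (b * rho0 * (1 - b)) / k0.
  by rewrite /C; ring.
have dec a : 0 < a -> ln (smooth (b * (rho * a)) / smooth (rho * a)) =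
    ln (smooth (b * rho * a) / mass a) - ln (smooth (rho * a) / mass a).
  move=> a0; rewrite mulrA.
  exact: (ln_div_common (s0 (mulr_gt0 brho_gt0 a0)) (s0 (mulr_gt0 rho_gt0 a0)) (m0 a0)).
have -> : log_ratio r = `|ln (smooth (b * rho * s) / mass s) -
    ln (smooth (rho * s) / mass s) - ln (b ^+ d)| by rewrite -(dec _ ss0) -rE.
have -> : log_ratio (rho * t) = `|ln (smooth (b * rho * t) / mass t) -
    ln (smooth (rho * t) / mass t) - ln (b ^+ d)| by rewrite -(dec _ t0).
exact: (dist_sub_le _ L1 L2).
Qed.

Lemma smooth_density_cvg : exists2 L : R, 0 < L &
  smooth (b ^+ j) / (b ^+ d) ^+ j @[j --> \oo] --> L.
Proof.
have [e [e0 [W eW] step]] := log_ratio_step.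
have [N HN] := chain_bound b01 hl1 e0 step log_ratio_lim.
have bj j : 0 < b ^+ j by rewrite exprn_gt0.
have bd : 0 < b ^+ d by rewrite exprn_gt0.
pose g j := smooth (b ^+ j.+1) / (b ^+ d) ^+ j.+1.
have g0 j : 0 < g j by rewrite divr_gt0 ?s0// exprn_gt0.
have var j : `|ln (g j.+1) - ln (g j)| = log_ratio (b ^+ j.+1).
  rewrite /log_ratio /g -!ln_div ?posrE ?divr_gt0 ?s0 ?exprn_gt0 ?mulr_gt0//.
  congr (`|ln _|); rewrite -exprS [(b ^+ d) ^+ j.+2]exprS.
  by field; rewrite !gt_eqF ?s0 ?exprn_gt0.
have /cvg_ex[l hl] : cvgn (fun j => ln (g j)).
  apply: (@cvgn_bounded_variation _ _ (N%:R * W + 1)) => J.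
  under eq_bigr do rewrite var.
  have J0 : 0 < J.+1%:R^-1 :> R by rewrite invr_gt0 ltr0n.
  (* With eps = 1/(J + 1) the J error terms add up to at most 1, so the variation bound is uniform
     in J although K depends on J. *)
  have [K0 HK0] := HN _ J0; pose K := maxn K0 J.
  apply: (@le_trans _ _ (\sum_(0 <= j < J) (N%:R * (\sum_(j <= i < K) e i) + J.+1%:R^-1))).
    rewrite big_nat [leRHS]big_nat; apply: ler_sum => j /andP[_ jJ].
    apply: (HK0 K (leq_maxl _ _)); last by rewrite bj lexx.
    by rewrite (leq_trans (ltnW jJ))// leq_maxr.
  rewrite big_split /= -mulr_sumr lerD//.
    by rewrite ler_wpM2l// (le_trans (sum_tails_le _ _ e0)).
  rewrite sumr_const_nat subn0 -[leLHS]mulr_natl ler_pdivrMr ?ltr0n// mul1r.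
  by rewrite ler_nat.
exists (expR l); first exact: expR_gt0.
rewrite -(cvg_shiftn 1) /=.
rewrite (_ : (fun j => _) = expR \o (fun j => ln (g j))).
  by apply: continuous_cvg => //; exact: continuous_expR.
by apply/funext => j /=; rewrite lnK ?posrE// addn1.
Qed.

End DensityAlongGeometricSequence.

(** * Existence of the density *)

Section DensityLimit.
Context (R : realType) (n : nat).
Local Notation Rn := 'rV[R]_n.
Variables (l1 l2 : R) (mu : {measure set Rn -> \bar R}) (x : Rn) (d : nat).
Hypotheses (hl1 : 1 < l1) (hl12 : l1 < l2) (mud : doubling mu).
Hypothesis xS : Sdd l1 l2 mu d x.
Local Notation mass := (mass mu x).

Let xsupp : msupport mu x. Proof. by case: xS => -[]. Qed.

Lemma bernoulli (t : R) m : 0 <= t <= 1 -> 1 - m%:R * t <= (1 - t) ^+ m.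
Proof.
move=> /andP[t0 t1]; elim: m => [|m IH]; first by rewrite mul0r subr0 expr0.
rewrite exprS (le_trans _ (ler_wpM2l _ IH)) ?subr_ge0// -natr1.
have : 0 <= m%:R * t ^+ 2 by rewrite mulr_ge0// exprn_ge0.
by rewrite expr2; lra.
Qed.

(** Writing ell for the limit along b^j, rounding r to nearby powers of b gives the bounds ell
    b^(1+d) and ell b^(-1-2d); their quotient is b^-(3d+2). *)
Lemma density_sandwich b : 0 < b < 1 -> exists2 L : R, 0 < L & exists2 r0, 0 < r0 &
  forall r, 0 < r < r0 -> L <= r ^- d * mass r <= L / b ^+ (3 * d + 2).
Proof.
move=> b01; have /andP[b0 b1] := b01.
have [L L0 HL] := smooth_density_cvg hl1 hl12 mud b01 xS.
have bd : 0 < b ^+ d by rewrite exprn_gt0.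
have h1 : 0 < L * (b^-1 - 1) by rewrite mulr_gt0// subr_gt0 invf_gt1.
have h2 : 0 < L * (1 - b) by rewrite mulr_gt0// subr_gt0.
(* This tolerance traps the smoothed density between L b and L / b. *)
have h3 : 0 < Num.min (L * (b^-1 - 1)) (L * (1 - b)) by rewrite lt_min h1.
have /cvgrPdist_lt/(_ _ h3)[J _ HJ] := HL.
have fJ j : (J <= j)%N -> L * b <= smooth mu x b (b ^+ j) / (b ^+ d) ^+ j <= L / b.
  move=> /HJ /=; rewrite lt_min !ltr_norml => /andP[/andP[? ?] /andP[? ?]].
  by apply/andP; split; lra.
exists (L * b * b ^+ d); first by rewrite !mulr_gt0.
exists (b ^+ J.+1); first by rewrite exprn_gt0.
move=> r /andP[r0 rJ].
have [|j /andP[jr rj]] := @geometric_bracket _ _ r b01.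
  by rewrite r0 (le_trans (ltW rJ))// exprn_ile1// ltW.
have Jj : (J < j)%N.
  by have := lt_trans jr rJ; rewrite ltr_iXn2l// ltnS.
have rd : 0 < r ^+ d by rewrite exprn_gt0.
set p := b ^+ d in bd fJ *.
have p0 i : 0 < p ^+ i by rewrite exprn_gt0.
rewrite [r ^- d * _]mulrC; apply/andP; split.
  rewrite ler_pdivlMr//.
  apply: (@le_trans _ _ (L * b * p ^+ j.+1)).
    rewrite exprS mulrA ler_wpM2l ?mulr_ge0 ?(ltW L0) ?(ltW b0) ?(ltW bd)//.
    by rewrite /p exprAC lerXn2r ?nnegrE ?(ltW r0) ?exprn_ge0 ?(ltW b0).
  have /fJ/andP[+ _] : (J <= j.+1)%N by rewrite (leq_trans (ltnW Jj)).
  rewrite ler_pdivlMr// => /le_trans; apply.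
  rewrite (le_trans (smooth_le_mass mud xsupp b01 _)) ?exprn_gt0//.
  by rewrite (le_mass mud xsupp)// ltW.
(* The upper bound needs the next larger scale: after the shift r <= b b^j, hence mass r <= smooth
   (b^j). [Jj] excludes index 0. *)
case: j Jj jr rj => [//|j] Jj jr rj.
have /fJ/andP[_ +] : (J <= j)%N by [].
rewrite ler_pdivrMr// => fj.
rewrite ler_pdivrMr//.
apply: (@le_trans _ _ (smooth mu x b (b ^+ j))).
  apply: le_trans (mass_le_smooth mud xsupp b01 _); last by rewrite exprn_gt0.
  by rewrite -exprS (le_mass mud xsupp).
apply: (le_trans fj).
have -> : L / b * p ^+ j = L * b * p / b ^+ (3 * d + 2) * p ^+ j.+2.
  rewrite exprD mulnC exprM -/p !exprS expr0.
  by field; rewrite !gt_eqF.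
rewrite ler_wpM2l ?divr_ge0 ?mulr_ge0 ?exprn_ge0 ?(ltW L0) ?(ltW b0) ?(ltW bd)//.
by rewrite /p exprAC lerXn2r ?nnegrE ?(ltW r0) ?exprn_ge0 ?(ltW b0)// ltW.
Qed.

Lemma near_right_itv (r0 : R) : 0 < r0 -> \forall r \near 0^'+, 0 < r < r0.
Proof.
by move=> r00; near=> r; apply/andP; split=> //; near: r; exact: nbhs_right_lt.
Unshelve. all: by end_near. Qed.

(** Cauchy's criterion: the sandwich for b = 1/2 bounds the density by M, and the one for b close to
    1 makes its relative oscillation at most eta. *)
Lemma density_cvg_real : exists2 L : R, 0 < L &
  r ^- d * mass r @[r --> (0 : R)^'+] --> L.
Proof.
pose D r := r ^- d * mass r.
have half : 0 < (2^-1 : R) < 1 by rewrite invr_gt0 ltr0n invf_lt1// ltr1n.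
have [L1 L10 [r1 r10 H1]] := density_sandwich half.
set M := L1 / _ in H1.
have M0 : 0 < M by rewrite divr_gt0// exprn_gt0// invr_gt0.
have : cvg (D r @[r --> (0 : R)^'+]).
  apply: cauchy_cvg; apply: cauchy_exP => e e0.
  pose m := (3 * d + 2)%N.
  pose eta := e / (M * 2).
  have eta0 : 0 < eta by rewrite divr_gt0// mulr_gt0.
  (* Then (1 - t)^m >= 1 - m t >= 1/(1 + eta) by Bernoulli's inequality. *)
  pose t := eta / ((1 + eta) * (1 + m%:R)).
  have e1 : 0 < 1 + eta by rewrite addr_gt0.
  have m1 : 0 < 1 + m%:R :> R by rewrite ltr_wpDr.
  have t0 : 0 < t by rewrite divr_gt0// mulr_gt0.
  have tm : m%:R * t <= eta / (1 + eta).
    rewrite (_ : m%:R * t = eta / (1 + eta) * (m%:R / (1 + m%:R))); last first.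
      by rewrite /t; field; rewrite !gt_eqF.
    rewrite ler_piMr ?(ltW (divr_gt0 eta0 e1))//.
    by rewrite ler_pdivrMr// mul1r lerDr.
  have t1 : t < 1.
    rewrite ltr_pdivrMr ?mulr_gt0// mul1r.
    apply: (@lt_le_trans _ _ (1 + eta)); first by rewrite ltrDr.
    by rewrite ler_peMr ?addr_ge0 ?(ltW eta0)// lerDl.
  have b01 : 0 < 1 - t < 1 by rewrite subr_gt0 t1 gtrBl.
  have [L L0 [r0 r00 H]] := density_sandwich b01.
  have Hbd : L / (1 - t) ^+ m <= (1 + eta) * L.
    rewrite ler_pdivrMr ?exprn_gt0 ?subr_gt0// mulrAC ler_peMl ?(ltW L0)//.
    have tt : 0 <= t <= 1 by rewrite !ltW.
    rewrite (le_trans _ (ler_wpM2l _ (bernoulli m tt))) ?addr_ge0 ?(ltW eta0)//.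
    rewrite (@le_trans _ _ ((1 + eta) * (1 - eta / (1 + eta))))//.
      by rewrite mulrBr mulr1 mulrCA mulfV ?mulr1 ?addrK// gt_eqF// addr_gt0.
    by rewrite ler_wpM2l ?addr_ge0 ?(ltW eta0)// lerD2l lerN2.
  have close r r' : 0 < r < Num.min r0 r1 -> 0 < r' < Num.min r0 r1 -> D r - D r' <= e / 2.
    move=> /andP[rg +] /andP[r'g +]; rewrite !lt_min => /andP[rr0 rr1] /andP[r'r0 r'r1].
    have /andP[_ h1] := H r (introT andP (conj rg rr0)).
    have /andP[h2 _] := H r' (introT andP (conj r'g r'r0)).
    have /andP[_ h3] := H1 r' (introT andP (conj r'g r'r1)).
    have h4 : D r <= (1 + eta) * D r'.
      apply: (le_trans h1); apply: (le_trans Hbd).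
      by rewrite ler_wpM2l ?addr_ge0 ?(ltW eta0).
    have h5 : eta * D r' <= eta * M by rewrite ler_wpM2l ?(ltW eta0).
    have h6 : eta * M = e / 2 by rewrite /eta; field; rewrite gt_eqF.
    by lra.
  have rm0 : 0 < Num.min r0 r1 by rewrite lt_min r00.
  exists (D (Num.min r0 r1 / 2)).
  have hr : 0 < Num.min r0 r1 / 2 < Num.min r0 r1.
    by rewrite divr_gt0//= ltr_pdivrMr// ltr_pMr// ltr1n.
  rewrite /fmapE /=; apply: filterS (near_right_itv rm0) => r rr.
  rewrite -ball_normE /=.
  have := close _ _ rr hr; have := close _ _ hr rr; move: (D r) (D _) => u v.
  by move=> ? ?; rewrite ltr_norml; apply/andP; split; lra.
move=> /cvg_ex[L HL]; exists L => //.
apply: (lt_le_trans L10); apply: (cvgr_to_ge HL).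
by apply: filterS (near_right_itv r10) => r /H1/andP[].
Qed.

Lemma density_cvg : exists2 L : R, 0 < L &
  density_ratio mu d x r @[r --> (0 : R)^'+] --> L%:E.
Proof.
have [L L0 HL] := density_cvg_real; exists L => //.
rewrite (_ : density_ratio mu d x = (fun r => (r ^- d * mass r)%:E)); last first.
  by apply/funext => r; rewrite /density_ratio (massE mud xsupp) EFinM.
by apply: cvg_EFin => //; exact: nearW.
Qed.

End DensityLimit.

(** * Outer regularity and the Vitali covering lemma *)

Section OuterRegularity.
Context (R : realType) (n : nat).
Local Notation Rn := 'rV[R]_n.
Variable nu : {measure set Rn -> \bar R}.
Hypothesis nuT : (nu setT < +oo)%E.
Local Open Scope ereal_scope.

(* The symmetric formulation makes stability under complements trivial. *)
Definition separable_by_open (A : set Rn) := forall e : R, (0 < e)%R ->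
  exists U V : set Rn, [/\ open U, open V, A `<=` U, ~` A `<=` V & nu (U `&` V) <= e%:E].

Lemma decreasing_measure_small (F : nat -> set Rn) (e : R) : (0 < e)%R ->
  (forall i, measurable (F i)) -> nonincreasing_seq F -> nu (\bigcap_i F i) < e%:E ->
  exists N : nat, nu (F N) <= e%:E.
Proof.
move=> e0 mF dF Fe.
have F0 : nu (F 0%N) < +oo.
  by apply: le_lt_trans nuT; apply: le_measure; rewrite ?inE.
have cF := nonincreasing_cvg_mu F0 mF (bigcap_measurable (ex_intro _ 0%N I) (fun i _ => mF i)) dF.
have fF i : nu (F i) \is a fin_num.
  by rewrite ge0_fin_numE//; apply: le_lt_trans nuT; apply: le_measure; rewrite ?inE.
have [N _ HN] : \forall i \near \oo, nu (F i) < e%:E.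
  have H : (nu \o F @ \oo) [set y : \bar R | y < e%:E].
    by apply: cF; apply: open_nbhs_nbhs; split; [exact: open_ereal_lt_ereal|exact: Fe].
  exact: H.
by exists N; apply/ltW/HN => /=.
Qed.

(** The open sets {g < 1/(i+1)} contain the complement of A = {g > 0}, and their traces on A
    decrease to the empty set. *)
Lemma open_separable (A : set Rn) : open A -> separable_by_open A.
Proof.
move=> oA e e0; have [g [gc g0] AE] := open_positivity oA.
pose V i := [set z | (g z < i.+1%:R^-1)%R].
have oV i : open (V i).
  rewrite (_ : V i = g @^-1` [set t | (t < i.+1%:R^-1)%R])//.
  by apply: open_comp; [move=> z _; exact: gc|exact: open_lt].
have [||||N HN] := @decreasing_measure_small (fun i => A `&` V i) e.
- exact: e0.
- by move=> i; apply: measurableI; exact: open_Borel.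
- move=> i j ij; apply/subsetPset => z [Az Vz]; split=> //.
  by apply: (lt_le_trans Vz); rewrite lef_pV2 ?posrE ?ltr0n// ler_nat.
- rewrite (_ : \bigcap_i _ = set0) ?measure0 ?lte_fin//.
  rewrite -subset0 => z H; have [] := H 0%N I; rewrite {1}AE /= => gz _.
  have [_] := H (Num.bound (g z)^-1) I; rewrite /V /= ltNge => /negP; apply.
  rewrite invf_ple ?posrE ?ltr0n//; apply/ltW; apply: (lt_trans (archi_boundP _)).
    by rewrite invr_ge0 ltW.
  by rewrite ltr_nat.
exists A, (V N); split=> // z; rewrite {1}AE /= => /negP; rewrite -leNgt => gz.
by rewrite /V /=; apply: (le_lt_trans gz); rewrite invr_gt0 ltr0n.
Qed.

(** For a countable union the intersection of all V_i need not be open, so finite intersections are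
    used; continuity from above makes one of them good enough, the full intersection having error at
    most e/2 < e. *)
Lemma Borel_separable (A : set Rn) : measurable A -> separable_by_open A.
Proof.
move: A; apply: smallest_sub; last exact: open_separable.
split.
- by apply: open_separable; exact: open0.
- move=> A sA e /sA[U [V [oU oV AU AV UV]]]; exists V, U; rewrite setTD setCK setIC.
  by split.
move=> F sF e e0.
have e20 : (0 < e / 2)%R by rewrite divr_gt0.
have es i : (0 < e / 2 / (2 ^ i.+1)%:R)%R by rewrite divr_gt0// ltr0n expn_gt0.
have /choice[U /choice[V UV]] := fun i => sF i _ (es i).
pose W := \bigcup_i U i; pose Z N := \bigcap_(i in `I_N.+1) V i.
have oW : open W by apply: bigcup_open => i _; have [] := UV i.
have oZ N : open (Z N).
  rewrite /Z; elim: N => [|N IH].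
    rewrite (_ : \bigcap_(i in _) _ = V 0%N); first by have [] := UV 0%N.
    apply/seteqP; split=> [z /(_ 0%N)|z Vz [|//]//]; first by apply.
  rewrite (_ : \bigcap_(i in _) _ = (\bigcap_(i in `I_N.+1) V i) `&` V N.+1).
    by apply: openI => //; have [] := UV N.+1.
  apply/seteqP; split=> [z H|z [H1 H2] i /=].
    by split=> [i /= iN|]; apply: H => //=; exact: leqW.
  by rewrite ltnS leq_eqVlt => /orP[/eqP->//|iN]; exact: H1.
have [||||N HN] := @decreasing_measure_small (fun N => W `&` Z N) e.
- exact: e0.
- by move=> i; apply: measurableI; exact: open_Borel.
- move=> i j ij; apply/subsetPset => z [Wz Vz]; split=> // k /= ki.
  by apply: Vz => /=; exact: leq_trans ij.
- apply: (@le_lt_trans _ _ (e / 2)%:E); last by rewrite lte_fin ltr_pdivrMr// ltr_pMr// ltr1n.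
  apply: (@le_trans _ _ (\sum_(0 <= i <oo) nu (U i `&` V i))).
    apply: measure_sigma_subadditive => //.
    + by move=> i; have [oU oV _ _ _] := UV i; apply: measurableI; exact: open_Borel.
    + apply: bigcap_measurable; first by exists 0%N.
      by move=> i _; apply: measurableI; exact: open_Borel.
    + move=> z H; have [[i _ Uz] _] := H 0%N I; exists i => //; split=> //.
      by have [_] := H i I; apply => /=.
  apply: (le_trans (lee_nneseries (v := fun i => (e / 2 / (2 ^ i.+1)%:R)%:E) _ _)).
  - by move=> i _ _.
  - by move=> i _; have [] := UV i.
  - by apply: epsilon_trick0; exact: ltW.
exists W, (Z N); split=> //.
- by move=> z [i _ Fz]; exists i => //; have [_ _ H _ _] := UV i; exact: H.
- move=> z Fz i _; have [_ _ _ H _] := UV i; apply: H => Fiz; apply: Fz.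
  by exists i.
Qed.

End OuterRegularity.

Section OuterRegularityNull.
Context (R : realType) (n : nat).
Local Notation Rn := 'rV[R]_n.
Variable mu : {measure set Rn -> \bar R}.
Local Open Scope ereal_scope.

(** The separation lemma needs a finite measure, here mu restricted to D. The part of U outside B
    lies in U and V, hence is small, and B itself is null. *)
Lemma null_outer_open (D B : set Rn) (e : R) : open D -> mu D < +oo ->
  measurable B -> mu B = 0 -> (0 < e)%R ->
  exists U : set Rn, [/\ open U, B `&` D `<=` U & mu U <= e%:E].
Proof.
move=> oD Dfin mB B0 e0; have mD := open_Borel oD.
have nT : mrestr mu mD setT < +oo by rewrite /mrestr setTI.
have [U [V [oU oV BU BV UV]]] := Borel_separable nT mB e0.
exists (U `&` D); split; [exact: openI|by move=> z [/BU Uz Dz]|].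
apply: (@le_trans _ _ (mu (B `|` ((U `&` V) `&` D)))).
  apply: le_measure; rewrite ?inE; first by apply: measurableI => //; exact: open_Borel.
    by apply: measurableU => //; do 2 apply: measurableI => //; exact: open_Borel.
  move=> z [Uz Dz]; have [Bz|nBz] := pselect (B z); [by left|right].
  by split=> //; split=> //; exact: BV.
have mUVD : measurable ((U `&` V) `&` D).
  by do 2 apply: measurableI => //; exact: open_Borel.
apply: (le_trans (measureU2 _ mB mUVD)).
rewrite -[e%:E]add0e; apply: leeD; last exact: UV.
by rewrite le_eqVlt; apply/orP; left; apply/eqP; exact: B0.
Qed.

Lemma negligible_approx (P : set Rn) :
  (forall e : R, (0 < e)%R -> exists G : set Rn,
     [/\ measurable G, P `<=` G & mu G <= e%:E]) -> mu.-negligible P.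
Proof.
move=> H; have /choice[G HG] := fun p : nat => H p.+1%:R^-1%R (ltac:(by rewrite invr_gt0)).
have mG i : measurable (G i) by have [] := HG i.
have mGG : measurable (\bigcap_i G i) by apply: bigcap_measurable => //; exists 0%N.
exists (\bigcap_i G i); split=> //; last by move=> z Pz i _; have [_ PG _] := HG i; exact: PG.
apply/eqP; rewrite eq_le measure_ge0 andbT; apply/lee_addgt0Pr => e e0; rewrite add0e.
pose p := Num.bound e^-1.
apply: (@le_trans _ _ (mu (G p))).
  by apply: le_measure; rewrite ?inE// => z; apply.
have [_ _ /le_trans] := HG p; apply; rewrite lee_fin invf_ple ?posrE//.
apply/ltW; apply: (lt_trans (archi_boundP _)); first by rewrite invr_ge0 ltW.
by rewrite ltr_nat.
Qed.

End OuterRegularityNull.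

(** * A Vitali covering lemma for Euclidean balls *)

Section Vitali.
Context (R : realType) (n : nat).
Local Notation Rn := 'rV[R]_n.

(** Each ball contains a rational point: coordinate errors at most p.2 / (n + 1) keep the Euclidean
    error below p.2, also for n = 0. *)
Lemma disjoint_eballs_countable (w : set (Rn * R)) :
  (forall p, w p -> 0 < p.2) -> trivIset w (fun p => eball p.1 p.2) -> countable w.
Proof.
move=> w0 wd.
have H (p : Rn * R) : exists q : 'rV[rat]_n, w p -> eball p.1 p.2 (map_mx ratr q).
  have [wp|] := pselect (w p); last by exists 0.
  have p0 := w0 _ wp; pose e := p.2 / n.+1%:R.
  have e0 : 0 < e by rewrite divr_gt0.
  have Hj j : exists q : rat, p.1 ord0 j < ratr q < p.1 ord0 j + e.
    have [q] := @rat_in_itvoo R (p.1 ord0 j) (p.1 ord0 j + e) (ltac:(by rewrite ltrDl)).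
    by rewrite in_itv /= => ?; exists q.
  have [q Hq] := choice Hj; exists (\row_j q j) => _; rewrite /eball /=.
  apply: (le_lt_trans (enorm_le_norm _)).
  apply: (@le_lt_trans _ _ (n%:R * e)).
    rewrite ler_wpM2l// leNgt; apply/negP => /(row_norm_gt (ltW e0))[j].
    rewrite !mxE ltNge => /negP; apply.
    by have /andP[? ?] := Hq j; rewrite ger0_norm ?subr_ge0 ?ltW// ltrBlDl.
  rewrite /e mulrCA gtr_pMr// ltr_pdivrMr// mul1r ltr_nat//.
have [q Hq] := choice H.
apply/countable_injP; exists (fun p => pickle (q p)) => p p' /set_mem wp /set_mem wp'.
move=> /(pcan_inj pickleK) qq; apply: (wd p p' wp wp').
by exists (map_mx ratr (q p)); split; [exact: Hq|rewrite qq; exact: Hq].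
Qed.

(* Zorn's lemma is applied to the disjoint subfamilies [w] such that every ball
   of the family that meets a ball of [w] meets one of at least half its radius. *)
Lemma vitali_eball (V : set (Rn * R)) (M : R) : (forall p, V p -> 0 < p.2 <= M) ->
  exists w : set (Rn * R), [/\ w `<=` V, trivIset w (fun p => eball p.1 p.2) &
    forall p, V p -> exists2 q, w q & eball q.1 (3 * q.2) p.1].
Proof.
move=> V0.
pose meet (p q : Rn * R) := eball p.1 p.2 `&` eball q.1 q.2 !=set0.
pose P (w : set (Rn * R)) := [/\ w `<=` V, trivIset w (fun p => eball p.1 p.2) &
  forall p q, V p -> w q -> meet p q -> exists q', [/\ w q', meet p q' & p.2 <= 2 * q'.2]].
have [w [[wV wd wP] wmax]] : exists w, P w /\ forall w', w `<` w' -> ~ P w'.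
  apply: Zorn_bigcup => F FP Ft; split.
  - by move=> p [w /FP[wV _ _] /wV].
  - move=> p q [w Fw wp] [w' Fw' w'q]; have [ww|ww] := Ft _ _ Fw Fw'.
      by have [_ + _] := FP _ Fw'; apply=> //; exact: ww.
    by have [_ + _] := FP _ Fw; apply=> //; exact: ww.
  - move=> p q Vp [w Fw wq] pq; have [_ _ H] := FP _ Fw.
    by have [q' [wq' ? ?]] := H _ _ Vp wq pq; exists q'; split=> //; exists w.
exists w; split=> // p Vp.
have [[q wq pq]|nomeet] := pselect (exists2 q, w q & meet p q).
  (* Only the centre of p has to be covered, and its distance to that of q' is below p.2 + q'.2 <= 3
     q'.2; hence the factor 3. *)
  have [q' [wq' [z [z1 z2]] pq']] := wP _ _ Vp wq pq; exists q' => //.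
  move: z1 z2; rewrite /eball /= => z1 z2.
  apply: (le_lt_trans (enorm_distD z _ _)); rewrite enorm_distC.
  by have : p.2 <= 2 * q'.2 := pq'; move: z1 z2; set a := enorm _; set c := enorm _; lra.
exfalso.
(* Among the balls disjoint from the whole of w, one of more than half the supremal radius can be
   added, against maximality. *)
pose W := [set p | V p /\ forall q, w q -> ~ meet p q].
have Wp : W p by split=> // q wq pq; apply: nomeet; exists q.
have [s sE] : exists s : R, s = sup [set p.2 | p in W] by exists (sup [set p.2 | p in W]).
have hs : has_sup [set p.2 | p in W].
  split; first by exists p.2, p.
  by exists M => _ [q [/V0/andP[_ ?] _] <-].
have s0 : 0 < s.
  rewrite sE; have /andP[p0 _] := V0 _ Vp; apply: (lt_le_trans p0).
  by apply: ub_le_sup; [exact: hs.2|exists p].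
have [_ [q Wq <-] sq] : exists2 r, [set p.2 | p in W] r & s / 2 < r.
  by apply: sup_gt; [exact: hs.1|rewrite -sE ltr_pdivrMr// ltr_pMr// ltr1n].
have Wle u : W u -> u.2 <= 2 * q.2.
  move=> Wu; apply: (@le_trans _ _ s); first by rewrite sE; apply: ub_le_sup; [exact: hs.2|exists u].
  by move: sq; rewrite ltr_pdivrMr// mulrC => /ltW.
have [Vq nq] := Wq; have /andP[q0 _] := V0 _ Vq.
have selfmeet u : V u -> meet u u.
  by move=> /V0/andP[u0 _]; exists u.1; split; rewrite /eball /= subrr enorm0.
have nwq : ~ w q by move=> wq; exact: (nq _ wq (selfmeet _ Vq)).
apply: (wmax (w `|` [set q])); first by split; [by left|move=> H; apply: nwq; apply: H; right].
split.
- by move=> u [/wV//|->].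
- move=> u v [wu|->] [wv|->] // uv.
  + exact: wd.
  + by exfalso; apply: (nq _ wu); rewrite /meet setIC.
  + by exfalso; apply: (nq _ wv).
- move=> u v Vu wv uv.
  have [[v' wv' uv']|nu] := pselect (exists2 v', w v' & meet u v').
    by have [q' [? ? ?]] := wP _ _ Vu wv' uv'; exists q'; split=> //; left.
  case: wv => [wv|vE]; first by exfalso; apply: nu; exists v.
  exists q; split; [by right|by rewrite -vE|].
  by apply: Wle; split=> // v' wv' uv'; apply: nu; exists v'.
Qed.

End Vitali.

(** * Comparison of null sets *)

Section NullSetComparison.
Context (R : realType) (n : nat).
Local Notation Rn := 'rV[R]_n.
Variable d : nat.
Hypothesis d0 : (0 < d)%N.
Local Open Scope ereal_scope.

Lemma diam_set0 : diam (@set0 Rn) = 0.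
Proof. by apply/eqP; rewrite eq_le diam_ge0 andbT; apply: diam_le. Qed.

Lemma diam_eball (x : Rn) (r : R) : (0 <= r)%R -> diam (eball x r) <= (2 * r)%:E.
Proof.
move=> r0; apply: diam_le; first by rewrite mulr_ge0.
rewrite /eball /= => y z yx zx; apply: (le_trans (enorm_distD x _ _)).
by rewrite (enorm_distC x z) mulr2n mulrDl mul1r lerD// ltW.
Qed.

Lemma hausdorff_eq0 (A : set Rn) :
  (forall e : R, (0 < e)%R -> exists F : nat -> set Rn,
     [/\ A `<=` \bigcup_i F i, forall i, diam (F i) <= e%:E &
         \sum_(0 <= i <oo) diam (F i) ^+ d <= e%:E]) -> hausdorff d A = 0.
Proof.
move=> H; apply/eqP; rewrite eq_le hausdorff_ge0 andbT.
apply: ge_ereal_sup => _ [delta /= delta0 <-].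
apply/lee_addgt0Pr => e e0; rewrite add0e.
have m0 : (0 < Num.min delta e)%R by rewrite lt_min delta0.
have [F [AF dF sF]] := H _ m0.
apply: (@le_trans _ _ (\sum_(0 <= i <oo) diam (F i) ^+ d)).
  apply: ereal_inf_lbound; exists F => //; split=> // i.
  by apply: (le_trans (dF i)); rewrite lee_fin ge_min lexx.
by apply: (le_trans sF); rewrite lee_fin ge_min lexx orbT.
Qed.

Lemma hausdorff_eq0_cover (A : set Rn) (delta e : R) : hausdorff d A = 0 ->
  (0 < delta)%R -> (0 < e)%R -> exists F : nat -> set Rn,
     [/\ A `<=` \bigcup_i F i, forall i, diam (F i) <= delta%:E &
         \sum_(0 <= i <oo) diam (F i) ^+ d <= e%:E].
Proof.
move=> A0 delta0 e0.
have : hausdorff_pre d delta A < e%:E.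
  by apply: le_lt_trans (hausdorff_pre_le d A delta0) _; rewrite A0 lte_fin.
by move=> /ereal_inf_lt[_ [F [AF dF] <-] /ltW sF]; exists F.
Qed.

Lemma hausdorff_bigcup_eq0 (A : nat -> set Rn) :
  (forall m, hausdorff d (A m) = 0) -> hausdorff d (\bigcup_m A m) = 0.
Proof.
move=> A0; apply: hausdorff_eq0 => e e0.
have es m : (0 < e / (2 ^ m.+1)%:R)%R by rewrite divr_gt0// ltr0n expn_gt0.
have /choice[F HF] := fun m => hausdorff_eq0_cover (A0 m) e0 (es m).
have [f fs fE] := nneseries_pair R.
exists (fun k => F (f k).1 (f k).2); split.
- move=> x [m _ Ax]; have [AF _ _] := HF m; have [i _ Fx] := AF _ Ax.
  by have [k fk] := fs m i; exists k => //; rewrite fk.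
- by move=> k; have [_ + _] := HF (f k).1; apply.
- rewrite (fE (fun i j => diam (F i j) ^+ d)); last by move=> i j; exact/expe_ge0/diam_ge0.
  apply: (le_trans (lee_nneseries (v := fun m => (e / (2 ^ m.+1)%:R)%:E) _ _)).
  + by move=> i _ _; apply: nneseries_ge0 => *; exact/expe_ge0/diam_ge0.
  + by move=> i _; have [] := HF i.
  + by apply: epsilon_trick0; exact: ltW.
Qed.

Lemma hausdorff_negligible_bigcup (A : nat -> set Rn) :
  (forall m, (hausdorff d).-negligible (A m)) -> (hausdorff d).-negligible (\bigcup_m A m).
Proof.
move=> /choice[B HB]; exists (\bigcup_m B m); split.
- by apply: bigcupT_measurable => m; have [] := HB m.
- by apply: hausdorff_bigcup_eq0 => m; have [] := HB m.
- by move=> x [m _ Ax]; exists m => //; have [_ _] := HB m; exact.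
Qed.

(** Open covering sets have Borel unions, and the intersection of these over p is a Borel hull of P
    of measure zero. *)
Lemma hausdorff_negligible_approx (P : set Rn) :
  (forall e : R, (0 < e)%R -> exists F : nat -> set Rn,
     [/\ forall i, open (F i), P `<=` \bigcup_i F i, forall i, diam (F i) <= e%:E &
         \sum_(0 <= i <oo) diam (F i) ^+ d <= e%:E]) -> (hausdorff d).-negligible P.
Proof.
move=> H; have /choice[F HF] := fun p : nat => H p.+1%:R^-1%R (ltac:(by rewrite invr_gt0)).
exists (\bigcap_p \bigcup_i F p i); split.
- apply: bigcap_measurable; first by exists 0%N.
  move=> p _; apply: bigcupT_measurable => i; apply: open_Borel.
  by have [] := HF p.
- apply: hausdorff_eq0 => e e0; pose p := Num.bound e^-1.
  have pe : (p.+1%:R^-1 <= e)%R.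
    rewrite invf_ple ?posrE//; apply/ltW; apply: (lt_trans (archi_boundP _)).
      by rewrite invr_ge0 ltW.
    by rewrite ltr_nat.
  have [_ _ dF sF] := HF p; exists (F p); split.
  + by move=> x; exact.
  + by move=> i; apply: (le_trans (dF i)); rewrite lee_fin.
  + by apply: (le_trans sF); rewrite lee_fin.
- by move=> x Px p _; have [_ + _ _] := HF p; exact.
Qed.

Variable mu : {measure set Rn -> \bar R}.

Lemma hausdorff_negligible_lower_mass (P B D : set Rn) (M r1 : R) :
  open D -> mu D < +oo -> measurable B -> mu B = 0 -> P `<=` B `&` D ->
  (0 < M)%R -> (0 < r1)%R ->
  (forall x r, P x -> (0 < r < r1)%R -> (r ^+ d / M)%:E <= mu (eball x r)) ->
  (hausdorff d).-negligible P.
Proof.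
move=> oD Dfin mB B0 PBD M0 r10 lowP; apply: hausdorff_negligible_approx => e e0.
(* A tripled ball has diameter at most 6 r, and (6 r)^d = C (r^d / M) <= C mu(B(x, r)). The disjoint
   original balls lie in U, of measure at most e / C. *)
pose C := (6 ^+ d * M)%R.
have C0 : (0 < C)%R by rewrite mulr_gt0// exprn_gt0.
have eC0 : (0 < e / C)%R by rewrite divr_gt0.
have [U [oU PU Ue]] := null_outer_open oD Dfin mB B0 eC0.
pose rho := Num.min (e / 6)%R (r1 / 2)%R.
have rho0 : (0 < rho)%R by rewrite lt_min !divr_gt0.
pose V := [set p : Rn * R | [/\ P p.1, (0 < p.2 <= rho)%R & eball p.1 p.2 `<=` U]].
have [|w [wV wd wP]] := @vitali_eball R n V rho; first by move=> p [].
have w0 p : w p -> (0 < p.2)%R by move=> /wV[_ /andP[]].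
have /countable_injP[f fi] := disjoint_eballs_countable w0 wd.
pose F k := \bigcup_(p in [set p | w p /\ f p = k]) eball p.1 (3 * p.2).
pose G k := \bigcup_(p in [set p | w p /\ f p = k]) eball p.1 p.2.
have FG k : F k = set0 \/ exists p, [/\ w p, F k = eball p.1 (3 * p.2) & G k = eball p.1 p.2].
  have [[p [wp pk]]|none] := pselect (exists p, w p /\ f p = k); last first.
    by left; rewrite -subset0 => z [p wp _]; apply: none; exists p.
  right; exists p; rewrite /F /G (_ : [set q | _] = [set p]) ?bigcup_set1//.
  apply/seteqP; split=> [q [wq qk]|q -> //].
  by apply: fi; rewrite ?inE// qk.
have oF k : open (F k) by apply: bigcup_open => p _; exact: eball_open.
have mG k : measurable (G k).
  by apply: open_Borel; apply: bigcup_open => p _; exact: eball_open.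
have dF k : diam (F k) <= e%:E /\ diam (F k) ^+ d <= C%:E * mu (G k).
  have [->|[p [wp -> ->]]] := FG k.
    rewrite diam_set0 lee_fin ltW//; split=> //.
    by move: d0; case: (d) => // d' _; rewrite expeS mul0e mule_ge0// lee_fin ltW.
  have [Pp /andP[p0 prho] _] := wV _ wp.
  have dp : diam (eball p.1 (3 * p.2)) <= (6 * p.2)%:E.
    apply: (le_trans (diam_eball _ _)); first by rewrite mulr_ge0// ltW.
    by rewrite lee_fin; lra.
  have /andP[pe pr] : (p.2 <= e / 6)%R && (p.2 <= r1 / 2)%R by rewrite -le_min.
  split; first by apply: (le_trans dp); rewrite lee_fin; lra.
  apply: (le_trans (lee_expe _ (diam_ge0 _) dp)).
  apply: (@le_trans _ _ (C%:E * (p.2 ^+ d / M)%:E)).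
    rewrite -EFinM -EFin_expe lee_fin exprMn /C.
    by rewrite -mulrA [(M * _)%R]mulrCA mulfV ?mulr1// gt_eqF.
  rewrite lee_pmul2l ?lte_fin//; apply: lowP => //.
  by rewrite p0; lra.
exists F; split=> //.
- move=> x Px; have Ux := PU _ (PBD _ Px).
  have /nbhs_ballP[s /= s0 sU] := open_nbhs_nbhs (conj oU Ux).
  have Vx : V (x, Num.min s rho).
    split=> //=; first by rewrite lt_min s0 rho0 ge_min lexx orbT.
    move=> z; rewrite /eball /= lt_min => /andP[zs _]; apply: sU.
    by rewrite -ball_normE /= distrC; apply: le_lt_trans zs; exact: le_norm_enorm.
  by have [q wq xq] := wP _ Vx; exists (f q) => //; exists q.
- by move=> k; have [] := dF k.
apply: (@le_trans _ _ (\sum_(0 <= k <oo) C%:E * mu (G k))).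
  by apply: lee_nneseries => [k _ _|k _]; [exact/expe_ge0/diam_ge0|have [] := dF k].
rewrite nneseriesZl; last by move=> k _; exact: measure_ge0.
rewrite -measure_semi_bigcup//; last 2 first.
- move=> i j _ _ [z [[p [wp pi] zp] [q [wq qj] zq]]].
  by rewrite -pi -qj (wd p q wp wq)//; exists z.
- by apply: bigcupT_measurable.
apply: (@le_trans _ _ (C%:E * (e / C)%:E)).
  rewrite lee_pmul2l ?lte_fin//; apply: (le_trans _ Ue).
  apply: le_measure; rewrite ?inE; [exact: bigcupT_measurable|exact: open_Borel|].
  by move=> z [k _ [p [wp _] zp]]; have [_ _] := wV _ wp; exact.
by rewrite -EFinM lee_fin mulrCA mulfV ?mulr1// gt_eqF.
Qed.

Lemma negligible_upper_mass (P B : set Rn) (M r1 : R) :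
  hausdorff d B = 0 -> P `<=` B -> (0 < M)%R -> (0 < r1)%R ->
  (forall x r, P x -> (0 < r < r1)%R -> mu (eball x r) <= (M * r ^+ d)%:E) ->
  mu.-negligible P.
Proof.
move=> B0 PB M0 r10 upP; apply: negligible_approx => e e0.
have C0 : (0 < 2 ^+ d + 1 :> R)%R by rewrite addr_gt0// exprn_gt0.
(* The diameters contribute M 2^d eps and the geometric correction terms M eps; together they make
   e. *)
pose eps := (e / (M * (2 ^+ d + 1)))%R.
have eps0 : (0 < eps)%R by rewrite divr_gt0// mulr_gt0.
(* Diameters c <= r1 / 4 keep the radius 2 c below r1; the ball is open, so radius c would not
   suffice. *)
have r4 : (0 < r1 / 4)%R by rewrite divr_gt0.
have [F [BF dF sF]] := hausdorff_eq0_cover B0 r4 eps0.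
have es i : (0 < eps / (2 ^ i.+1)%:R)%R by rewrite divr_gt0// ltr0n expn_gt0.
have HG i : exists G : set Rn, [/\ measurable G, P `&` F i `<=` G &
    mu G <= (M * 2 ^+ d)%:E * diam (F i) ^+ d + (M * eps / (2 ^ i.+1)%:R)%:E].
  have e1 : (0 <= M * eps / (2 ^ i.+1)%:R)%R by rewrite -mulrA ltW// mulr_gt0.
  have e2 : (0 <= M * 2 ^+ d)%R by rewrite mulr_ge0 ?exprn_ge0 ?(ltW M0).
  have dge : 0 <= (M * 2 ^+ d)%:E * diam (F i) ^+ d.
    by apply: mule_ge0; [rewrite lee_fin|exact/expe_ge0/diam_ge0].
  have [[x [Px Fx]]|none] := pselect (exists x, P x /\ F i x); last first.
    exists set0; split=> //; first by move=> x Hx; apply: none; exists x.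
    by rewrite measure0 adde_ge0.
  have dfin : diam (F i) \is a fin_num.
    by rewrite ge0_fin_numE ?diam_ge0//; apply: le_lt_trans (dF i) _; rewrite ltry.
  move: (dF i) (@diam_ge0 _ _ (F i)) (@le_diam _ _ (F i) ) dge.
  rewrite -(fineK dfin); set c := fine _; rewrite !lee_fin => cr c0 Hc dge.
  (* A set of diameter 0 contributes nothing to the sum, so it is covered by a tiny ball charged to
     the correction term; t^d <= t uses d >= 1. *)
  have [cE|cn0] := eqVneq c 0%R.
    pose t := Num.min 1%R (Num.min (r1 / 2)%R (eps / (2 ^ i.+1)%:R)%R).
    have t0 : (0 < t)%R by rewrite !lt_min ltr01 divr_gt0//=.
    have /and3P[t1 tr te] : [&& t <= 1, t <= r1 / 2 & t <= eps / (2 ^ i.+1)%:R]%R.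
      by rewrite -!le_min.
    exists (eball x t); split; first exact: eball_Borel.
      by move=> y [_ Fy]; have := Hc _ _ Fy Fx; rewrite lee_fin cE => /le_lt_trans; apply.
    apply: (@le_trans _ _ (M * t ^+ d)%:E); first by apply: upP => //; rewrite t0; lra.
    rewrite -[leLHS]add0e; apply: leeD.
      exact: dge.
    rewrite lee_fin -mulrA ler_wpM2l ?(ltW M0)// (le_trans _ te)//.
    by move: d0; case: (d) => // d' _; rewrite exprS ler_piMr ?(ltW t0)// exprn_ile1// ltW.
  have cgt : (0 < c)%R by rewrite lt_neqAle eq_sym cn0.
  exists (eball x (2 * c)); split; first exact: eball_Borel.
    move=> y [_ Fy]; rewrite /eball /=; have := Hc _ _ Fy Fx.
    by rewrite lee_fin => /le_lt_trans; apply; lra.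
  apply: (@le_trans _ _ (M * (2 * c) ^+ d)%:E).
    by apply: upP => //; apply/andP; split; lra.
  rewrite -EFin_expe -EFinM -EFinD lee_fin exprMn mulrA lerDl.
  exact: e1.
have /choice[G {}HG] := HG.
have mG i : measurable (G i) by have [] := HG i.
exists (\bigcup_i G i); split; first exact: bigcupT_measurable.
  move=> x Px; have [i _ Fx] := BF _ (PB _ Px); exists i => //.
  by have [_ H _] := HG i; exact: H.
apply: (@le_trans _ _ (\sum_(0 <= i <oo) mu (G i))).
  by apply: measure_sigma_subadditive => //; exact: bigcupT_measurable.
have dge i : 0 <= (M * 2 ^+ d)%:E * diam (F i) ^+ d.
  apply: mule_ge0; last exact/expe_ge0/diam_ge0.
  by rewrite lee_fin mulr_ge0 ?exprn_ge0 ?(ltW M0).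
apply: (le_trans (lee_nneseries (v := fun i => (M * 2 ^+ d)%:E * diam (F i) ^+ d +
    (M * eps / (2 ^ i.+1)%:R)%:E) _ _)) => [i _ _ //|i _|]; first by have [] := HG i.
apply: (le_trans (epsilon_trick _ dge _)); first by rewrite mulr_ge0// ltW.
rewrite nneseriesZl; last by move=> i _; exact/expe_ge0/diam_ge0.
apply: (@le_trans _ _ ((M * 2 ^+ d)%:E * eps%:E + (M * eps)%:E)).
  rewrite leeD2r// lee_wpmul2l// lee_fin mulr_ge0 ?exprn_ge0 ?(ltW M0)//.
rewrite -EFinM -EFinD lee_fin /eps le_eqVlt; apply/orP; left; apply/eqP.
by field; rewrite !gt_eqF.
Qed.

End NullSetComparison.

(** * Pieces with uniform density bounds *)

Section AbsoluteContinuity.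
Context (R : realType) (n : nat).
Local Notation Rn := 'rV[R]_n.
Variables (mu : {measure set Rn -> \bar R}) (d : nat).
Hypotheses (mud : doubling mu) (d0 : (0 < d)%N).

(** One index controls the radius and both constants, so the pieces increase with m. *)
Definition regular_points m : set Rn := [set x | msupport mu x /\
  forall r, 0 < r < m.+1%:R^-1 -> r ^+ d / m.+1%:R <= mass mu x r <= m.+1%:R * r ^+ d].

Lemma density_regular_points (x : Rn) (L : R) : msupport mu x -> 0 < L ->
  r ^- d * mass mu x r @[r --> (0 : R)^'+] --> L -> exists m, regular_points m x.
Proof.
move=> xS L0 HL.
have L2 : 0 < L / 2 by rewrite divr_gt0.
have /cvgrPdist_lt/(_ _ L2)[r0 /= r00 H] := HL.
(* Below r0 the density lies between L / 2 and 3 L / 2, hence between 1/m and m once m exceeds these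
   quantities. *)
pose M := Num.max r0^-1 (Num.max (2 * L) (2 / L)).
exists (Num.bound M); split=> // r /andP[rg rm].
have MB : M < (Num.bound M).+1%:R.
  by apply: (lt_trans (archi_boundP _)); rewrite ?ltr_nat// le_max invr_ge0 ltW.
move: MB; rewrite !gt_max; set m := _.+1 in rm * => /and3P[m1 m2 m3].
have mp : 0 < m%:R :> R by rewrite ltr0n.
have rr0 : r < r0 by apply: (lt_trans rm); rewrite invf_plt ?posrE.
have := H r _ rg; rewrite /= sub0r normrN gtr0_norm// => /(_ rr0).
have rd : 0 < r ^+ d by rewrite exprn_gt0.
rewrite ltr_norml mulrC => /andP[h1 h2].
have h3 : mass mu x r / r ^+ d <= m%:R by lra.
have h4 : m%:R^-1 <= mass mu x r / r ^+ d.
  apply: (@le_trans _ _ (L / 2)); last by lra.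
  by rewrite -[L / 2]invrK invf_div lef_pV2 ?posrE ?divr_gt0// ltW.
by rewrite -ler_pdivrMr// h3 andbT mulrC -ler_pdivlMr.
Qed.

Variable E : set Rn.
Hypothesis ES : forall x, E x -> exists m, regular_points m x.

Lemma mu_abs_cont_hausdorff : abs_cont_on mu (@hausdorff R n d) E.
Proof.
move=> A AE [B [mB B0 AB]].
rewrite (_ : A = \bigcup_m (A `&` regular_points m)); last first.
  rewrite -setI_bigcupr; apply/esym/setIidl => x /AE/ES[m ?].
  by exists m.
apply: negligible_bigcup => m.
apply: (@negligible_upper_mass R n d d0 mu _ B m.+1%:R m.+1%:R^-1) => //.
- by move=> x [/AB].
- move=> x r [_ [xS Hx]] rm; rewrite (massE mud xS) lee_fin.
  by have /andP[_] := Hx _ rm.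
Qed.

Lemma hausdorff_abs_cont_mu : abs_cont_on (@hausdorff R n d) mu E.
Proof.
move=> A AE [B [mB B0 AB]].
have [A0|/set0P[x0 Ax0]] := eqVneq A set0.
  exists set0; split=> //; last by rewrite A0.
  apply: hausdorff_eq0 => e e0; exists (fun=> set0); split=> //.
    by move=> i; rewrite diam_set0 lee_fin ltW.
  rewrite eseries0 ?lee_fin ?ltW// => i _ _; rewrite diam_set0.
  by move: d0; case: (d) => // k _; rewrite expeS mul0e.
(* The centre x0 lies in the support, where all balls have finite measure; this makes
   [null_outer_open] applicable on [eball x0 m%:R]. *)
have [_ [x0S _]] := ES (AE _ Ax0).
rewrite (_ : A = \bigcup_m (A `&` regular_points m `&` eball x0 m%:R)); last first.
  apply/seteqP; split=> [x Ax|x [m _ [[]]]//].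
  have [k [xS Hk]] := ES (AE _ Ax).
  (* Both the regular pieces and the balls around x0 increase with the index, so the maximum serves
     for both. *)
  pose N := maxn k (Num.bound (enorm (x - x0))); exists N => //; split; first split=> //.
    split=> // r /andP[r0 rN].
    have kN : k.+1%:R <= N.+1%:R :> R by rewrite ler_nat ltnS leq_maxl.
    have kp : 0 < k.+1%:R :> R by rewrite ltr0n.
    have Np : 0 < N.+1%:R :> R by rewrite ltr0n.
    have rd : 0 <= r ^+ d by rewrite exprn_ge0// ltW.
    have [|h1 h2] := andP (Hk r _).
      by rewrite r0 (lt_le_trans rN)// lef_pV2.
    rewrite (le_trans _ h1)/= ?ler_wpM2l ?lef_pV2//.
    by rewrite (le_trans h2)// ler_wpM2r.
  rewrite /eball /=; apply: (lt_le_trans (archi_boundP (enorm_ge0 _))).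
  by rewrite ler_nat leq_maxr.
apply: hausdorff_negligible_bigcup => // m.
apply: (@hausdorff_negligible_lower_mass R n d d0 mu _ B (eball x0 m%:R) m.+1%:R m.+1%:R^-1) => //.
- exact: eball_open.
- exact: (eball_lty mud x0S).
- by move=> x [[/AB]].
- move=> x r [[_ [xS Hx]] _] rm; rewrite (massE mud xS) lee_fin.
  by have /andP[] := Hx _ rm.
Qed.

End AbsoluteContinuity.
Local Open Scope ereal_scope.

Theorem mainTheorem3 (R : realType) (n : nat)
    (mu : {measure set 'rV[R]_n -> \bar R}) (l1 l2 : R)
    (mu_doubling : doubling mu) (hl1 : (1 < l1)%R) (hl12 : (l1 < l2)%R)
    (d : nat) (hd : (1 <= d <= n)%N) :
  (forall x, Sdd l1 l2 mu d x ->
     cvg (density_ratio mu d x r @[r --> (0%R : R)^'+]) /\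
     0 < theta mu d x < +oo) /\
  (forall (k : int)
     (E := [set x | Sdd l1 l2 mu d x /\
                    (((2 : R) ^ k)%R)%:E <= theta mu d x < (((2 : R) ^ (k + 1))%R)%:E]),
     abs_cont_on mu (@hausdorff R n d) E /\
     abs_cont_on (@hausdorff R n d) mu E).
Proof.
have /andP[d0 _] := hd; split=> [x xS|k E].
  have [L L0 HL] := density_cvg hl1 hl12 mu_doubling xS.
  split; first by apply/cvg_ex; exists L%:E.
  have -> : theta mu d x = L%:E by apply/cvg_lim => //; exact: ereal_hausdorff.
  by rewrite lte_fin L0 ltry.
have ES x : E x -> exists m, regular_points mu d m x.
  move=> [xS _]; have [L L0 HL] := density_cvg_real hl1 hl12 mu_doubling xS.
  by have [[xsupp _] _ _] := xS; exact: density_regular_points xsupp L0 HL.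
split; first exact: mu_abs_cont_hausdorff ES.
exact: hausdorff_abs_cont_mu ES.
Qed.
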